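(* Let $A \subset \mathbb{R}^{1+n}$ be a spectrum. Then $A$ is dual defective if and only if $A$ does not contain any iterated circuit.
   Context: Setting. Let $n\ge 1$. A spectrum (point configuration) is a finite family $A=\{\alpha_1,\dots,\alpha_N\}\subset\mathbb{R}^{1+n}$ (points need not be distinct), identified with the $(1+n)\times N$ matrix with columns $\alpha_1,\dots,\alpha_N$. It is assumed that this matrix has rank $1+n$ and that the all ones vector lies in its row span. The group $\mathrm{GL}_{1+n}(\mathbb{R})$ acts by left multiplication. Configurations are considered up to reordering of the columns. The codimension of $A$ is $N-n-1$. Discriminant variety. The space $(\mathbb{C}^\times)^A$ is the family of exponential sums $f(w)=\sum_{k=1}^N c_k e^{\langle w,\alpha_k\rangle}$, with $c_k\in\mathbb{C}^\times$; $f$ is identified with $(c_1,\dots,c_N)$. The dual variety $\check X_A\subset(\mathbb{C}^\times)^A$ is the set of all $f$ having a singular point, i.e. a point $w\in\mathbb{C}^{1+n}$ where $f$ and all its first partial derivatives vanish. $A$ is dual defective if $\check X_A$ has (complex) codimension at least $2$ in $(\mathbb{C}^\times)^A$, i.e. if $\check X_A$ contains no locally closed complex submanifold of $(\mathbb{C}^\times)^A$ of dimension $N-1$ (in particular, $A$ is dual defective if $\check X_A$ is empty). Iterated circuits. A configuration is a pyramid if all of its points but one are contained in a strict affine subspace of the affine hull of the configuration. A circuit is a configuration (satisfying the assumptions above, in some $\mathbb{R}^{1+n'}$ with $n'\geq 1$) of codimension $1$ which is not a pyramid. A configuration is upper diagonal if, after acting by $\mathrm{GL}_{1+n}(\mathbb{R})$,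 it can be written as $$\begin{pmatrix} 1&1&1&\cdots&1\\ 0&\tilde A_1&*&\cdots&*\\ 0&0&\tilde A_2&\cdots&*\\ \vdots&\vdots&\vdots&\ddots&\vdots\\ 0&0&0&\cdots&\tilde A_r\end{pmatrix},$$ where the first column is a single column, the entries of the top row are (rows of) ones, and $\tilde A_j$ is a matrix with $n_j\ge1$ rows, $n_1+\dots+n_r=n$. Its diagonal configurations are $A_j=\begin{pmatrix}1&1\\0&\tilde A_j\end{pmatrix}\subset\mathbb{R}^{1+n_j}$, $j=1,\dots,r$ (the points of $\tilde A_j$ together with the origin, with a top row of ones adjoined). An iterated circuit is an upper diagonal configuration all of whose diagonal configurations are circuits. $A$ contains an iterated circuit if some subfamily $A'\subset A$, of rank $1+n$, is an iterated circuit (with respect to the action of $\mathrm{GL}_{1+n}(\mathbb{R})$). *)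

(* Defs.v *)
From mathcomp Require Import all_boot all_order all_algebra.
From mathcomp Require Import perm complex.
From mathcomp Require Import all_classical all_reals all_analysis.

Set Implicit Arguments.
Unset Strict Implicit.
Unset Printing Implicit Defensive.

Import Order.TTheory GRing.Theory Num.Theory.
Import numFieldNormedType.Exports.

Local Open Scope classical_set_scope.
Local Open Scope ring_scope.
Local Open Scope complex_scope.

(* The complex numbers over R.  Stated at type numFieldType so that C R and
   row vectors over it inherit the normed module structures that
   normedtype puts on every numFieldType; derivatives and
   differentials over C R are then the complex ones. *)
Definition C (R : realType) : numFieldType := R[i].

Definition expC (R : realType) (z : C R) : C R :=
  (expR (complex.Re z) * cos (complex.Im z)) +i*
  (expR (complex.Re z) * sin (complex.Im z)).

(* A configuration of N points of R^m is a matrix whose columns are the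
   points; repeated columns are allowed. *)
Definition spectrum (R : realType) (m N : nat) (A : 'M[R]_(m, N)) : Prop :=
  \rank A = m /\ ((const_mx 1 : 'rV[R]_N) <= A)%MS.

Definition codim (R : realType) (n N : nat) (A : 'M[R]_(1 + n, N)) : nat :=
  (N - n - 1)%N.

(* f(w) = \sum_k c_k e^<w, alpha_k>, where <w, alpha_k> is the (bilinear)
   k-th entry of w *m A. *)
Definition exp_sum (R : realType) (m N : nat) (A : 'M[R]_(m, N))
    (c : 'rV[C R]_N) (w : 'rV[C R]_m) : C R :=
  \sum_(k < N) c 0 k *
    expC ((w *m (\matrix_(i, j) ((A i j)%:C : C R))) 0 k).

Definition singular_point (R : realType) (m : nat) (f : 'rV[C R]_m -> C R)
    (w : 'rV[C R]_m) : Prop :=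
  f w = 0 /\ forall i : 'I_m, is_derive w (delta_mx 0 i : 'rV[C R]_m) f 0.

Definition torus (R : realType) (N : nat) : set 'rV[C R]_N :=
  [set c | forall k : 'I_N, c 0 k != 0].

Definition dual_variety (R : realType) (m N : nat) (A : 'M[R]_(m, N)) :
    set 'rV[C R]_N :=
  [set c | torus c /\ exists w, singular_point (exp_sum A c) w].

Definition holomorphic_on (R : realType) (N M : nat) (U : set 'rV[C R]_N)
    (f : 'rV[C R]_N -> 'rV[C R]_M) : Prop :=
  forall z, U z -> differentiable f z.

(* Locally closed complex submanifolds of dimension d of C^N, by slice
   charts: near each of its points, M is carried by a biholomorphism
   phi : U -> V (with inverse psi) onto the part of V where the coordinates
   of index >= d vanish. *)
Definition complex_submanifold (R : realType) (N d : nat)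
    (M : set 'rV[C R]_N) : Prop :=
  (d <= N)%N /\
  forall p, M p ->
  exists (U V : set 'rV[C R]_N) (phi psi : 'rV[C R]_N -> 'rV[C R]_N),
    [/\ open U /\ U p, open V,
        holomorphic_on U phi /\ holomorphic_on V psi,
        (forall z, U z -> V (phi z) /\ psi (phi z) = z) /\
        (forall z, V z -> U (psi z) /\ phi (psi z) = z)
      & forall z, U z ->
          (M z <-> forall j : 'I_N, (d <= j)%N -> phi z 0 j = 0)].

(* Submanifolds of the torus, an open subset of C^N, are the submanifolds of
   C^N contained in it.  Since the empty set is a submanifold of every
   dimension, M has to be nonempty. *)
Definition dual_defective (R : realType) (m N : nat) (A : 'M[R]_(m, N)) :
    Prop :=
  ~ exists M : set 'rV[C R]_N,
      [/\ M !=set0, complex_submanifold (N - 1) M & M `<=` dual_variety A].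

Definition affine_subspace (R : realType) (m : nat) (S : set 'cV[R]_m) :
    Prop :=
  forall (x y : 'cV[R]_m) (t : R), S x -> S y -> S (t *: x + (1 - t) *: y).

Definition affine_hull (R : realType) (m N : nat) (A : 'M[R]_(m, N)) :
    set 'cV[R]_m :=
  [set x | exists l : 'cV[R]_N, \sum_(k < N) l k 0 = 1 /\ x = A *m l].

Definition pyramid (R : realType) (m N : nat) (A : 'M[R]_(m, N)) : Prop :=
  exists (k : 'I_N) (S : set 'cV[R]_m),
    [/\ affine_subspace S, S `<` affine_hull A
      & forall j : 'I_N, j != k -> S (col j A)].

Definition circuit (R : realType) (n N : nat) (A : 'M[R]_(1 + n, N)) : Prop :=
  [/\ (1 <= n)%N, spectrum A, codim A = 1%N & ~ pyramid A].

Definition equiv_config (R : realType) (m N : nat) (A B : 'M[R]_(m, N)) :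
    Prop :=
  exists (g : 'M[R]_m) (s : 'S_N), g \in unitmx /\ B = col_perm s (g *m A).

Definition diagonal_config (R : realType) (m q : nat) (T : 'M[R]_(m, q)) :
    'M[R]_(1 + m, 1 + q) :=
  block_mx (const_mx 1) (const_mx 1) 0 T.

Definition block_config (R : realType) (r : nat) (m q : 'I_r -> nat)
    (T : forall i j : 'I_r, 'M[R]_(m i, q j)) :
    'M[R]_(1 + \sum_i m i, 1 + \sum_j q j) :=
  block_mx (const_mx 1) (const_mx 1) 0 (\mxblock_(i, j) T i j).

Definition iterated_circuit (R : realType) (n N : nat)
    (A : 'M[R]_(1 + n, N)) : Prop :=
  exists (r : nat) (m q : 'I_r -> nat)
         (en : (1 + \sum_i m i = 1 + n)%N) (eN : (1 + \sum_j q j = N)%N)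
         (T : forall i j : 'I_r, 'M[R]_(m i, q j)),
    [/\ forall i, (1 <= m i)%N,
        forall i j : 'I_r, (j < i)%N -> T i j = 0,
        equiv_config A (castmx (en, eN) (block_config T))
      & forall i, circuit (diagonal_config (T i i))].

Definition contains_iterated_circuit (R : realType) (n N : nat)
    (A : 'M[R]_(1 + n, N)) : Prop :=
  exists (M : nat) (f : 'I_M -> 'I_N),
    [/\ injective f, \rank (colsub f A) = (1 + n)%N
      & iterated_circuit (colsub f A)].

(* Main.v *)
(* After normalization by GL the spectrum is an affine configuration P, and the
   dual variety is parametrized by the pairs (b, w), where b is an affine
   relation of P without zero coordinates, sent to b e^{- w P} (Horn-Kapranov).
   The differential of this map has corank one modulo scaling exactly when the
   quadratic form H(b) = \sum_k b_k p_k p_k^T is nondegenerate.  If some H(b) is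
   nondegenerate, the inverse function theorem yields a hypersurface patch.  If
   none is, the differential is everywhere singular between spaces of equal
   dimension, and a counting argument in the style of Sard's theorem shows that
   the image contains no hypersurface.

   It remains to see that some H(b) is nondegenerate iff there is an iterated
   circuit.  For a circuit \det H(b) is, up to a nonzero factor, the sum of the
   coefficients of its linear relation, which is nonzero; the blocks of a
   triangular configuration are combined by rescaling the relation of each new
   block.  Conversely let b have no zero coordinate and H(b) be nondegenerate,
   and take a generic relation b0.  The pencil \det (t H(b) - H(b0)) has degree n,
   less than the number of points, hence has a root whose order is smaller than
   the number of points k with b0_k = t b_k.  These points form a circuit modulo
   the span of the other points, and H(b0 - t b) is nondegenerate on that span,
   so that induction applies to the other points. *)
From HB Require Import structures.
Require Import Defs.
From mathcomp Require Import all_boot all_order all_algebra perm complex.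
From mathcomp Require Import all_classical all_reals all_analysis.
From mathcomp Require Import ring lra zify.

Set Implicit Arguments.
Unset Strict Implicit.
Unset Printing Implicit Defensive.

Import Order.TTheory GRing.Theory Num.Theory.
Import numFieldNormedType.Exports.

Local Open Scope ring_scope.

(** * Generic choices *)

(** The pencil is natural because [t H(b) - H(b0)] is the Hessian of the relation [t b - b0], which
    loses the point [k] at [t = b0_k / b_k]. Genericity of [b0] makes two ratios agree only if every
    relation is proportional to [b] on the two points, so the points lost together depend on the
    configuration alone. The exponents are arbitrary reals, so the dual variety need not be
    algebraic and elimination cannot bound its dimension; a hypersurface is therefore excluded
    metrically. Counting needs uniform constants, while the Horn-Kapranov parameters are unbounded
    and the Lipschitz constants of a chart depend on the point. Baire's theorem supplies a ball in
    which one constant works at a dense set of points, enough for a slightly perturbed grid.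
    Iterated circuits are real while singular sums are complex. The determinant of [H] is a
    polynomial with real coefficients on the relations, so it vanishes on all complex relations once
    it vanishes on all real ones. *)

Lemma poly_nonroot_nat (F : numDomainType) (p : {poly F}) :
  p != 0 -> exists t : nat, p.[t%:R] != 0.
Proof.
move=> p0.
have [/hasP[t _ ht]|/hasPn H] :=
  boolP (has (fun t : nat => p.[t%:R] != 0) (iota 0 (size p))); first by exists t.
suff : (size [seq t%:R : F | t <- iota 0 (size p)] < size p)%N.
  by rewrite size_map size_iota ltnn.
apply: max_poly_roots => //; last first.
  by rewrite map_inj_uniq ?iota_uniq // => x y /eqP; rewrite eqr_nat => /eqP.
by apply/allP => x /mapP[t /H /negPn ht ->].
Qed.

(* Nonvanishing of a function that is polynomial along every line. *)
Definition generic (F : numFieldType) (V : lmodType F) (P : V -> bool) :=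
  forall x y, exists p : {poly F}, forall t, P (x + t *: y) = (p.[t] != 0).

(** Join a point good for the earlier conditions to one good for the new condition. On this line
    every condition is the nonvanishing of a polynomial that is nonzero at parameter 0 or 1, so the
    product of these polynomials has a nonroot. *)
Lemma generic_exists (F : numFieldType) (V : lmodType F) (I : eqType) (s : seq I)
    (P : I -> V -> bool) :
  (forall i, generic (P i)) -> (forall i, i \in s -> exists x, P i x) ->
  exists x, all (P^~ x) s.
Proof.
move=> gP; elim: s => [|i s IHs] ex; first by exists 0.
have [|x xs] := IHs; first by move=> j js; apply: ex; rewrite inE js orbT.
have [y Py] := ex i (mem_head _ _).
have [q Hq] : exists q : {poly F}, forall t,
    all (P^~ (x + t *: (y - x))) s = (q.[t] != 0).
  elim: s {IHs ex xs} => [|j s [q Hq]] /=.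
    by exists 1 => t; rewrite hornerC oner_eq0.
  have [p Hp] := gP j x (y - x).
  by exists (p * q) => t; rewrite Hp Hq hornerM mulf_eq0 negb_or.
have [p Hp] := gP i x (y - x).
have [|t] := @poly_nonroot_nat _ (p * q).
  rewrite mulf_neq0 //.
    apply: contraTneq Py => p0; move: (Hp 1).
    by rewrite scale1r addrC subrK p0 horner0 eqxx => ->.
  apply: contraTneq xs => q0; move: (Hq 0).
  by rewrite scale0r addr0 q0 horner0 eqxx => ->.
rewrite hornerM mulf_eq0 negb_or => /andP[pt qt].
by exists (x + t%:R *: (y - x)) => /=; rewrite Hp pt Hq.
Qed.

Lemma dvdp_prod_XsubC (F : fieldType) (rs : seq F) (p : {poly F}) :
  (forall a, ('X - a%:P) ^+ count_mem a rs %| p) ->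
  \prod_(a <- rs) ('X - a%:P) %| p.
Proof.
elim: rs p => [|x rs IH] p H; first by rewrite big_nil dvd1p.
have /dvdpP[p' Ep] : 'X - x%:P %| p.
  by apply: dvdp_trans (H x); rewrite /= eqxx exprS dvdp_mulIl.
rewrite big_cons mulrC Ep dvdp_mul2r ?polyXsubC_eq0 //.
apply: (IH) => a; have := H a; rewrite /= Ep.
have [->|ne] := eqVneq x a; first by rewrite exprSr dvdp_mul2r ?polyXsubC_eq0.
rewrite add0n; rewrite Gauss_dvdpl // coprimep_expl // coprimep_XsubC root_XsubC.
exact: ne.
Qed.

(** * Circuits and triangular configurations *)

(* Relations among the columns of [A] are the row vectors [b] with
   [b *m A^T = 0].  [gram A b = \sum_k b_k a_k a_k^T] is the Hessian of the
   exponential sum at a singular point with terms [b_k]. *)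
Definition gram (F : fieldType) (n q : nat) (A : 'M[F]_(n, q)) (b : 'rV[F]_q) :
  'M[F]_n := A *m diag_mx b *m A^T.

(* The nonzero points of a circuit having the origin among its points. *)
Definition linear_circuit (F : fieldType) (p q : nat) (A : 'M[F]_(p, q)) :=
  [/\ (0 < p)%N, q = p.+1, row_free A
    & exists b : 'rV[F]_q, [/\ b *m A^T = 0, forall k, b 0 k != 0
                             & \sum_k b 0 k != 0]].

(** Iterated circuits without the row of ones and the column of the origin. The inductive form
    avoids dependent families of block sizes in the linear algebra. *)
Inductive triangular (F : fieldType) : forall n q, 'M[F]_(n, q) -> Prop :=
| triangular_nil : triangular (0 : 'M[F]_(0, 0))
| triangular_cons p q n q' (A : 'M[F]_(p, q)) (X : 'M[F]_(p, q'))
    (B : 'M[F]_(n, q')) :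
    linear_circuit A -> triangular B -> triangular (block_mx A X 0 B).

Lemma triangular_cast (F : fieldType) n q n' q' (e : (n = n') * (q = q'))
    (A : 'M[F]_(n, q)) : triangular (castmx e A) <-> triangular A.
Proof. by case: e => e1 e2; case: _ / e1; case: _ / e2; rewrite castmx_id. Qed.

(** The constructor adds a circuit at the top left, whereas deleting a class of points produces one
    at the bottom right; associativity of block matrices reconciles the two. *)
Lemma triangular_rcons (F : fieldType) n q p q' (A : 'M[F]_(n, q))
    (X : 'M[F]_(n, q')) (B : 'M[F]_(p, q')) :
  triangular A -> linear_circuit B -> triangular (block_mx A X 0 B).
Proof.
move=> tA; move: p q' X B; elim: tA => {n q A} [|p q n q' A X B cA tB IH] p' q'' Y C cC.
  have -> : block_mx (0 : 'M[F]_(0, 0)) Y 0 C =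
      castmx (addn0 p', addn0 q'') (block_mx C (0 : 'M[F]_(p', 0)) 0 (0 : 'M[F]_(0, 0))).
    apply/matrixP => i j; rewrite castmxE /=.
    have -> : cast_ord (esym (addn0 p')) i = lshift 0 i by apply/val_inj.
    have -> : cast_ord (esym (addn0 q'')) j = lshift 0 j by apply/val_inj.
    rewrite block_mxEul -[RHS](block_mxEdr (0 : 'M[F]_(0, 0)) Y 0 C).
    by congr (block_mx _ _ _ _ _ _); apply/val_inj.
  by apply/triangular_cast; apply: triangular_cons => //; constructor.
rewrite -[Y]vsubmxK.
have := @block_mxA _ _ _ _ _ _ _ A X (usubmx Y) 0 B (dsubmx Y) 0 0 C.
rewrite /= col_mx0 row_mx0 => E.
have /triangular_cast : triangular (castmx (esym (addnA p n p'), esym (addnA q q' q''))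
  (block_mx (block_mx A X 0 B) (col_mx (usubmx Y) (dsubmx Y)) 0 C)); last by [].
by rewrite -E; apply: triangular_cons => //; apply: IH.
Qed.

Lemma linear_circuit_ker (F : fieldType) (p q : nat) (A : 'M[F]_(p, q))
    (b c : 'rV[F]_q) :
  q = p.+1 -> row_free A -> b *m A^T = 0 -> c *m A^T = 0 -> b != 0 ->
  exists k, c = k *: b.
Proof.
move=> eq fA bA cA b0.
have rk : \rank (kermx A^T) = 1%N.
  by rewrite mxrank_ker mxrank_tr (eqP fA) eq subSnn.
have bK : (b <= kermx A^T)%MS by apply/sub_kermxP.
have cK : (c <= kermx A^T)%MS by apply/sub_kermxP.
have Kb : (kermx A^T <= b)%MS.
  by rewrite -(mxrank_leqif_sup bK) rk rank_rV b0.
by have /sub_rVP := submx_trans cK Kb.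
Qed.

(** A vector [x] is in the kernel of [gram A b] iff [x *m A *m diag_mx b] is a relation, hence a
    multiple of [b], that is, iff [x *m A] is constant. The row space of [A] is the orthogonal of
    [b], so it contains the ones vector iff the sum of [b] is zero. *)
Lemma linear_circuit_gram (F : fieldType) (p q : nat) (A : 'M[F]_(p, q))
    (b : 'rV[F]_q) :
  q = p.+1 -> row_free A -> b *m A^T = 0 -> (forall k, b 0 k != 0) ->
  (\det (gram A b) != 0) = (\sum_k b 0 k != 0).
Proof.
move=> eq fA bA b0.
have b1 : const_mx 1 *m diag_mx b = b.
  by apply/rowP => k; rewrite mul_mx_diag !mxE mul1r.
have bs : const_mx 1 *m b^T = (\sum_k b 0 k)%:M :> 'M[F]_1.
  apply/matrixP => i j; rewrite !ord1 !mxE mulr1n.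
  by apply: eq_bigr => k _; rewrite !mxE mul1r.
have Abt : A *m b^T = 0 by rewrite -[A]trmxK -trmx_mul bA trmx0.
have bn0 : b != 0.
  have k0 : 'I_q by rewrite eq; exact: ord0.
  by apply: contraNneq (b0 k0) => ->; rewrite mxE.
rewrite -unitfE -unitmxE -row_free_unit; apply/idP/idP => [fH|s0].
  apply: contraTneq fH => s0; rewrite -kermx_eq0.
  have rk : \rank (kermx b^T) = p.
    by rewrite mxrank_ker mxrank_tr rank_rV bn0 eq subn1.
  have AK : (A <= kermx b^T)%MS by apply/sub_kermxP.
  have KA : (kermx b^T <= A)%MS by rewrite -(mxrank_leqif_sup AK) rk (eqP fA).
  have /submxP[x Ex] : ((const_mx 1 : 'rV_q) <= A)%MS.
    by apply: submx_trans KA; apply/sub_kermxP; rewrite bs s0 raddf0.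
  have xK : (x <= kermx (gram A b))%MS.
    by apply/sub_kermxP; rewrite /gram !mulmxA -Ex b1.
  apply: contra_neq bn0 => K0.
  move: xK; rewrite K0 submx0 => /eqP x0.
  by rewrite -b1 Ex x0 !mul0mx.
rewrite -kermx_eq0 -submx0; apply/rV_subP => x /sub_kermxP.
rewrite /gram !mulmxA => xH; rewrite submx0.
have [k Ek] := linear_circuit_ker eq fA bA xH bn0.
have xA : x *m A = k *: const_mx 1.
  apply/rowP => j; move/rowP: Ek => /(_ j); rewrite mul_mx_diag !mxE mulr1.
  by move/(mulIf (b0 j)).
have : k *: (const_mx 1 *m b^T) = 0 :> 'M[F]_1.
  by rewrite scalemxAl -xA -mulmxA Abt mulmx0.
rewrite bs => /eqP; rewrite scalemx_eq0.
have -> : ((\sum_k b 0 k)%:M == 0 :> 'M[F]_1) = false.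
  by apply/negbTE; apply: contra_neq s0 => /matrixP/(_ 0 0); rewrite !mxE.
rewrite orbF => /eqP k0; move/eqP: xA; rewrite k0 scale0r.
by rewrite mulmx_free_eq0.
Qed.

Lemma row_free_gram (F : fieldType) n q (A : 'M[F]_(n, q)) b :
  \det (gram A b) != 0 -> row_free A.
Proof.
rewrite -unitfE -unitmxE -row_free_unit -!kermx_eq0 -!submx0 => H.
apply: submx_trans H; apply/sub_kermxP.
by rewrite /gram !mulmxA mulmx_ker !mul0mx.
Qed.

Lemma gram_mull (F : fieldType) n q (A : 'M[F]_(n, q)) b (g : 'M[F]_n) :
  gram (g *m A) b = g *m gram A b *m g^T.
Proof. by rewrite /gram trmx_mul !mulmxA. Qed.

Lemma gramE (F : fieldType) n q (A : 'M[F]_(n, q)) b :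
  gram A b = \sum_k b 0 k *: (col k A *m (col k A)^T).
Proof.
apply/matrixP => i j; rewrite summxE !mxE; apply: eq_bigr => k _.
by rewrite mul_mx_diag !mxE big_ord1 !mxE mulrCA mulrA.
Qed.

Lemma relationE (F : fieldType) n q (A : 'M[F]_(n, q)) (b : 'rV_q) :
  b *m A^T = \sum_k b 0 k *: (col k A)^T.
Proof.
apply/rowP => i; rewrite summxE !mxE; apply: eq_bigr => k _.
by rewrite !mxE.
Qed.

(* Here ['X - a] divides the determinant to order [p], and the cofactor takes the
   value [\det h * \det H22] at [a]. *)
Lemma det_pencil (F : fieldType) r p (h H11 : 'M[F]_r) H12 H21 (H22 : 'M[F]_p)
    (a : F) :
  let D := \det (('X - a%:P) *: map_mx polyC (block_mx H11 H12 H21 H22)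
                 + map_mx polyC (block_mx h 0 0 0)) in
  ~~ (('X - a%:P) ^+ p.+1 %| D) -> \det h != 0 /\ \det H22 != 0.
Proof.
move=> D; set Y := 'X - a%:P in D *.
pose D' := \det (block_mx (Y *: map_mx polyC H11 + map_mx polyC h)
  (Y *: map_mx polyC H12) (map_mx polyC H21) (map_mx polyC H22)).
have -> : D = Y ^+ p * D'.
  have -> : Y ^+ p = \det (block_mx (1%:M : 'M[{poly F}]_r) 0 0 (Y%:M : 'M[{poly F}]_p)).
    by rewrite det_ublock det1 mul1r det_scalar.
  rewrite -det_mulmx mulmx_block !mul1mx !mul0mx !addr0 !add0r !mul_scalar_mx.
  rewrite /D !map_block_mx !map_mx0 scale_block_mx add_block_mx.
  by rewrite !addr0.
rewrite exprSr dvdp_mul2l ?expf_neq0 ?polyXsubC_eq0 // dvdp_XsubCl => nr.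
apply/andP; rewrite -negb_or -mulf_eq0; apply: contra nr => /eqP dh.
rewrite /root /D' -horner_evalE -det_map_mx map_block_mx.
have e1 m n (M : 'M[F]_(m, n)) : map_mx (horner_eval a) (map_mx polyC M) = M.
  by apply/matrixP => i j; rewrite !mxE horner_evalE hornerC.
have e2 m n (M : 'M[F]_(m, n)) : map_mx (horner_eval a) (Y *: map_mx polyC M) = 0.
  by apply/matrixP => i j; rewrite !mxE horner_evalE hornerM hornerXsubC subrr mul0r.
by rewrite map_mxD !e1 !e2 add0r det_lblock dh.
Qed.

Lemma row_split (F : fieldType) n s (B : 'M[F]_(n, s)) :
  exists r p (e : (r + p = n)%N) (g : 'M[F]_n) (B0 : 'M[F]_(r, s)),
    [/\ g \in unitmx, row_free B0 &
      g *m B = castmx (e, erefl) (col_mx B0 0)].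
Proof.
have le := rank_leq_row B.
exists (\rank B), (n - \rank B)%N, (subnKC le), (invmx (col_ebase B)),
  (row_base B).
split; first by rewrite unitmx_inv col_ebase_unit.
  by rewrite row_base_free.
have -> : invmx (col_ebase B) *m B = pid_mx (\rank B) *m row_ebase B.
  by rewrite -[RHS](mulKmx (col_ebase_unit B)) (mulmxA (col_ebase B)) mulmx_ebase.
rewrite /row_base.
apply/matrixP => i j; rewrite castmxE /= cast_ord_id.
have ei : (cast_ord (esym (subnKC le)) i : nat) = i by [].
case: (split_ordP (cast_ord (esym (subnKC le)) i)) ei => k -> /= ei.
  by rewrite col_mxEu !mxE; apply: eq_bigr => l _; rewrite !mxE -ei.
rewrite col_mxEd !mxE; apply: big1 => l _; rewrite !mxE -ei.
by rewrite ltnNge leq_addr andbF mul0r.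
Qed.

(* The inductive step of [triangular_of_gram].  [~: S] is a class of columns on
   which every relation of [A] is proportional to [b]; it is the zero set of the
   relation [b0 - a *: b], and the coordinates are chosen so that the last [p]
   of them vanish on the columns in [S].  The determinant of the pencil
   ['X H(b) - H(b0)] then vanishes at [a] to order at least [p = #|~: S| - 1],
   and to exactly that order iff both diagonal blocks are nondegenerate. *)
Section ParallelClass.
Variables (F : numFieldType) (r p q : nat) (A : 'M[F]_(r + p, q)) (b b0 : 'rV[F]_q).
Hypotheses (bA : b *m A^T = 0) (b0A : b0 *m A^T = 0).
Hypothesis (bn0 : forall k, b 0 k != 0).
Variable (a : F).
Let S : {set 'I_q} := [set k | b0 0 k != a * b 0 k].
Let eS : 'I_#|S| -> 'I_q := fun i => enum_val i.
Let eL : 'I_#|~: S| -> 'I_q := fun i => enum_val i.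
Hypothesis par : forall c : 'rV_q, c *m A^T = 0 ->
  forall j k, j \notin S -> k \notin S -> c 0 j * b 0 k = c 0 k * b 0 j.
Variable B0 : 'M[F]_(r, #|S|).
Hypotheses (fA : row_free A) (fB : row_free B0).
Hypothesis (AS : colsub eS A = col_mx B0 0).
Hypothesis (L0 : (0 < #|~: S|)%N).

Let X := colsub eL (usubmx A).
Let C := colsub eL (dsubmx A).
Let bL := colsub eL b.

Lemma colsub_class : colsub eL A = col_mx X C.
Proof.
apply/matrixP => i j; rewrite mxE; case: (split_ordP i) => k ->.
  by rewrite col_mxEu !mxE.
by rewrite col_mxEd !mxE.
Qed.

Lemma sum_class_split (V : zmodType) (f : 'I_q -> V) :
  \sum_k f k = \sum_k f (eS k) + \sum_k f (eL k).
Proof.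
rewrite (bigID (mem S)) /= big_enum_val; congr (_ + _).
rewrite -(@big_enum_val _ _ _ _ (mem (~: S)) f) /=.
by apply: eq_bigl => k; rewrite !inE.
Qed.

Lemma relation_class_split (c : 'rV_q) :
  c *m A^T = row_mx (colsub eS c *m B0^T + colsub eL c *m X^T) (colsub eL c *m C^T).
Proof.
have -> : c *m A^T = colsub eS c *m (colsub eS A)^T + colsub eL c *m (colsub eL A)^T.
  apply/matrixP => i j; rewrite !mxE sum_class_split.
  by congr (_ + _); apply: eq_bigr => k _; rewrite !mxE.
rewrite AS colsub_class !tr_col_mx !mul_mx_row trmx0 mulmx0 add_row_mx.
by rewrite add0r.
Qed.

Lemma gram_class_split (c : 'rV_q) : gram A c =
  gram (col_mx B0 0) (colsub eS c) + gram (col_mx X C) (colsub eL c).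
Proof.
rewrite -AS -colsub_class !gramE sum_class_split; congr (_ + _); apply: eq_bigr => k _;
 rewrite !mxE; congr (_ *: _);
 by apply/matrixP => i j; rewrite !mxE; apply: eq_bigr => l _; rewrite !mxE.
Qed.

(** The last [p] coordinates vanish on the columns in [S], so a linear form in them that kills [C]
    kills all of [A]. *)
Lemma parallel_class_free : row_free C.
Proof.
rewrite -kermx_eq0 -submx0; apply/rV_subP => x /sub_kermxP xC; rewrite submx0.
have xA : row_mx 0 x *m A = 0.
  apply/rowP => k; have [kS|kS] := boolP (k \in S).
    rewrite -(enum_rankK_in kS kS).
    have -> : (row_mx 0 x *m A) 0 (enum_val (enum_rank_in kS k)) =
      (row_mx 0 x *m colsub eS A) 0 (enum_rank_in kS k).
      by rewrite !mxE; apply: eq_bigr => l _; rewrite !mxE.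
    by rewrite AS mul_row_col mul0mx mulmx0 addr0 !mxE.
  have kL : k \in ~: S by rewrite inE.
  rewrite -(enum_rankK_in kL kL).
  have -> : (row_mx 0 x *m A) 0 (enum_val (enum_rank_in kL k)) =
    (row_mx 0 x *m colsub eL A) 0 (enum_rank_in kL k).
    by rewrite !mxE; apply: eq_bigr => l _; rewrite !mxE.
  by rewrite colsub_class mul_row_col mul0mx xC addr0 !mxE.
move/eqP: xA; rewrite mulmx_free_eq0 // => /eqP xA.
by apply/eqP; rewrite -(row_mxKr (0 : 'rV_r) x) xA; apply/matrixP => i j; rewrite !mxE.
Qed.

Lemma parallel_class_rel : bL *m C^T = 0.
Proof. by move: bA; rewrite relation_class_split -row_mx0 => /eq_row_mx[]. Qed.

(** Since [B0] has independent rows, every relation of [C] extends to a relation of [A], and [par]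
    then makes it proportional to [bL]. The relations of [C] thus form a line, while [C] has rank
    [p]. *)
Lemma card_parallel_class : #|~: S| = p.+1.
Proof.
have bLn0 : bL != 0.
  by apply: contraNneq (bn0 (eL (Ordinal L0))) => /rowP/(_ (Ordinal L0)); rewrite !mxE => ->.
have /eqP rk : \rank (kermx C^T) == 1%N.
  have bK : (bL <= kermx C^T)%MS by apply/sub_kermxP/parallel_class_rel.
  suff Kb : (kermx C^T <= bL)%MS.
    have := mxrankS Kb; have := mxrankS bK; rewrite rank_rV bLn0 => h1 h2.
    by rewrite eqn_leq h1 h2.
  apply/rV_subP => c /sub_kermxP cC.
  have [y Ey] : exists y : 'rV_#|S|, y *m B0^T = - (c *m X^T).
    have fullB : row_full B0^T by rewrite /row_full mxrank_tr.
    by exists (- (c *m X^T) *m pinvmx B0^T); rewrite mulmxKpV // submx_full.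
  pose c' : 'rV[F]_q := \row_k
    (if k \in S then \sum_l (if eS l == k then y 0 l else 0)
     else \sum_l (if eL l == k then c 0 l else 0)).
  have cS : colsub eS c' = y.
    apply/rowP => k; rewrite !mxE (enum_valP k) (bigD1 k) //= eqxx big1 ?addr0 //.
    by move=> l lk; rewrite (inj_eq enum_val_inj) (negbTE lk).
  have cL : colsub eL c' = c.
    apply/rowP => k; rewrite !mxE.
    have := enum_valP k; rewrite inE => /negbTE; rewrite -/(eL k) => ->.
    rewrite (bigD1 k) //= eqxx big1 ?addr0 //.
    by move=> l lk; rewrite (inj_eq enum_val_inj) (negbTE lk).
  have c'A : c' *m A^T = 0.
    by rewrite relation_class_split cS cL Ey cC addNr row_mx0.
  apply/sub_rVP; set i0 := Ordinal L0.
  exists (c 0 i0 / bL 0 i0); apply/rowP => j.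
  have nS i : eL i \notin S by have := enum_valP i; rewrite inE.
  have cc i : c' 0 (eL i) = c 0 i by rewrite -cL [RHS]mxE.
  have := par c'A (nS i0) (nS j); rewrite !cc => e.
  by rewrite !mxE mulrAC e mulfK // bn0.
move: rk; rewrite mxrank_ker mxrank_tr (eqP parallel_class_free) => e.
by rewrite -(subnK (rank_leq_col C)) (eqP parallel_class_free) e.
Qed.

Hypothesis Hb : \det (gram A b) != 0.
Hypothesis mult : ~~ (('X - a%:P) ^+ p.+1 %|
   \det ('X *: map_mx polyC (gram A b) - map_mx polyC (gram A b0))).

(** With [c = b0 - a *: b], the pencil is [('X - a) H(b) - H(c)]. As [c] is supported on [S], only
    the upper left block of [H(c)] is nonzero; the lower right block of [H(b)] sees only the class.
    This is the shape required by [det_pencil]. *)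
Lemma parallel_class_deletion : [/\ (colsub eS (b0 - a *: b)) *m B0^T = 0,
   \det (gram B0 (colsub eS (b0 - a *: b))) != 0 &
   (0 < p)%N -> linear_circuit C].
Proof.
set c := b0 - a *: b.
have cL : colsub eL c = 0.
  apply/rowP => k; rewrite !mxE; have := enum_valP k.
  by rewrite !inE negbK => /eqP ->; rewrite subrr.
have cA : c *m A^T = 0 by rewrite mulmxBl -scalemxAl bA b0A scaler0 subrr.
have gram_col m (Y : 'M[F]_(r, m)) (Z : 'M[F]_(p, m)) d : gram (col_mx Y Z) d =
    block_mx (gram Y d) (Y *m diag_mx d *m Z^T) (Z *m diag_mx d *m Y^T) (gram Z d).
  by rewrite /gram tr_col_mx mul_col_mx mul_col_row.
have gc : gram A c = block_mx (gram B0 (colsub eS c)) 0 0 0.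
  rewrite gram_class_split cL gram_col.
  have -> : gram (col_mx X C) 0 = 0.
    by rewrite /gram (_ : diag_mx _ = 0) ?mulmx0 ?mul0mx // linear0.
  by rewrite addr0 /gram !trmx0 !mulmx0 !mul0mx.
have gd : drsubmx (gram A b) = gram C bL.
  rewrite gram_class_split !gram_col add_block_mx block_mxKdr /gram !mul0mx.
  by rewrite add0r.
have [] : \det (- gram B0 (colsub eS c)) != 0 /\ \det (drsubmx (gram A b)) != 0.
  apply: (@det_pencil _ _ _ _ (ulsubmx (gram A b)) (ursubmx (gram A b))
    (dlsubmx (gram A b)) (drsubmx (gram A b)) a).
  rewrite submxK; congr (~~ (_ %| \det _)): mult.
  have -> : block_mx (- gram B0 (colsub eS c)) 0 0 0 = a *: gram A b - gram A b0.
    rewrite -[RHS]opprB; have <- : gram A c = gram A b0 - a *: gram A b.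
      rewrite /gram -!mulmxA scalemxAr -mulmxBr; congr (_ *m _).
      by rewrite scalemxAl -mulmxBl; congr (_ *m _); rewrite linearB linearZ.
    by rewrite gc opp_block_mx !oppr0.
  apply/matrixP => i j; rewrite !mxE polyCD polyCM polyCN mulrBl.
  by rewrite addrA subrK.
rewrite gd => h1 h2; split.
- by move: cA; rewrite relation_class_split cL !mul0mx addr0 -row_mx0 => /eq_row_mx[].
- by move: h1; rewrite -scaleN1r detZ mulf_eq0 negb_or => /andP[].
- move=> p0; split => //; [exact: card_parallel_class | exact: parallel_class_free | ].
  exists bL; split; [exact: parallel_class_rel | by move=> k; rewrite mxE | ].
  rewrite -(linear_circuit_gram card_parallel_class parallel_class_free parallel_class_rel) //.
  by move=> k; rewrite mxE.
Qed.
End ParallelClass.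

Lemma generic_ne0 (F : numFieldType) (V : lmodType F) (f : V -> F) :
  (forall x y t, f (x + t *: y) = f x + t * f y) -> generic (fun x => f x != 0).
Proof.
move=> lf x y; exists ((f x)%:P + (f y) *: 'X) => t.
by rewrite lf hornerD hornerC hornerZ hornerX mulrC.
Qed.

(** For each pair [j, k] on which some relation is not proportional to [b], proportionality is a
    proper linear condition on relations; [b0] avoids these finitely many conditions. *)
Lemma generic_relation (F : numFieldType) n q (A : 'M[F]_(n, q)) (b : 'rV_q) :
  exists2 b0 : 'rV_q, b0 *m A^T = 0 & forall j k,
    b0 0 j * b 0 k = b0 0 k * b 0 j ->
    forall c : 'rV_q, c *m A^T = 0 -> c 0 j * b 0 k = c 0 k * b 0 j.
Proof.
pose K := kermx A^T.
pose f (jk : 'I_q * 'I_q) (v : 'rV[F]_q) :=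
  (v *m K) 0 jk.1 * b 0 jk.2 - (v *m K) 0 jk.2 * b 0 jk.1.
pose s := [seq jk <- enum {: 'I_q * 'I_q} | `[< exists v, f jk v != 0 >]].
have [||v /allP Hv] := @generic_exists F _ _ s (fun jk v => f jk v != 0).
- move=> jk; apply: generic_ne0 => x y t; rewrite /f mulmxDl -scalemxAl !mxE.
  by rewrite !mulrDl opprD addrACA -!mulrA -mulrBr.
- by move=> jk; rewrite mem_filter => /andP[/asboolP].
exists (v *m K); first by apply/sub_kermxP/submxMl.
move=> j k e c /sub_kermxP/submxP[w ->].
apply/eqP; rewrite -subr_eq0; apply/negPn/negP => fw.
have /Hv : (j, k) \in s.
  by rewrite mem_filter mem_enum andbT; apply/asboolP; exists w.
by rewrite /f /= e subrr eqxx.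
Qed.

Theorem triangular_of_gram (F : numFieldType) n q (A : 'M[F]_(n, q)) (b : 'rV_q) :
  b *m A^T = 0 -> \det (gram A b) != 0 ->
  exists M (f : 'I_M -> 'I_q) (g : 'M[F]_n),
    [/\ injective f, g \in unitmx & triangular (g *m colsub f A)].
Proof.
elim/ltn_ind: q n A b => q IHq n A b bA Hb.
have gE (S : {set 'I_q}) (c : 'rV_q) : (forall k, k \notin S -> c 0 k = 0) ->
    gram (colsub (fun i : 'I_#|S| => enum_val i) A)
         (colsub (fun i : 'I_#|S| => enum_val i) c) = gram A c /\
    colsub (fun i : 'I_#|S| => enum_val i) c *m
         (colsub (fun i : 'I_#|S| => enum_val i) A)^T = c *m A^T.
  move=> cS; rewrite !gramE !relationE.
  have cc k : col k (colsub (fun i : 'I_#|S| => enum_val i) A) = col (enum_val k) A.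
    by apply/matrixP => i j; rewrite !mxE.
  split.
    rewrite [RHS](bigID (mem S)) /= [X in _ = _ + X]big1 ?addr0; last first.
      by move=> k /cS ->; rewrite scale0r.
    by rewrite [RHS]big_enum_val; apply: eq_bigr => k _; rewrite mxE cc.
  rewrite [RHS](bigID (mem S)) /= [X in _ = _ + X]big1 ?addr0; last first.
    by move=> k /cS ->; rewrite scale0r.
  by rewrite [RHS]big_enum_val; apply: eq_bigr => k _; rewrite mxE cc.
have [n0|n_gt0] := posnP n.
  subst n.
  have f : 'I_0 -> 'I_q by case.
  exists 0, f, 1%:M; split; [by case|exact: unitmx1|].
  have -> : 1%:M *m colsub f A = (0 : 'M[F]_(0, 0)) by apply/matrixP => -[].
  exact: triangular_nil.
(* A point with coefficient zero contributes neither to the relation nor to the Hessian, so it can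
   be deleted. *)
have [/existsP[k0 /eqP bk0]|/existsPn bn0] := boolP [exists k, b 0 k == 0].
  pose S := [set~ k0].
  have cS : (#|S| < q)%N.
    rewrite (cardsC1 k0) card_ord ltn_predL.
    by apply: leq_trans (ltn_ord k0).
  have [|eg er] := gE S b; first by move=> k; rewrite !inE negbK => /eqP ->.
  have [||M [f [g [fi gu tg]]]] := IHq _ cS _ (colsub (fun i : 'I_#|S| => enum_val i) A)
    (colsub (fun i : 'I_#|S| => enum_val i) b); rewrite ?er ?eg //.
  exists M, (fun i => enum_val (f i)), g; split=> //.
    by move=> i j /enum_val_inj/fi.
  congr triangular: tg; apply/matrixP => i j; rewrite !mxE.
  by apply: eq_bigr => l _; rewrite !mxE.
have fA := row_free_gram Hb.
have bn : b != 0.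
  apply: contraTneq Hb => ->.
    rewrite /gram linear0 mulmx0 mul0mx.
  by case: n n_gt0 {A bA gE fA} => // n _; rewrite det0 eqxx.
have nq : (n < q)%N.
  have : (b <= kermx A^T)%MS by apply/sub_kermxP.
  move/mxrankS; rewrite rank_rV bn mxrank_ker mxrank_tr (eqP fA) subn_gt0 //.
have [b0 b0A par] := generic_relation A b.
pose r_ k := b0 0 k / b 0 k.
(* [char_poly G] is the determinant of the pencil up to the nonzero factor [\det (gram A b)], and
   [rs] lists the parameters at which points drop out, one entry for each point. *)
pose G := invmx (gram A b) *m gram A b0.
pose rs := [seq r_ k | k <- enum 'I_q].
have uH : gram A b \in unitmx by rewrite unitmxE unitfE.
(* Otherwise a product of [q] linear factors would divide a polynomial of degree [n], which is less
   than [q]. *)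
have [a nda] : exists a, ~~ (('X - a%:P) ^+ count_mem a rs %| char_poly G).
  apply: contrapT => H.
  have /dvdp_leq : \prod_(a <- rs) ('X - a%:P) %| char_poly G.
    by apply: dvdp_prod_XsubC => a; apply/negPn/negP => nd; apply: H; exists a.
  rewrite monic_neq0 ?char_poly_monic // size_char_poly size_prod_XsubC.
  by rewrite size_map size_enum_ord => /(_ isT); rewrite ltnS leqNgt nq.
pose S : {set 'I_q} := [set k | b0 0 k != a * b 0 k].
have inS k : (k \in S) = (r_ k != a).
  by rewrite inE /r_ -[in RHS](inj_eq (mulIf (bn0 k))) divfK ?bn0.
have countL : count_mem a rs = #|~: S|.
  rewrite count_map -sum1_count -sum1_card big_enum_cond.
  by apply: eq_bigl => k; rewrite finset.in_setC inS negbK.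
have L0 : (0 < #|~: S|)%N.
  by rewrite -countL lt0n; apply: contraNneq nda => ->; rewrite expr0 dvd1p.
have cS : (#|S| < q)%N.
  by have := cardsC S; rewrite card_ord; move: L0; lia.
have [r [p [e [g [B0 [gu fB gAS]]]]]] := row_split (colsub (fun i : 'I_#|S| => enum_val i) A).
subst n; rewrite castmx_id in gAS.
have colsubM m m' (Y : 'M[F]_(m, q)) (h : 'M[F]_(m', m)) k (f : 'I_k -> 'I_q) :
    colsub f (h *m Y) = h *m colsub f Y.
  by apply/matrixP => i j; rewrite !mxE; apply: eq_bigr => l _; rewrite !mxE.
pose A' := g *m A.
have relA' (c : 'rV_q) : c *m A'^T = 0 <-> c *m A^T = 0.
  rewrite /A' trmx_mul mulmxA; split => [cA|->]; last by rewrite mul0mx.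
  by rewrite -[LHS](mulmxK (_ : g^T \in unitmx)) ?unitmx_tr // cA mul0mx.
have bA' : b *m A'^T = 0 by apply/relA'.
have b0A' : b0 *m A'^T = 0 by apply/relA'.
have par' (c : 'rV_q) : c *m A'^T = 0 ->
    forall j k, j \notin S -> k \notin S -> c 0 j * b 0 k = c 0 k * b 0 j.
  move=> /relA' cA j k; rewrite !inE !negbK => /eqP ej /eqP ek; apply: par => //.
  by rewrite ej ek mulrAC.
have fA' : row_free A' by rewrite /A' /row_free mxrankMfree // mxrank_unit.
have A'S : colsub (fun i : 'I_#|S| => enum_val i) A' = col_mx B0 0 by rewrite colsubM.
have Hb' : \det (gram A' b) != 0.
  rewrite gram_mull !det_mulmx !mulf_neq0 // ?det_tr -unitfE -unitmxE //.
have cL := card_parallel_class bA' bn0 par' fA' fB A'S L0.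
have mult : ~~ (('X - a%:P) ^+ p.+1 %|
    \det ('X *: map_mx polyC (gram A' b) - map_mx polyC (gram A' b0))).
  rewrite -cL -countL.
  have -> : 'X *: map_mx polyC (gram A' b) - map_mx polyC (gram A' b0) =
      map_mx polyC (g *m gram A b) *m char_poly_mx G *m map_mx polyC g^T.
    rewrite /char_poly_mx mulmxBr mulmxBl -!map_mxM mul_mx_scalar -scalemxAl -map_mxM.
    by rewrite !gram_mull -(mulmxA g (gram A b) G) /G mulKVmx.
  rewrite !det_mulmx -/(char_poly G) !det_map_mx mulrAC -polyCM.
  rewrite mul_polyC dvdpZr //.
  by rewrite mulf_neq0 // ?det_mulmx ?mulf_neq0 ?det_tr // -unitfE -unitmxE.
have [rel' gram' lc] := parallel_class_deletion bA' b0A' bn0 par' fA' fB A'S L0 mult.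
have [M [f [g' [fi g'u tg]]]] := IHq _ cS _ _ _ rel' gram'.
pose h : 'M[F]_(r + p) := block_mx g' 0 0 1%:M.
have hu : h *m g \in unitmx.
  by rewrite unitmx_mul gu andbT unitmxE det_ublock det1 mulr1 -unitmxE.
have hB k (f' : 'I_k -> 'I_q) : h *m g *m colsub f' A =
    col_mx (g' *m usubmx (colsub f' A')) (dsubmx (colsub f' A')).
  rewrite -mulmxA -colsubM -/A' -[X in _ *m X = _]vsubmxK mul_block_col.
  by rewrite !mul0mx addr0 add0r mul1mx.
have colB0 : colsub (fun i => enum_val (f i)) A' = col_mx (colsub f B0) 0.
  have <- : colsub f (col_mx B0 (0 : 'M[F]_(p, _))) = col_mx (colsub f B0) 0.
    apply/matrixP => i j; rewrite mxE; case: (split_ordP i) => k ->.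
      by rewrite !col_mxEu mxE.
    by rewrite !col_mxEd !mxE.
  by rewrite -A'S; apply/matrixP => i j; rewrite !mxE.
(* For [p = 0] the class is a single point, which is dropped: the points in [S] already span. *)
have [p0|p_gt0] := posnP p.
  subst p; exists M, (fun i => enum_val (f i)), (h *m g); split=> //.
    by move=> i j /enum_val_inj/fi.
  rewrite hB colB0 col_mxKu col_mxKd.
  apply/(@triangular_cast _ _ _ _ _ (addn0 r, erefl M)).
  congr triangular: tg; apply/matrixP => i j; rewrite castmxE /= cast_ord_id.
  by rewrite (_ : cast_ord _ _ = lshift 0 i) ?col_mxEu //; apply/val_inj.
pose eL (i : 'I_#|~: S|) := enum_val i.
pose f' (i : 'I_(M + #|~: S|)) : 'I_q :=
  match fintype.split i with inl j => enum_val (f j) | inr j => eL j end.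
exists (M + #|~: S|)%N, f', (h *m g); split=> //.
  have dj i j : enum_val (f i) != eL j.
    have := enum_valP j; rewrite inE -/(eL j).
    by apply: contraNneq => <-; exact: enum_valP.
  move=> i j; rewrite /f'.
  case: (split_ordP i) => i' ->; case: (split_ordP j) => j' -> ;
    rewrite ?(unsplitK (inl _)) ?(unsplitK (inr _)) => e.
  - by rewrite (fi _ _ (enum_val_inj e)).
  - by move: (dj i' j'); rewrite e eqxx.
  - by move: (dj j' i'); rewrite e eqxx.
  - by rewrite (enum_val_inj e).
have f'l i : f' (lshift _ i) = enum_val (f i) by rewrite /f' (unsplitK (inl i)).
have f'r i : f' (rshift _ i) = eL i by rewrite /f' (unsplitK (inr i)).
have cf' : colsub f' A' = row_mx (colsub (fun i => enum_val (f i)) A') (colsub eL A').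
  apply/matrixP => i j; rewrite mxE.
  by case: (split_ordP j) => j' ->; rewrite ?row_mxEl ?row_mxEr ?f'l ?f'r [RHS]mxE.
have -> : h *m g *m colsub f' A = block_mx (g' *m colsub f B0)
    (g' *m usubmx (colsub eL A')) 0 (dsubmx (colsub eL A')).
  rewrite hB cf' colB0 -[X in row_mx _ X]vsubmxK -block_mxEh block_mxEv.
  by rewrite col_mxKu col_mxKd mul_mx_row -block_mxEv.
apply: triangular_rcons => //.
by congr linear_circuit: (lc p_gt0); apply/matrixP => i j; rewrite !mxE.
Qed.

Local Open Scope classical_set_scope.

(** * Iterated circuits *)

Lemma triangular_free (F : fieldType) n q (A : 'M[F]_(n, q)) :
  triangular A -> row_free A.
Proof.
elim=> {n q A} [|p q n q' A X B [_ _ fA _] _ fB].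
  by rewrite /row_free -leqn0 rank_leq_row.
rewrite -kermx_eq0 -submx0; apply/rV_subP => x /sub_kermxP.
rewrite -[x]hsubmxK mul_row_block mulmx0 addr0 -row_mx0 => /eq_row_mx[/eqP].
rewrite mulmx_free_eq0 // => /eqP -> /eqP.
by rewrite mul0mx add0r mulmx_free_eq0 // => /eqP ->; rewrite row_mx0 submx0.
Qed.

(* [\det (t *: H + M)] is, up to a unit, a characteristic polynomial in [t]. *)
Lemma unit_shift (F : numFieldType) n (H M : 'M[F]_n) :
  H \in unitmx -> exists t, t *: H + M \in unitmx.
Proof.
move=> uH.
have [|t nz] := @poly_nonroot_nat _ (char_poly (- (invmx H *m M))).
  by rewrite monic_neq0 ?char_poly_monic.
exists t%:R; have -> : t%:R *: H + M = H *m (t%:R%:M + invmx H *m M).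
  by rewrite mulmxDr mulKVmx // mul_mx_scalar.
rewrite unitmx_mul uH unitmxE unitfE; congr (_ != 0): nz.
rewrite /char_poly -horner_evalE -det_map_mx; congr (\det _).
apply/matrixP => i j; rewrite !mxE /= /horner_eval hornerD hornerN hornerC opprK.
by rewrite hornerMn hornerX.
Qed.

(** A relation [b] of [B] is completed by some [y] to a relation of the whole matrix, and multiples
    of the circuit relation [be] may be added to [y]. A large class of multiples keeps the Hessian
    nondegenerate, because its dependence on them is the pencil [t *: gram A be + M0]. *)
Lemma gram_of_triangular (F : numFieldType) n q (A : 'M[F]_(n, q)) :
  triangular A -> exists b : 'rV_q, b *m A^T = 0 /\ \det (gram A b) != 0.
Proof.
elim=> {n q A} [|p q n q' A X B [_ eq fA [be [beA be0 bes]]] _ [b [bB Hb]]].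
  by exists 0; rewrite mul0mx det_mx00 oner_eq0.
have [y Ey] : exists y : 'rV_q, y *m A^T = - (b *m X^T).
  have fullA : row_full A^T by rewrite /row_full mxrank_tr.
  by exists (- (b *m X^T) *m pinvmx A^T); rewrite mulmxKpV // submx_full.
have uA : gram A be \in unitmx.
  by rewrite unitmxE unitfE (linear_circuit_gram eq fA beA be0).
have uB : gram B b \in unitmx by rewrite unitmxE unitfE.
pose Z := X *m diag_mx b *m B^T.
(* The Schur complement of [gram B b] in the Hessian for [t = 0]. *)
pose M0 := gram A y + gram X b - Z *m invmx (gram B b) *m Z^T.
have [t ut] := unit_shift M0 uA.
exists (row_mx (t *: be + y) b).
rewrite tr_block_mx mul_row_block trmx0 mulmx0 add0r bB mulmxDl -scalemxAl beA.
rewrite scaler0 add0r Ey addNr row_mx0; split=> //.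
have ZT : Z^T = B *m diag_mx b *m X^T.
  by rewrite /Z !trmx_mul trmxK tr_diag_mx mulmxA.
have -> : gram (block_mx A X 0 B) (row_mx (t *: be + y) b) =
    block_mx 1%:M (Z *m invmx (gram B b)) 0 1%:M *m
    block_mx (t *: gram A be + M0) 0 Z^T (gram B b).
  rewrite mulmx_block !mul0mx !mul1mx ?mulmx0 !add0r mulmxKV // addrA subrK.
  rewrite /gram diag_mx_row mulmx_block tr_block_mx mulmx_block !mul0mx !trmx0.
  rewrite !mulmx0 !add0r !addr0 addrA.
  congr block_mx; last by rewrite ZT mul0mx add0r.
  congr (_ + _); by rewrite raddfD /= linearZ /= mulmxDr mulmxDl -scalemxAr -scalemxAl.
rewrite det_mulmx det_ublock !det1 !mul1r det_lblock mulf_neq0 //.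
by rewrite -unitfE -unitmxE.
Qed.

(** Affine subspaces are only assumed closed under lines through two points. Relative to a base
    point [x0] this gives scaling, and addition follows because [x0 + v + w] is the midpoint of
    [x0 + 2 v] and [x0 + 2 w]. *)
Lemma affine_subspace_comb (R : realType) m N (S : set 'cV[R]_m) (A : 'M[R]_(m, N))
    (l : 'cV[R]_N) :
  affine_subspace S -> (forall j, l j 0 != 0 -> S (col j A)) ->
  \sum_j l j 0 = 1 -> S (A *m l).
Proof.
move=> aS SA l1.
have [j0 lj0] : exists j0, l j0 0 != 0.
  apply/existsP; apply: contraT => /existsPn H; move: l1.
  rewrite big1 => [/eqP|j _]; first by rewrite eq_sym oner_eq0.
  by apply/eqP; have := H j; rewrite negbK.
set x0 := col j0 A.
have Sx0 : S x0 by exact: SA.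
have Vs v t : S (x0 + v) -> S (x0 + t *: v).
  move=> Sv; have := aS _ _ t Sv Sx0; congr S.
  by rewrite scalerDr addrAC -scalerDl (addrC t) subrK scale1r.
have Vd v w : S (x0 + v) -> S (x0 + w) -> S (x0 + (v + w)).
  move=> /(Vs _ 2) Sv /(Vs _ 2) Sw; have := aS _ _ 2^-1 Sv Sw; congr S.
  have -> : 1 - 2^-1 = 2^-1 :> R by rewrite [X in X - _](splitr 1) mul1r addrK.
  have half (y : 'cV[R]_m) : 2^-1 *: (2 *: y) = y.
    by rewrite scalerA mulVf ?scale1r // pnatr_eq0.
  rewrite -scalerDr addrACA -[2 *: v + _]scalerDr (scalerDr 2^-1) half.
  by have -> : x0 + x0 = 2 *: x0; rewrite ?half // -{1 2}[x0]scale1r -scalerDl.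
have -> : A *m l = x0 + \sum_j l j 0 *: (col j A - x0).
  under eq_bigr do rewrite scalerBr.
  rewrite sumrB -scaler_suml l1 scale1r addrC subrK.
  apply/colP => i; rewrite !mxE summxE; apply: eq_bigr => j _.
  by rewrite !mxE mulrC.
apply: (big_ind (fun v => S (x0 + v))) => [|v w|j _]; first by rewrite addr0.
  exact: Vd.
have [->|/SA Sj] := eqVneq (l j 0) 0; first by rewrite scale0r addr0.
by apply: Vs; rewrite addrC subrK.
Qed.

Lemma affine_hull_del_affine (R : realType) m N (A : 'M[R]_(m, N)) (k : 'I_N) :
  affine_subspace [set x | exists l : 'cV[R]_N,
    [/\ \sum_j l j 0 = 1, l k 0 = 0 & x = A *m l]].
Proof.
move=> _ _ t [l [l1 lk ->]] [l' [l'1 l'k ->]].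
exists (t *: l + (1 - t) *: l'); split.
- under eq_bigr do rewrite !mxE.
  by rewrite big_split /= -!mulr_sumr l1 l'1 !mulr1 addrC subrK.
- by rewrite !mxE lk l'k !mulr0 addr0.
- by rewrite mulmxDr -!scalemxAr.
Qed.

(** With the ones vector in the row span, relations have sum zero and are affine dependences. A
    point is an apex iff it lies outside the affine hull of the others, iff all relations vanish at
    it. *)
Lemma not_pyramidP (R : realType) n N (A : 'M[R]_(n, N)) :
  ((const_mx 1 : 'rV[R]_N) <= A)%MS ->
  ~ pyramid A <-> forall k, exists2 b : 'rV_N, b *m A^T = 0 & b 0 k != 0.
Proof.
move=> /submxP[u Eu].
have sum0 (c : 'cV[R]_N) : A *m c = 0 -> \sum_j c j 0 = 0.
  move=> Ac; have : (const_mx 1 : 'rV[R]_N) *m c = 0 by rewrite Eu -mulmxA Ac mulmx0.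
  move/matrixP/(_ 0 0); rewrite !mxE => e; rewrite -[RHS]e.
  by apply: eq_bigr => j _; rewrite !mxE mul1r.
have col_delta (j : 'I_N) : A *m delta_mx j 0 = col j A :> 'cV_n by rewrite colE.
have sum_delta (j : 'I_N) : \sum_i (delta_mx j 0 : 'cV[R]_N) i 0 = 1.
  rewrite (bigD1 j) //= !mxE !eqxx big1 ?addr0 // => i ij.
  by rewrite !mxE (negbTE ij).
split=> [nP k|H [k [S [aS [_ pS] SA]]]].
  apply: contrapT => nb; apply: nP.
  exists k, [set x | exists l : 'cV[R]_N, [/\ \sum_j l j 0 = 1, l k 0 = 0 & x = A *m l]].
  split; first exact: affine_hull_del_affine.
    split=> [x [l [l1 _ ->]]|hS]; first by exists l.
    have [|l [l1 lk Al]] := hS (col k A).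
      by exists (delta_mx k 0); rewrite sum_delta col_delta.
    apply: nb; exists (delta_mx k 0 - l)^T.
      by rewrite -trmx_mul mulmxBr -Al col_delta subrr trmx0.
    by rewrite !mxE lk !eqxx subr0 oner_eq0.
  move=> j jk; exists (delta_mx j 0); rewrite sum_delta col_delta mxE eq_sym (negbTE jk).
  by [].
have [b bA bk] := H k.
apply: pS => _ [l [l1 ->]].
have Ab : A *m b^T = 0 by rewrite -[A]trmxK -trmx_mul bA trmx0.
(* Subtracting a multiple of the relation removes the apex from the combination without changing its
   value. *)
have -> : A *m l = A *m (l - (l k 0 / b 0 k) *: b^T).
  by rewrite mulmxBr -scalemxAr Ab scaler0 subr0.
apply: affine_subspace_comb => // [j|].
  move=> nz; apply: SA; apply: contraNneq nz => ->.
  by rewrite !mxE divfK // subrr.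
under eq_bigr do rewrite !mxE.
rewrite sumrB l1 -mulr_sumr.
have -> : \sum_j b 0 j = 0.
  by rewrite -[RHS](sum0 _ Ab); apply: eq_bigr => j _; rewrite mxE.
by rewrite mulr0 subr0.
Qed.

Lemma diagonal_config_rel (R : realType) m q (C : 'M[R]_(m, q)) (b0 : 'rV_1) (b : 'rV_q) :
  row_mx b0 b *m (diagonal_config C)^T = 0 <->
  b0 0 0 = - \sum_k b 0 k /\ b *m C^T = 0.
Proof.
rewrite /diagonal_config tr_block_mx mul_row_block trmx0 mulmx0 add0r -row_mx0.
have e (d : nat) (c : 'rV[R]_d) : c *m (const_mx 1 : 'M[R]_(1, d))^T = (\sum_k c 0 k)%:M.
  apply/matrixP => i j; rewrite !ord1 !mxE mulr1n.
  by apply: eq_bigr => k _; rewrite !mxE mulr1.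
rewrite !e big_ord1; split=> [/eq_row_mx[/matrixP/(_ 0 0)]|[e0 ->]].
  by rewrite !mxE !mulr1n => /eqP; rewrite addr_eq0 => /eqP.
by rewrite e0 -raddfD addNr raddf0.
Qed.

Lemma diagonal_config_rank (R : realType) m q (C : 'M[R]_(m, q)) :
  \rank (diagonal_config C) = (1 + \rank C)%N.
Proof.
rewrite /diagonal_config.
have -> : block_mx (const_mx 1) (const_mx 1) 0 C =
    block_mx (1%:M : 'M[R]_1) 0 0 C *m block_mx (1%:M : 'M[R]_1) (const_mx 1) 0 1%:M.
  rewrite mulmx_block !mul0mx !mulmx0 !mul1mx mulmx1 !addr0 !add0r.
  by congr block_mx; apply/matrixP => i j; rewrite !ord1 !mxE.
rewrite mxrankMfree ?rank_diag_block_mx ?mxrank1 //.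
by rewrite row_free_unit unitmxE det_ublock !det1 mulr1 unitr1.
Qed.

Lemma ones_sub_diagonal (R : realType) m q (C : 'M[R]_(m, q)) :
  ((const_mx 1 : 'rV[R]_(1 + q)) <= diagonal_config C)%MS.
Proof.
apply/submxP; exists (row_mx 1%:M 0).
by rewrite /diagonal_config mul_row_block !mul0mx !mul1mx !addr0 row_mx_const.
Qed.

(** In a relation of the diagonal configuration the origin has coefficient minus the sum of the
    others. The condition on the sum in [linear_circuit] thus says that the origin is not an
    apex. *)
Lemma circuit_diagonal (R : realType) m q (C : 'M[R]_(m, q)) :
  circuit (diagonal_config C) <-> linear_circuit C.
Proof.
have split_rel (c : 'rV[R]_(1 + q)) : c = row_mx (lsubmx c) (rsubmx c) by rewrite hsubmxK.
split=> [[m0 [rk _] cod /(not_pyramidP (ones_sub_diagonal C)) nP]|[m0 eq fC [b [bC b0 bs]]]].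
  have rC : \rank C = m by move: rk; rewrite diagonal_config_rank => /addnI.
  have eq : q = m.+1 by move: cod; rewrite /codim; lia.
  have fC : row_free C by rewrite /row_free rC.
  split=> //.
  have k0 : 'I_q by rewrite eq; exact: ord0.
  have [c cA ck] := nP (rshift 1 k0).
  move: cA; rewrite [c]split_rel => /diagonal_config_rel[_ bC].
  set b := rsubmx c in bC.
  have bn0 : b != 0 by apply: contraNneq ck => /rowP/(_ k0); rewrite !mxE => ->.
  exists b; split=> //.
    move=> k; have [c' c'A c'k] := nP (rshift 1 k).
    move: c'A; rewrite [c']split_rel => /diagonal_config_rel[_ b'C].
    have [t Et] := linear_circuit_ker eq fC bC b'C bn0.
    apply: contraNneq c'k => bk; move/rowP/(_ k): Et; rewrite !mxE.
    by move: bk; rewrite mxE => ->; rewrite mulr0 => ->.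
  have [c' c'A c'k] := nP (lshift q 0).
  move: c'A; rewrite [c']split_rel => /diagonal_config_rel[e b'C].
  have [t Et] := linear_circuit_ker eq fC bC b'C bn0.
  apply: contraNneq c'k => s0; move: e; rewrite !mxE => ->.
  rewrite Et; under eq_bigr do rewrite mxE.
  by rewrite -mulr_sumr s0 mulr0 oppr0.
have ones := ones_sub_diagonal C.
split=> //.
- by split=> //; rewrite diagonal_config_rank (eqP fC).
- by rewrite /codim; lia.
- apply/not_pyramidP => // k; exists (row_mx (- \sum_k b 0 k)%:M b).
    by apply/diagonal_config_rel; rewrite !mxE mulr1n.
  case: (split_ordP k) => k' ->; rewrite ?row_mxEl ?row_mxEr //.
  by rewrite ord1 mxE mulr1n oppr_eq0.
Qed.

Lemma triangular_mxblock (F : fieldType) r (m q : 'I_r -> nat)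
    (T : forall i j : 'I_r, 'M[F]_(m i, q j)) :
  (forall i j : 'I_r, (j < i)%N -> T i j = 0) ->
  (forall i, linear_circuit (T i i)) -> triangular (\mxblock_(i, j) T i j).
Proof.
elim: r m q T => [|r IH] m q T T0 cT.
  have e (k : 'I_0 -> nat) : (\sum_i k i = 0)%N by rewrite big_ord0.
  apply/(@triangular_cast _ _ _ _ _ (e m, e q)).
  have -> : castmx (e m, e q) (\mxblock_(i, j) T i j) = 0 by apply/matrixP => -[].
  exact: triangular_nil.
rewrite mxblock_recul; apply/triangular_cast.
rewrite (_ : \mxcol_i T (lift ord0 i) ord0 = 0).
  apply: triangular_cons; first exact: cT.
  by apply: IH => // i j ji; apply: T0.
apply/matrixP => i j; rewrite !mxE.
by rewrite T0 // mxE.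
Qed.

Lemma triangular_mxblockP (F : fieldType) n q (A : 'M[F]_(n, q)) :
  triangular A -> exists r (m k : 'I_r -> nat)
    (en : (\sum_i m i = n)%N) (eq : (\sum_j k j = q)%N)
    (T : forall i j : 'I_r, 'M[F]_(m i, k j)),
    [/\ forall i j : 'I_r, (j < i)%N -> T i j = 0,
      forall i, linear_circuit (T i i) &
      A = castmx (en, eq) (\mxblock_(i, j) T i j)].
Proof.
move=> tA.
(* Families indexed by [nat] let a block be added in front by matching on the index, with no cast of
   the dependent block sizes. *)
have [r [m [k [en [eq [T [T0 cT ->]]]]]]] : exists r (m k : nat -> nat)
    (en : (\sum_(i < r) m i = n)%N) (eq : (\sum_(j < r) k j = q)%N)
    (T : forall i j : nat, 'M[F]_(m i, k j)),
    [/\ forall i j : 'I_r, (j < i)%N -> T i j = 0,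
      forall i : 'I_r, linear_circuit (T i i) &
      A = castmx (en, eq) (\mxblock_(i < r, j < r) T i j)]; last first.
  by exists r, (fun i => m i), (fun j => k j), en, eq, (fun i j => T i j).
elim: tA => {n q A} [|p q n q' A X B cA tB [r [m [k [en [eq [T [T0 cT EB]]]]]]]].
  exists 0%N, (fun=> 0%N), (fun=> 0%N), (big_ord0 _ _ _ _), (big_ord0 _ _ _ _), (fun _ _ => 0).
  by split=> [[]//|[]//|]; apply/matrixP => -[].
subst n q'; rewrite castmx_id in EB.
pose m' i := if i is i'.+1 then m i' else p.
pose k' j := if j is j'.+1 then k j' else q.
(* The value 0 for [j >= r] only makes the family total. *)
pose X' (j : nat) : 'M[F]_(p, k j) :=
  match Bool.bool_dec (j < r)%N true with
  | left h => submxrow X (Ordinal h)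
  | right _ => 0
  end.
pose T' (i j : nat) : 'M[F]_(m' i, k' j) :=
  match i return 'M[F]_(m' i, k' j) with
  | 0%N => match j return 'M[F]_(p, k' j) with 0%N => A | j'.+1 => X' j' end
  | i'.+1 => match j return 'M[F]_(m i', k' j) with 0%N => 0 | j'.+1 => T i' j' end
  end.
have en' : (\sum_(i < r.+1) m' i = p + \sum_(i < r) m i)%N by rewrite big_ord_recl.
have eq' : (\sum_(i < r.+1) k' i = q + \sum_(i < r) k i)%N by rewrite big_ord_recl.
exists r.+1, m', k', en', eq', T'; split.
- move=> i j; case: (unliftP ord0 i) => [i'|] ->; case: (unliftP ord0 j) => [j'|] -> //=.
  by rewrite /bump !add1n ltnS => ji; apply: T0.
- by move=> i; case: (unliftP ord0 i) => [i'|] -> //=; apply: cT.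
rewrite mxblock_recul castmx_comp.
have eX : X = \mxrow_(j < r) X' j.
  rewrite -[LHS]submxrowK; apply/eq_mxrow => -[j jr].
  rewrite /X' /=; case: Bool.bool_dec => [h|]; last by rewrite jr.
  by rewrite (bool_irrelevance jr h).
have z : \mxcol_(i < r) (0 : 'M[F]_(m i, q)) = 0 by apply/matrixP => i j; rewrite !mxE.
rewrite EB eX -z; exact: esym (castmx_id _ _).
Qed.

(* A spectrum normalized by the action of GL, as an affine configuration [P]. *)
Definition with_ones (F : fieldType) n N (P : 'M[F]_(n, N)) : 'M[F]_(1 + n, N) :=
  col_mx (const_mx 1) P.

Definition nondegenerate_relation (F : fieldType) n N (P : 'M[F]_(n, N)) (b : 'rV_N) :=
  [/\ \sum_k b 0 k = 0, b *m P^T = 0 & \det (gram P b) != 0].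

Lemma gram_ones_col (F : fieldType) n N (P : 'M[F]_(n, N)) (b : 'rV_N) :
  b *m (with_ones P)^T = 0 ->
  gram (with_ones P) b = block_mx 0 0 0 (gram P b).
Proof.
rewrite /with_ones tr_col_mx mul_mx_row -row_mx0 => /eq_row_mx[b1 bP].
have d1 : b = (const_mx 1 : 'rV_N) *m diag_mx b.
  by apply/rowP => j; rewrite mul_mx_diag !mxE mul1r.
rewrite /gram /with_ones tr_col_mx mul_col_mx mul_col_row -d1 b1 bP.
congr block_mx; apply: (can_inj (@trmxK _ _ _)).
by rewrite !trmx_mul trmxK tr_diag_mx mulmxA -d1 bP trmx0.
Qed.

Lemma ones_relP (F : fieldType) n N (P : 'M[F]_(n, N)) (b : 'rV_N) :
  b *m (with_ones P)^T = 0 <->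
  \sum_k b 0 k = 0 /\ b *m P^T = 0.
Proof.
have e : b *m (const_mx 1 : 'rV_N)^T = (\sum_k b 0 k)%:M.
  apply/matrixP => i j; rewrite !ord1 !mxE mulr1n.
  by apply: eq_bigr => k _; rewrite !mxE mulr1.
rewrite /with_ones tr_col_mx mul_mx_row e -row_mx0; split=> [/eq_row_mx[]|[-> ->]].
  by move=> /matrixP/(_ 0 0); rewrite !mxE mulr1n.
by rewrite raddf0.
Qed.

(** The Hessian of [with_ones P] is [gram P b] bordered by zeros. In terms of its rank,
    nondegeneracy is invariant under [GL] and can be moved between normalizations. *)
Lemma nondegenerate_rank (F : fieldType) n N (P : 'M[F]_(n, N)) (b : 'rV_N) :
  nondegenerate_relation P b <->
  b *m (with_ones P)^T = 0 /\
  (n <= \rank (gram (with_ones P) b))%N.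
Proof.
have rkE : b *m (with_ones P)^T = 0 ->
    (n <= \rank (gram (with_ones P) b))%N = (\det (gram P b) != 0).
  move=> bA; rewrite gram_ones_col // rank_diag_block_mx mxrank0 add0n.
  by rewrite -unitfE -unitmxE -row_free_unit /row_free eqn_leq rank_leq_row.
split=> [[b1 bP Hb]|[bA]].
  have bA : b *m (with_ones P)^T = 0 by apply/ones_relP.
  by rewrite rkE.
by rewrite rkE // => Hb; have /ones_relP[b1 bP] := bA.
Qed.

Lemma relation_mull (F : fieldType) m N (A : 'M[F]_(m, N)) g (b : 'rV_N) :
  g \in unitmx -> b *m (g *m A)^T = 0 <-> b *m A^T = 0.
Proof.
move=> gu; rewrite trmx_mul mulmxA; split => [cA|->]; last by rewrite mul0mx.
by rewrite -[LHS](mulmxK (_ : g^T \in unitmx)) ?unitmx_tr // cA mul0mx.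
Qed.

Lemma gram_rank_mull (F : fieldType) m N (A : 'M[F]_(m, N)) g (b : 'rV_N) :
  g \in unitmx -> \rank (gram (g *m A) b) = \rank (gram A b).
Proof.
move=> gu; rewrite gram_mull mxrankMfree ?row_free_unit ?unitmx_tr //.
by rewrite -mxrank_tr trmx_mul mxrankMfree ?row_free_unit ?unitmx_tr // mxrank_tr.
Qed.

Lemma colsub_extend (F : fieldType) m N M (A : 'M[F]_(m, N)) (f : 'I_M -> 'I_N)
    (b : 'rV_M) : injective f -> exists c : 'rV_N,
    c *m A^T = b *m (colsub f A)^T /\ gram A c = gram (colsub f A) b.
Proof.
move=> fi; pose c : 'rV[F]_N := \row_k \sum_(l | f l == k) b 0 l.
have sumc (V : lmodType F) (g : 'I_N -> V) :
    \sum_k c 0 k *: g k = \sum_l b 0 l *: g (f l).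
  under eq_bigr do rewrite mxE scaler_suml.
  rewrite (exchange_big_dep xpredT) //=; apply: eq_bigr => l _.
  by rewrite (big_pred1 (f l)) // => k; rewrite eq_sym.
exists c; rewrite !relationE !gramE !sumc; split; apply: eq_bigr => l _;
  by have -> : col l (colsub f A) = col (f l) A by apply/matrixP => i j; rewrite !mxE.
Qed.

Lemma castmx_diagonal_config (R : realType) m q m' q' (em : m = m') (eq : q = q')
    (em' : (1 + m = 1 + m')%N) (eq' : (1 + q = 1 + q')%N) (B : 'M[R]_(m, q)) :
  castmx (em', eq') (diagonal_config B) = diagonal_config (castmx (em, eq) B).
Proof. by subst m' q'; rewrite !castmx_id. Qed.

Theorem contains_iterated_circuitP (R : realType) n N (A : 'M[R]_(1 + n, N))
    (g : 'M[R]_(1 + n)) (P : 'M[R]_(n, N)) :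
  spectrum A -> g \in unitmx -> g *m A = with_ones P ->
  contains_iterated_circuit A <-> exists b, nondegenerate_relation P b.
Proof.
move=> [rkA _] gu Eg; split.
  move=> [M [f [fi rk [r [m [q [en [eN [T [m1 T0 [h [s [hu EB]]] cT]]]]]]]]]].
  have tB : triangular (\mxblock_(i, j) T i j).
    by apply: triangular_mxblock => // i; apply/circuit_diagonal.
  have [b [bB Hb]] := gram_of_triangular tB.
  have [b' [relb' rkb']] : exists b' : 'rV_M, b' *m (colsub f A)^T = 0 /\
     (n <= \rank (gram (colsub f A) b'))%N.
    have en' : (\sum_i m i = n)%N by apply: (@addnI 1).
    subst n M; move: EB; rewrite castmx_id.
    rewrite -[block_config T]/(diagonal_config (\mxblock_(i, j) T i j)).
    move: (\mxblock_(i, j) T i j) b bB Hb {tB} => B b bB Hb EB.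
    (* The origin receives minus the sum of [b], and the relation is then transported along the
       permutation [s]. *)
    have [d [dr dg]] := colsub_extend (h *m colsub f A)
      (row_mx (- \sum_k b 0 k)%:M b) (@perm_inj _ s).
    have EB' : colsub s (h *m colsub f A) = with_ones (row_mx 0 B).
      have -> : colsub s (h *m colsub f A) = col_perm s (h *m colsub f A).
        by apply/matrixP => i j; rewrite mxE [RHS]mxE.
      rewrite -EB /with_ones /diagonal_config block_mxEv.
      by rewrite row_mx_const.
    have : nondegenerate_relation (row_mx 0 B) (row_mx (- \sum_k b 0 k)%:M b).
      rewrite /nondegenerate_relation tr_row_mx mul_row_col trmx0 mulmx0 add0r bB.
      split=> //; last first.
        rewrite /gram diag_mx_row mul_row_block tr_row_mx mul_row_col.
        by rewrite !mul0mx !mulmx0 !add0r trmx0 mulmx0 add0r.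
      rewrite big_split_ord /= big_ord1 row_mxEl mxE mulr1n.
      rewrite [X in _ + X](eq_bigr (fun k => b 0 k)) ?addNr // => k _.
      by rewrite row_mxEr.
    move/nondegenerate_rank; rewrite -EB' => -[r0 rk0].
    exists d; split; first by apply/(relation_mull _ _ hu); rewrite dr.
    by rewrite -(gram_rank_mull _ _ hu) dg.
  have [c [cr cg]] := colsub_extend A b' fi.
  exists c; apply/nondegenerate_rank; rewrite -Eg; split.
    by apply/relation_mull => //; rewrite cr.
  by rewrite gram_rank_mull // cg.
move=> [b [b1 bP Hb]].
case: N A P rkA Eg b b1 bP Hb => [|N] A P rkA Eg b b1 bP Hb.
  by move: (rank_leq_col A); rewrite rkA.
(* Any point may serve as the origin of the iterated circuit. After translation its column in [P']
   is zero, so the other points carry the whole Hessian. *)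
pose k0 : 'I_N.+1 := ord0.
pose t := col k0 P.
pose P' := P - t *m (const_mx 1 : 'rV_N.+1).
pose g1 : 'M[R]_(1 + n) := block_mx 1%:M 0 (- t) 1%:M.
have Eg1 : g1 *m g *m A = with_ones P'.
  by rewrite -mulmxA Eg /with_ones mul_block_col !mul1mx mul0mx addr0 mulNmx addrC.
have g1u : g1 *m g \in unitmx.
  by rewrite unitmx_mul gu andbT unitmxE det_lblock !det1 mulr1 unitr1.
have [_ bP' Hb'] : nondegenerate_relation P' b.
  apply/nondegenerate_rank; rewrite -Eg1; split.
    by apply/relation_mull/(relation_mull _ _ gu) => //; rewrite Eg; apply/ones_relP.
  rewrite gram_rank_mull // -(gram_rank_mull _ _ gu) Eg.
  by have /nondegenerate_rank[] : nondegenerate_relation P b.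
have P'0 : col k0 P' = 0.
  by apply/matrixP => i j; rewrite !mxE big_ord1 !mxE mulr1 subrr.
have [||M [f [g' [fi g'u tg]]]] :=
    @triangular_of_gram _ _ _ (colsub (lift k0) P') (colsub (lift k0) b).
- by move: bP'; rewrite !relationE big_ord_recl P'0 trmx0 scaler0 add0r => E;
   rewrite -[RHS]E; apply: eq_bigr => k _; rewrite mxE; congr (_ *: _);
   apply/matrixP => i j; rewrite !mxE.
- congr (\det _ != 0): Hb'; rewrite !gramE big_ord_recl P'0 mul0mx scaler0 add0r.
  by apply: eq_bigr => k _; rewrite mxE; congr (_ *: (_ *m _));
    apply/matrixP => i j; rewrite !mxE.
have [r [m [q [en [eN [T [T0 cT ET]]]]]]] := triangular_mxblockP tg.
pose f' (i : 'I_(1 + M)) : 'I_N.+1 :=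
  match fintype.split i with inl _ => k0 | inr j => lift k0 (f j) end.
pose h : 'M[R]_(1 + n) := block_mx 1%:M 0 0 g' *m (g1 *m g).
have hu : h \in unitmx.
  by rewrite unitmx_mul g1u andbT unitmxE det_ublock det1 mul1r -unitmxE.
have Eh : h *m colsub f' A = diagonal_config (g' *m colsub f (colsub (lift k0) P')).
  have f'l i : f' (lshift _ i) = k0 by rewrite /f' (unsplitK (inl i)).
  have f'r i : f' (rshift _ i) = lift k0 (f i) by rewrite /f' (unsplitK (inr i)).
  have E1 : g1 *m g *m colsub f' A =
      diagonal_config (colsub f (colsub (lift k0) P')).
    have -> : g1 *m g *m colsub f' A = colsub f' (g1 *m g *m A).
      by apply/matrixP => i j; rewrite !mxE; apply: eq_bigr => l _; rewrite !mxE.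
    rewrite Eg1; apply/matrixP => i j; rewrite mxE /diagonal_config.
    case: (split_ordP i) => i' ->; case: (split_ordP j) => j' ->;
      rewrite ?f'l ?f'r /with_ones /block_mx !(col_mxEu, col_mxEd)
        ?row_mxEl ?row_mxEr.
    + by rewrite !mxE.
    + by rewrite !mxE.
    + by have /matrixP/(_ i' 0) := P'0; rewrite [LHS]mxE => ->; rewrite !mxE.
    + by rewrite [RHS]mxE [RHS]mxE.
  rewrite /h -mulmxA E1 /diagonal_config mulmx_block !mul1mx !mul0mx !mulmx0.
  by rewrite !addr0 !add0r.
exists (1 + M)%N, f'; split.
- move=> i j; rewrite /f'.
  case: (split_ordP i) => i' ->; case: (split_ordP j) => j' -> ;
    rewrite ?(unsplitK (inl _)) ?(unsplitK (inr _)) => e.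
  + by rewrite !ord1.
  + by move/eqP: e; rewrite (negbTE (neq_lift _ _)).
  + by move/eqP: e; rewrite eq_sym (negbTE (neq_lift _ _)).
  + by rewrite (fi _ _ (lift_inj e)).
- rewrite -mxrank_tr -(mxrankMfree _ (_ : row_free h^T)) ?row_free_unit ?unitmx_tr //.
  rewrite -trmx_mul mxrank_tr Eh diagonal_config_rank.
  by rewrite (eqP (triangular_free tg)).
have en' : (1 + \sum_i m i = 1 + n)%N by rewrite en.
have eN' : (1 + \sum_j q j = 1 + M)%N by rewrite eN.
exists r, m, q, en', eN', T; split=> //.
- by move=> i; have [] := cT i.
- exists h, 1%g; split=> //; rewrite col_perm1 Eh ET.
  exact: castmx_diagonal_config.
- by move=> i; apply/circuit_diagonal.
Qed.

Local Open Scope complex_scope.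

(** * Exponential estimates *)

Section RealBounds.
Variable R : realType.
Implicit Types x y : R.

(** The inequality [1 + y <= e^y] at [y = x] and at [y = - x] gives
    [1 + x <= e^x <= 1 / (1 - x)]. *)
Lemma expR_bound x : `|x| <= 2^-1 -> `|expR x - 1 - x| <= 2 * x ^+ 2.
Proof.
rewrite ler_norml => /andP[x1 x2].
have h1 := expR_ge1Dx x; have h2 := expR_ge1Dx (- x).
rewrite ger0_norm; last by lra.
have e0 := expR_gt0 x.
have h3 : expR x * (1 - x) <= 1.
  by rewrite -[leRHS](expRxMexpNx_1 x) ler_pM2l.
nra.
Qed.

Lemma MVT_eq0 (f g : R -> R) x : f 0 = 0 -> (forall t, is_derive t (1 : R) f (g t)) ->
  exists2 c, `|c| <= `|x| & f x = g c * x.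
Proof.
move=> f0 df.
have cf : continuous f.
  move=> t; apply: differentiable_continuous; apply/derivable1_diffP.
  by case: (df t).
have [x0|x0|->] := ltgtP x 0; last by exists 0; rewrite ?f0 ?mulr0.
  have [|c] := @MVT _ f g x 0 x0 (fun t _ => df t); first exact: continuous_subspaceT.
  rewrite in_itv /= f0 !sub0r mulrN => /andP[c1 c2] /oppr_inj e.
  by exists c => //; rewrite !ltr0_norm ?lerN2 // ltW.
have [|c] := @MVT _ f g 0 x x0 (fun t _ => df t); first exact: continuous_subspaceT.
rewrite in_itv /= f0 !subr0 => /andP[c1 c2] e.
by exists c => //; rewrite !gtr0_norm // ltW.
Qed.

Lemma sin_bound x : `|sin x| <= `|x|.
Proof.
have [c _ ->] := @MVT_eq0 (@sin R) (@cos R) x (sin0 R) (fun t => is_derive_sin t).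
by rewrite normrM ler_piMl ?normr_ge0 // cos_max.
Qed.

Lemma cos_bound x : `|cos x - 1| <= x ^+ 2.
Proof.
have [||c cx ->] := @MVT_eq0 (fun t => cos t - 1) (fun t => - sin t) x.
- by rewrite cos0 subrr.
- by move=> t; rewrite -[X in is_derive _ _ _ X]subr0; apply: is_deriveB.
rewrite normrM normrN -[x ^+ 2]ger0_norm ?sqr_ge0 // normrX expr2.
by rewrite ler_wpM2r // (le_trans (sin_bound _)).
Qed.

Lemma sin_bound2 x : `|sin x - x| <= `|x| ^+ 3.
Proof.
have [|c cx ->] := @MVT_eq0 (fun t => sin t - t) (fun t => cos t - 1) x.
  by rewrite sin0 subrr.
rewrite normrM exprSr ler_wpM2r // (le_trans (cos_bound _)) //.
by rewrite -[c ^+ 2]ger0_norm ?sqr_ge0 // normrX lerXn2r // nnegrE.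
Qed.
End RealBounds.

(** * Real-valued modulus and the complex exponential *)

Section Modulus.
Variable R : realType.
Implicit Types z w : C R.

(** The norm on [C R] takes its values in [C R]; this version lives in the ordered field [R], where
    real arithmetic applies. *)
Definition modulus (z : C R) : R := Normc.normc z.

Lemma modulusE z : `|z| = (modulus z)%:C. Proof. by []. Qed.
Lemma modulus0 : modulus 0 = 0. Proof. exact: Normc.normc0. Qed.
Lemma modulus1 : modulus 1 = 1. Proof. exact: Normc.normc1. Qed.
Lemma modulusM z w : modulus (z * w) = modulus z * modulus w.
Proof. exact: Normc.normcM. Qed.
Lemma modulusD z w : modulus (z + w) <= modulus z + modulus w.
Proof. exact: le_normcD. Qed.
Lemma modulusN z : modulus (- z) = modulus z.
Proof. exact: normcN. Qed.
Lemma modulusV z : modulus z^-1 = (modulus z)^-1.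
Proof. exact: Normc.normcV. Qed.
Lemma modulus_ge0 z : 0 <= modulus z.
Proof. by case: z => a b; apply: sqrtr_ge0. Qed.
Lemma modulus_eq0 z : (modulus z == 0) = (z == 0).
Proof. by apply/eqP/eqP => [/Normc.eq0_normc|->] //; rewrite modulus0. Qed.
Lemma modulusB z w : modulus (z - w) = modulus (w - z).
Proof. by rewrite -modulusN opprB. Qed.
Lemma modulus_Re z : `|complex.Re z| <= modulus z.
Proof. by rewrite -lecR; apply: normc_ge_Re. Qed.
Lemma modulus_Im z : `|complex.Im z| <= modulus z.
Proof.
case: z => a b; rewrite /modulus /= -sqrtr_sqr; apply: ler_wsqrtr.
by rewrite lerDr sqr_ge0.
Qed.
Lemma modulus_le z : modulus z <= `|complex.Re z| + `|complex.Im z|.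
Proof.
case: z => a b /=; rewrite -[leRHS]ger0_norm ?addr_ge0 // -sqrtr_sqr.
apply: ler_wsqrtr; rewrite sqrrD !real_normK ?num_real // -addrA lerD2l lerDr.
by rewrite mulrn_wge0 // mulr_ge0.
Qed.
Lemma modulus_real (a : R) : modulus (a%:C) = `|a|.
Proof. by rewrite /modulus /= expr0n addr0 sqrtr_sqr. Qed.

Lemma expC_bound z : modulus z <= 2^-1 -> modulus (expC z - 1 - z) <= 8 * modulus z ^+ 2.
Proof.
move=> z1; apply: le_trans (modulus_le _) _.
have hx := modulus_Re z; have hy := modulus_Im z.
case: z z1 hx hy => x y; set r := modulus _ => z1 /= hx hy.
have r0 : 0 <= r by apply: modulus_ge0.
have ex := expR_bound (le_trans hx z1).
have x2 : x ^+ 2 <= r ^+ 2 by rewrite -[x ^+ 2]real_normK ?num_real // lerXn2r ?nnegrE.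
have y2 : y ^+ 2 <= r ^+ 2 by rewrite -[y ^+ 2]real_normK ?num_real // lerXn2r ?nnegrE.
have cy := cos_bound y; have sy := sin_bound2 y.
have y3 : `|y| ^+ 3 <= r ^+ 2 * 2^-1.
  by rewrite exprSr ler_pM ?exprn_ge0 // ?lerXn2r ?nnegrE // (le_trans hy).
set e := expR x in ex *.
have e0 : 0 < e by apply: expR_gt0.
have e2 : e <= 2.
  move: ex hx; rewrite !ler_norml => /andP[_ ex] /andP[_ hx]; nra.
have -> : e * cos y - 1 - x = e * (cos y - 1) + (e - 1 - x) by ring.
have -> : e * sin y - 0 - y = e * (sin y - y) + (e - 1 - x) * y + x * y by ring.
have h1 : `|e * (cos y - 1)| <= 2 * r ^+ 2.
  rewrite normrM (gtr0_norm e0); apply: ler_pM => //; first exact: ltW.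
  exact: le_trans cy _.
have h2 : `|e * (sin y - y)| <= r ^+ 2.
  rewrite normrM (gtr0_norm e0); apply: (@le_trans _ _ (2 * (r ^+ 2 * 2^-1))).
    apply: ler_pM => //; first exact: ltW.
    exact: le_trans sy _.
  by lra.
have h3 : `|(e - 1 - x) * y| <= r ^+ 2.
  rewrite normrM; apply: (@le_trans _ _ (2 * r ^+ 2 * 2^-1)); last by lra.
  apply: ler_pM => //; last exact: le_trans hy _.
  by apply: le_trans ex _; rewrite ler_pM2l.
have h4 : `|x * y| <= r ^+ 2 by rewrite normrM expr2 ler_pM.
have h5 := ler_normD (e * (cos y - 1)) (e - 1 - x).
have h6 := ler_normD (e * (sin y - y) + (e - 1 - x) * y) (x * y).
have h7 := ler_normD (e * (sin y - y)) ((e - 1 - x) * y).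
have r2 : 0 <= r ^+ 2 by rewrite exprn_ge0.
lra.
Qed.

Lemma expCD z w : expC (z + w) = expC z * expC w.
Proof.
case: z w => a b [c d]; rewrite /expC /= expRD cosD sinD.
by apply/eqP; rewrite eq_complex /=; apply/andP; split; apply/eqP; ring.
Qed.

Lemma expC0 : expC 0 = 1 :> C R.
Proof. by rewrite /expC /= expR0 cos0 sin0 mul1r mulr0. Qed.

Lemma expCN z : expC (- z) * expC z = 1.
Proof. by rewrite -expCD addNr expC0. Qed.

Lemma expC_neq0 z : expC z != 0.
Proof. by apply: contra_eq_neq (expCN z) => ->; rewrite mulr0 eq_sym oner_eq0. Qed.

Lemma modulus_expC z : modulus (expC z) = expR (complex.Re z).
Proof.
case: z => x y; rewrite /modulus /expC /= !exprMn -mulrDr cos2Dsin2 mulr1 sqrtr_sqr.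
by rewrite gtr0_norm // expR_gt0.
Qed.

Lemma modulus_expC_le z : modulus (expC z) <= expR (modulus z).
Proof. by rewrite modulus_expC ler_expR (le_trans (ler_norm _)) // modulus_Re. Qed.

End Modulus.

(** * Real-valued sup norm on complex matrices, topology and differentiability *)

Section VectorNorm.
Variable R : realType.

Definition vnorm m n (x : 'M[C R]_(m, n)) : R :=
  \big[Num.max/0]_(k : 'I_m * 'I_n) modulus (x k.1 k.2).

Lemma vnorm_ge0 m n (x : 'M[C R]_(m, n)) : 0 <= vnorm x.
Proof.
rewrite /vnorm; elim/big_ind: _ => // [a b|i _]; rewrite ?le_max ?modulus_ge0 //.
by move->.
Qed.

Lemma modulus_vnorm m n (x : 'M[C R]_(m, n)) i j : modulus (x i j) <= vnorm x.
Proof. by rewrite /vnorm (le_bigmax _ _ (i, j)). Qed.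

Lemma vnorm_le m n (x : 'M[C R]_(m, n)) e : 0 <= e ->
  (forall i j, modulus (x i j) <= e) -> vnorm x <= e.
Proof. by move=> e0 H; apply/bigmax_leP; split => // -[i j] _; apply: H. Qed.

Lemma vnorm0 m n : vnorm (0 : 'M[C R]_(m, n)) = 0.
Proof.
apply/eqP; rewrite eq_le vnorm_ge0 andbT; apply: vnorm_le => // i j.
by rewrite mxE modulus0.
Qed.

Lemma vnorm_eq0 m n (x : 'M[C R]_(m, n)) : vnorm x = 0 -> x = 0.
Proof.
move=> x0; apply/matrixP => i j; rewrite mxE; apply/eqP; rewrite -modulus_eq0.
by rewrite eq_le modulus_ge0 andbT -x0 modulus_vnorm.
Qed.

Lemma vnormD m n (x y : 'M[C R]_(m, n)) : vnorm (x + y) <= vnorm x + vnorm y.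
Proof.
apply: vnorm_le => [|i j]; first by rewrite addr_ge0 ?vnorm_ge0.
by rewrite mxE (le_trans (modulusD _ _)) // lerD ?modulus_vnorm.
Qed.

Lemma vnormN m n (x : 'M[C R]_(m, n)) : vnorm (- x) = vnorm x.
Proof. by apply: eq_bigr => i _; rewrite mxE modulusN. Qed.

Lemma vnormB m n (x y : 'M[C R]_(m, n)) : vnorm (x - y) = vnorm (y - x).
Proof. by rewrite -vnormN opprB. Qed.

Lemma vnormBD m n (x y z : 'M[C R]_(m, n)) :
  vnorm (x - z) <= vnorm (x - y) + vnorm (y - z).
Proof. by rewrite (le_trans _ (vnormD _ _)) // addrA subrK. Qed.

Lemma vnormZ m n (a : C R) (x : 'M[C R]_(m, n)) : vnorm (a *: x) = modulus a * vnorm x.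
Proof.
have le b (y : 'M[C R]_(m, n)) : vnorm (b *: y) <= modulus b * vnorm y.
  apply: vnorm_le => [|i j]; first by rewrite mulr_ge0 ?modulus_ge0 ?vnorm_ge0.
  by rewrite mxE modulusM ler_wpM2l ?modulus_ge0 ?modulus_vnorm.
apply/eqP; rewrite eq_le le /=.
have [->|a0] := eqVneq a 0; first by rewrite modulus0 mul0r vnorm_ge0.
have am : 0 < modulus a by rewrite lt0r modulus_ge0 modulus_eq0 a0.
rewrite -ler_pdivlMl // -modulusV (le_trans _ (le _ _)) //.
by rewrite scalerA mulVf // scale1r.
Qed.

Lemma modulus_sum (I : Type) (s : seq I) (F : I -> C R) :
  modulus (\sum_(i <- s) F i) <= \sum_(i <- s) modulus (F i).
Proof.
elim/big_ind2: _ => [|a b c d h1 h2|//]; first by rewrite modulus0.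
by rewrite (le_trans (modulusD _ _)) // lerD.
Qed.

Definition mxbound m n (M : 'M[C R]_(m, n)) : R := m%:R * vnorm M.

Lemma mxbound_ge0 m n (M : 'M[C R]_(m, n)) : 0 <= mxbound M.
Proof. by rewrite mulr_ge0 // vnorm_ge0. Qed.

Lemma vnormM l m n (x : 'M[C R]_(l, m)) (M : 'M[C R]_(m, n)) :
  vnorm (x *m M) <= mxbound M * vnorm x.
Proof.
apply: vnorm_le => [|i j]; first by rewrite mulr_ge0 ?mxbound_ge0 ?vnorm_ge0.
rewrite mxE (le_trans (modulus_sum _ _)) //.
rewrite (@le_trans _ _ (\sum_(k < m) vnorm x * vnorm M)) //.
  by apply: ler_sum => k _; rewrite modulusM ler_pM ?modulus_ge0 ?modulus_vnorm.
by rewrite sumr_const card_ord -mulr_natl /mxbound mulrA mulrAC.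
Qed.

Lemma normrE_vnorm m n (x : 'M[C R]_(m, n)) : `|x| = (vnorm x)%:C.
Proof.
have le1 : `|x| <= (vnorm x)%:C :> C R.
  have [->|] := eqVneq `|x| 0; first by rewrite lecR vnorm_ge0.
  move=> /(@mx_norm_neq0 _ _ _ x)[[i j] /= E].
  by rewrite /Num.norm /= E modulusE lecR modulus_vnorm.
have r0 : `|x| = (complex.Re `|x|)%:C :> C R.
  by rewrite RRe_real // realE normr_ge0.
apply/eqP; rewrite eq_le le1 /= r0 lecR; apply: vnorm_le => [|i j].
  by rewrite -lecR -r0 normr_ge0.
rewrite -lecR -r0 -modulusE [leRHS]/Num.norm /= mx_normE -[leLHS]nngE num_le.
exact: (le_bigmax _ _ (i, j)).
Qed.

Lemma nbhs_vnormP m n (x : 'M[C R]_(m, n)) (U : set 'M[C R]_(m, n)) :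
  nbhs x U <-> exists2 e : R, 0 < e & forall y, vnorm (y - x) < e -> U y.
Proof.
split=> [/nbhs_normP[e /= e0 H]|[e e0 H]].
  have re : e = (complex.Re e)%:C by rewrite RRe_real // gtr0_real.
  exists (complex.Re e); first by rewrite -ltcR -re.
  by move=> y ye; apply: H; rewrite /ball_ /= normrE_vnorm re ltcR vnormB.
apply: nbhs_le_nbhs_norm; exists e%:C; first by rewrite /= ltcR.
by move=> y; rewrite /ball_ /= normrE_vnorm ltcR vnormB => /H.
Qed.

Lemma open_vnormP m n (U : set 'M[C R]_(m, n)) :
  open U <-> forall x, U x -> exists2 e : R, 0 < e & forall y, vnorm (y - x) < e -> U y.
Proof.
rewrite openE; split=> [H x /H /nbhs_vnormP//|H x /H ?].
by apply/nbhs_vnormP.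
Qed.

Lemma open_vball m n (x : 'M[C R]_(m, n)) r : open [set y | vnorm (y - x) < r].
Proof.
apply/open_vnormP => y /= yr; exists (r - vnorm (y - x)); first by rewrite subr_gt0.
by move=> z; rewrite ltrBrDr; apply/le_lt_trans/vnormBD.
Qed.

Lemma nbhs_modulusP (x : C R) (U : set (C R)) :
  nbhs x U <-> exists2 e : R, 0 < e & forall y, modulus (y - x) < e -> U y.
Proof.
split=> [/nbhs_normP[e /= e0 H]|[e e0 H]].
  have re : e = (complex.Re e)%:C by rewrite RRe_real // gtr0_real.
  exists (complex.Re e); first by rewrite -ltcR -re.
  by move=> y ye; apply: H; rewrite /ball_ /= modulusE re ltcR modulusB.
apply: nbhs_le_nbhs_norm; exists e%:C; first by rewrite /= ltcR.
by move=> y; rewrite /ball_ /= modulusE ltcR modulusB => /H.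
Qed.

Lemma linear_vnorm_continuous m n k (M : 'M[C R]_(m, n)) :
  continuous (mulmxr M : 'M[C R]_(k, m) -> 'M[C R]_(k, n)).
Proof.
move=> x U /nbhs_vnormP[e e0 H]; apply/nbhs_vnormP.
have K0 : 0 < 1 + mxbound M by rewrite ltr_wpDr ?mxbound_ge0.
exists (e / (1 + mxbound M)); first by rewrite divr_gt0.
move=> y ye; apply: H; rewrite /= -mulmxBl (le_lt_trans (vnormM _ _)) //.
rewrite (@le_lt_trans _ _ ((1 + mxbound M) * vnorm (y - x))) //.
  by rewrite ler_wpM2r ?vnorm_ge0 // lerDr.
by rewrite mulrC -ltr_pdivlMr.
Qed.

Lemma differentiable_vnorm m n (F : 'rV[C R]_m -> 'rV[C R]_n) x (L : 'M[C R]_(m, n)) :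
  (forall e, 0 < e -> exists2 d, 0 < d & forall h, vnorm h < d ->
     vnorm (F (x + h) - F x - h *m L) <= e * vnorm h) ->
  differentiable F x.
Proof.
move=> H.
pose V : normedModType (C R) := 'rV[C R]_m.
pose W : normedModType (C R) := 'rV[C R]_n.
have dF : (F : V -> W) \o shift (x : V) =
    cst (F x : W) + (mulmxr L : V -> W) +o_ (0 : V) id.
  apply: eqaddoE; apply/eqaddoP => e e0.
  have re : e = (complex.Re e)%:C by rewrite RRe_real // gtr0_real.
  have [|d d0 Hd] := H (complex.Re e); first by rewrite -ltcR -re.
  apply/nbhs_vnormP; exists d => // h; rewrite subr0 => hd.
  rewrite !normrE_vnorm re -rmorphM lecR; have := Hd h hd.
  rewrite !fctE /= [h + x]addrC opprD addrA; congr (_ <= _).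
apply/(@diff_locallyP _ V W); rewrite (@diff_unique _ V W _ (mulmxr L) x) //.
  by split; first exact: linear_vnorm_continuous.
exact: linear_vnorm_continuous.
Qed.

(** Applied to a slice chart, this shows that the inverse chart expands distances measured from a
    given point, with constants that depend on the point. *)
Lemma differentiable_lipschitz m n (F : 'rV[C R]_m -> 'rV[C R]_n) x :
  differentiable F x -> exists K, exists2 d, 0 < d & forall y, vnorm (y - x) < d ->
    vnorm (F y - F x) <= K * vnorm (y - x).
Proof.
pose V : normedModType (C R) := 'rV[C R]_m.
pose W : normedModType (C R) := 'rV[C R]_n.
move=> /(@diff_locallyP _ V W)[_ /eqaddoP E].
have /nbhs_vnormP[d d0 Hd] := E 1 ltr01.
pose J := lin1_mx ('d (F : V -> W) (x : V)).
exists (1 + mxbound J), d => // y yd.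
have := Hd (y - x); rewrite subr0 => /(_ yd).
rewrite mul1r !normrE_vnorm lecR !fctE /= subrK => h.
have -> : F y - F x = (F y - (F x + 'd (F : V -> W) (x : V) (y - x))) + (y - x) *m J.
  by rewrite mul_rV_lin1 opprD addrA subrK.
by rewrite (le_trans (vnormD _ _)) // mulrDl mul1r lerD // vnormM.
Qed.

End VectorNorm.

(** * Estimates for the function [a e^l] and its differential on bounded sets *)

Section ScalarEstimates.
Variable R : realType.
Implicit Types (a b l z : C R) (r s t : R).

Lemma expC_taylor r : exists2 K : R, 0 <= K &
  forall z, modulus z <= r -> modulus (expC z - 1 - z) <= K * modulus z ^+ 2.
Proof.
(* The 8 serves for [modulus z <= 1/2]. For larger [z] a constant bound is enough, since
   [1 <= 4 |z|^2]. *)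
exists (8 + 4 * (expR `|r| + 1 + `|r|)).
  by rewrite addr_ge0 // mulr_ge0 // !addr_ge0 // expR_ge0.
move=> z zr; have [z1|z1] := lerP (modulus z) 2^-1.
  apply: le_trans (expC_bound z1) _; rewrite ler_wpM2r ?sqr_ge0 // lerDl.
  by rewrite mulr_ge0 // !addr_ge0 // expR_ge0.
have h0 : modulus (expC z - 1 - z) <= expR `|r| + 1 + `|r|.
  apply: le_trans (modulusD _ _) _; rewrite modulusN lerD //; last first.
    by rewrite (le_trans zr) // ler_norm.
  apply: le_trans (modulusD _ _) _; rewrite modulusN modulus1 lerD2r.
  by rewrite (le_trans (modulus_expC_le _)) // ler_expR (le_trans zr) // ler_norm.
have h1 : 1 <= 4 * modulus z ^+ 2 by nra.
have h2 := modulus_ge0 (expC z - 1 - z).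
nra.
Qed.

Lemma expC_lip r : exists2 K : R, 0 <= K &
  forall z, modulus z <= r -> modulus (expC z - 1) <= K * modulus z.
Proof.
have [K K0 H] := expC_taylor r; exists (K * `|r| + 1).
  by rewrite addr_ge0 // mulr_ge0.
move=> z zr; rewrite -[expC z - 1](subrK z) (le_trans (modulusD _ _)) //.
rewrite mulrDl mul1r lerD2r (le_trans (H _ zr)) // expr2 mulrA.
by rewrite ler_wpM2r ?modulus_ge0 // ler_wpM2l // (le_trans zr) // ler_norm.
Qed.

Lemma amp_taylor r : exists2 K : R, 0 <= K & forall a l b z t,
  modulus a <= r -> modulus l <= r -> modulus b <= r -> modulus z <= r ->
  modulus b <= t -> modulus z <= t ->
  modulus ((a + b) * expC (l + z) - a * expC l - (b + a * z) * expC l) <= K * t ^+ 2.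
Proof.
have [K K0 H] := expC_taylor r.
exists (expR `|r| * (2 * `|r| * K + 1)).
  by rewrite mulr_ge0 ?expR_ge0 // addr_ge0 // !mulr_ge0.
move=> a l b z t ar lr br zr bt zt.
have -> : (a + b) * expC (l + z) - a * expC l - (b + a * z) * expC l =
   expC l * ((a + b) * (expC z - 1 - z) + b * z).
  by rewrite expCD; ring.
rewrite modulusM -mulrA ler_pM ?modulus_ge0 //.
  by rewrite (le_trans (modulus_expC_le _)) // ler_expR (le_trans lr) // ler_norm.
have t0 : 0 <= t := le_trans (modulus_ge0 _) bt.
rewrite (le_trans (modulusD _ _)) // !modulusM mulrDl mul1r lerD //; last first.
  by rewrite expr2 ler_pM ?modulus_ge0.
rewrite -(mulrA (2 * `|r|)) ler_pM ?modulus_ge0 //.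
  have -> : 2 * `|r| = `|r| + `|r| by ring.
  rewrite (le_trans (modulusD _ _)) // lerD //.
    by rewrite (le_trans ar) // ler_norm.
  by rewrite (le_trans br) // ler_norm.
by rewrite (le_trans (H _ zr)) // ler_wpM2l // lerXn2r ?nnegrE ?modulus_ge0.
Qed.

Lemma damp_bound r : exists2 K : R, 0 <= K & forall a l b z t,
  modulus a <= r -> modulus l <= r -> modulus b <= t -> modulus z <= t ->
  modulus ((b + a * z) * expC l) <= K * t.
Proof.
exists ((1 + `|r|) * expR `|r|); first by rewrite mulr_ge0 ?expR_ge0 ?addr_ge0.
move=> a l b z t ar lr bt zt.
have t0 : 0 <= t := le_trans (modulus_ge0 _) bt.
rewrite modulusM -mulrA [expR _ * t]mulrC mulrA ler_pM ?modulus_ge0 //.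
  rewrite (le_trans (modulusD _ _)) // mulrDl mul1r lerD // modulusM.
  by rewrite ler_pM ?modulus_ge0 // (le_trans ar) // ler_norm.
by rewrite (le_trans (modulus_expC_le _)) // ler_expR (le_trans lr) // ler_norm.
Qed.

Lemma damp_lip r : exists2 K : R, 0 <= K & forall a l a' l' b z s t,
  modulus a <= r -> modulus l <= r -> modulus a' <= r -> modulus l' <= r ->
  modulus (a - a') <= s -> modulus (l - l') <= s ->
  modulus b <= t -> modulus z <= t ->
  modulus ((b + a * z) * expC l - (b + a' * z) * expC l') <= K * (s * t).
Proof.
have [K K0 H] := expC_lip (r + r).
exists (expR `|r| + (1 + `|r|) * (expR `|r| * K)).
  by rewrite addr_ge0 ?expR_ge0 // mulr_ge0 ?addr_ge0 // mulr_ge0 // expR_ge0.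
move=> a l a' l' b z s t ar lr a'r l'r as_ ls bt zt.
have t0 : 0 <= t := le_trans (modulus_ge0 _) bt.
have s0 : 0 <= s := le_trans (modulus_ge0 _) as_.
have el c : modulus c <= r -> modulus (expC c) <= expR `|r|.
  by move=> cr; rewrite (le_trans (modulus_expC_le _)) // ler_expR (le_trans cr) // ler_norm.
have -> : (b + a * z) * expC l - (b + a' * z) * expC l' =
   expC l * ((a - a') * z) + (b + a' * z) * (expC l' * (expC (l - l') - 1)).
  by rewrite mulrBr -expCD mulr1 [l' + _]addrC subrK; ring.
rewrite (le_trans (modulusD _ _)) // [leRHS]mulrDl lerD //.
  by rewrite !modulusM ler_pM ?modulus_ge0 ?mulr_ge0 ?modulus_ge0 // ?el // ler_pM ?modulus_ge0.
rewrite [s * t]mulrC.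
have -> : (1 + `|r|) * (expR `|r| * K) * (t * s) =
    (1 + `|r|) * t * (expR `|r| * (K * s)) by ring.
rewrite !modulusM ler_pM ?modulus_ge0 ?mulr_ge0 ?modulus_ge0 //.
  rewrite (le_trans (modulusD _ _)) // mulrDl mul1r lerD // modulusM.
  by rewrite ler_pM ?modulus_ge0 // (le_trans a'r) // ler_norm.
rewrite ler_pM ?modulus_ge0 ?el //.
rewrite (le_trans (H _ _)) ?ler_wpM2l //.
by rewrite (le_trans (modulusD _ _)) // modulusN lerD.
Qed.

End ScalarEstimates.

Section ExponentialMap.
Variables (R : realType) (m N : nat) (Ma Ml Mc : 'M[C R]_(m, N)).
Implicit Types x y h : 'rV[C R]_m.

(** The common form of the Horn-Kapranov map, where [Mc = 0], and of the hypersurface patch, where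
    [Mc] carries the transverse direction. *)
Definition expmap x : 'rV[C R]_N :=
  \row_k ((x *m Ma) 0 k * expC ((x *m Ml) 0 k) + (x *m Mc) 0 k).

Lemma expmapE x k :
  expmap x 0 k = (x *m Ma) 0 k * expC ((x *m Ml) 0 k) + (x *m Mc) 0 k.
Proof. by rewrite mxE. Qed.

(* The Jacobian of [expmap], acting on row vectors from the right. *)
Definition dexpmap x : 'M[C R]_(m, N) :=
  Ma *m diag_mx (\row_k expC ((x *m Ml) 0 k)) +
  Ml *m diag_mx (\row_k ((x *m Ma) 0 k * expC ((x *m Ml) 0 k))) + Mc.

Lemma dexpmapE x h k : (h *m dexpmap x) 0 k =
  ((h *m Ma) 0 k + (x *m Ma) 0 k * (h *m Ml) 0 k) * expC ((x *m Ml) 0 k)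
  + (h *m Mc) 0 k.
Proof.
have d (M : 'M[C R]_(m, N)) (v : 'rV_N) :
    (h *m M *m diag_mx v) 0 k = (h *m M) 0 k * v 0 k by rewrite mul_mx_diag mxE.
rewrite /dexpmap !mulmxDr !mulmxA mxE; congr (_ + _).
rewrite mxE !d [X in _ * X + _]mxE [X in _ + _ * X]mxE mulrDl; congr (_ + _).
by rewrite mulrCA mulrA.
Qed.

Let B := mxbound Ma + mxbound Ml.
Let B0 : 0 <= B. Proof. by rewrite addr_ge0 ?mxbound_ge0. Qed.

Let coordMa x k : modulus ((x *m Ma) 0 k) <= B * vnorm x.
Proof.
rewrite (le_trans (modulus_vnorm _ _ _)) // (le_trans (vnormM _ _)) //.
by rewrite ler_wpM2r ?vnorm_ge0 // lerDl mxbound_ge0.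
Qed.

Let coordMl x k : modulus ((x *m Ml) 0 k) <= B * vnorm x.
Proof.
rewrite (le_trans (modulus_vnorm _ _ _)) // (le_trans (vnormM _ _)) //.
by rewrite ler_wpM2r ?vnorm_ge0 // lerDr mxbound_ge0.
Qed.

Lemma expmap_taylor r : exists2 K : R, 0 <= K & forall x h,
  vnorm x <= r -> vnorm h <= r ->
  vnorm (expmap (x + h) - expmap x - h *m dexpmap x) <= K * vnorm h ^+ 2.
Proof.
have [K K0 H] := amp_taylor (B * r).
exists (K * B ^+ 2); first by rewrite mulr_ge0 // exprn_ge0.
move=> x h xr hr; apply: vnorm_le => [|i k].
  by rewrite !mulr_ge0 ?exprn_ge0 // vnorm_ge0.
rewrite ord1 -mulrA -exprMn.
have -> : (expmap (x + h) - expmap x - h *m dexpmap x) 0 k =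
  ((x *m Ma) 0 k + (h *m Ma) 0 k) * expC ((x *m Ml) 0 k + (h *m Ml) 0 k)
  - (x *m Ma) 0 k * expC ((x *m Ml) 0 k) -
  ((h *m Ma) 0 k + (x *m Ma) 0 k * (h *m Ml) 0 k) * expC ((x *m Ml) 0 k).
  have mxB (u v : 'rV[C R]_N) : (u - v) 0 k = u 0 k - v 0 k by rewrite !mxE.
  have mxD (M : 'M[C R]_(m, N)) : ((x + h) *m M) 0 k = (x *m M) 0 k + (h *m M) 0 k.
    by rewrite mulmxDl mxE.
  by rewrite !mxB dexpmapE !expmapE !mxD; ring.
have le y : vnorm y <= r -> B * vnorm y <= B * r by move=> ?; rewrite ler_wpM2l.
apply: H; rewrite ?coordMa ?coordMl //.
- by rewrite (le_trans (coordMa _ _)) ?le.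
- by rewrite (le_trans (coordMl _ _)) ?le.
- by rewrite (le_trans (coordMa _ _)) ?le.
- by rewrite (le_trans (coordMl _ _)) ?le.
Qed.

Lemma dexpmap_bound r : exists2 K : R, 0 <= K & forall x h,
  vnorm x <= r -> vnorm (h *m dexpmap x) <= K * vnorm h.
Proof.
have [K K0 H] := damp_bound (B * r).
have K1 : 0 <= K * B + mxbound Mc.
  by apply: addr_ge0; [exact: mulr_ge0|exact: mxbound_ge0].
exists (K * B + mxbound Mc) => //.
move=> x h xr; apply: vnorm_le => [|i k]; first by rewrite mulr_ge0 ?vnorm_ge0.
rewrite ord1 dexpmapE (le_trans (modulusD _ _)) // [leRHS]mulrDl lerD //; last first.
  by rewrite (le_trans (modulus_vnorm _ _ _)) // vnormM.
have le y : vnorm y <= r -> B * vnorm y <= B * r by move=> ?; rewrite ler_wpM2l.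
rewrite -mulrA; apply: H => //.
  by rewrite (le_trans (coordMa _ _)) ?le.
by rewrite (le_trans (coordMl _ _)) ?le.
Qed.

Lemma dexpmap_lip r : exists2 K : R, 0 <= K & forall x y h,
  vnorm x <= r -> vnorm y <= r ->
  vnorm (h *m dexpmap x - h *m dexpmap y) <= K * vnorm (x - y) * vnorm h.
Proof.
have [K K0 H] := damp_lip (B * r).
exists (K * B ^+ 2); first by rewrite mulr_ge0 ?exprn_ge0.
move=> x y h xr yr; apply: vnorm_le => [|i k].
  by rewrite !mulr_ge0 ?vnorm_ge0 ?exprn_ge0.
have -> : K * B ^+ 2 * vnorm (x - y) * vnorm h = K * ((B * vnorm (x - y)) * (B * vnorm h)).
  by ring.
have mxB (u v : 'rV[C R]_N) : (u - v) i k = u 0 k - v 0 k by rewrite ord1 !mxE.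
have subDD (a b c : C R) : a + c - (b + c) = a - b by ring.
rewrite (etrans (mxB _ _) (congr2 (fun a b => a - b) (dexpmapE x h k) (dexpmapE y h k))).
rewrite subDD.
have le z : vnorm z <= r -> B * vnorm z <= B * r by move=> ?; rewrite ler_wpM2l.
have eB (M : 'M[C R]_(m, N)) : (x *m M) 0 k - (y *m M) 0 k = ((x - y) *m M) 0 k.
  by rewrite mulmxBl !mxE.
apply: H => //; rewrite ?eB //.
- by rewrite (le_trans (coordMa _ _)) ?le.
- by rewrite (le_trans (coordMl _ _)) ?le.
- by rewrite (le_trans (coordMa _ _)) ?le.
- by rewrite (le_trans (coordMl _ _)) ?le.
Qed.

(** Taylor's formula at [y] is combined with the Lipschitz bound on the differential between [y] and
    [x0]. Comparing two points with one fixed differential serves both the inverse function theorem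
    and the sliding in [singular_cover]. *)
Lemma expmap_strict r : exists2 K : R, 0 <= K & forall x0 x y s,
  vnorm x0 <= r -> vnorm (x - x0) <= s -> vnorm (y - x0) <= s -> s <= r ->
  vnorm (expmap x - expmap y - (x - y) *m dexpmap x0) <= K * s * vnorm (x - y).
Proof.
have [K1 K10 H1] := expmap_taylor (r + r).
have [K2 K20 H2] := dexpmap_lip (r + r).
exists (2 * K1 + K2); first by rewrite addr_ge0 // mulr_ge0.
move=> x0 x y s x0r xs ys sr.
have s0 : 0 <= s := le_trans (vnorm_ge0 _) xs.
have yr : vnorm y <= r + r.
  by rewrite -[y](subrK x0) (le_trans (vnormD _ _)) // lerD // (le_trans ys).
have hs : vnorm (x - y) <= s + s.
  by rewrite (le_trans (vnormBD _ x0 _)) // lerD // vnormB.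
have hr : vnorm (x - y) <= r + r by rewrite (le_trans hs) // lerD.
have x0r2 : vnorm x0 <= r + r by rewrite (le_trans x0r) // lerDl (le_trans s0).
have := H1 _ _ yr hr; rewrite [y + _]addrC subrK => h1.
have := H2 _ _ (x - y) yr x0r2 => h2.
have -> : expmap x - expmap y - (x - y) *m dexpmap x0 =
  (expmap x - expmap y - (x - y) *m dexpmap y) +
  ((x - y) *m dexpmap y - (x - y) *m dexpmap x0) by rewrite addrA subrK.
rewrite (le_trans (vnormD _ _)) // ![in leRHS]mulrDl lerD //.
  rewrite (le_trans h1) // !mul1r -!mulrA -mulrDr ler_wpM2l // -mulrDl expr2.
  by rewrite ler_wpM2r ?vnorm_ge0.
by rewrite (le_trans h2) // ler_wpM2r ?vnorm_ge0 // ler_wpM2l.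
Qed.

Lemma expmap_lip r : exists2 K : R, 0 <= K & forall x y,
  vnorm x <= r -> vnorm y <= r -> vnorm (expmap x - expmap y) <= K * vnorm (x - y).
Proof.
have [K1 K10 H1] := expmap_taylor (r + r).
have [K2 K20 H2] := dexpmap_bound r.
exists (K1 * `|r + r| + K2); first by rewrite addr_ge0 // mulr_ge0.
move=> x y xr yr.
have r0 : 0 <= r := le_trans (vnorm_ge0 _) xr.
have hr : vnorm (x - y) <= r + r by rewrite (le_trans (vnormD _ _)) // vnormN lerD.
have yr2 : vnorm y <= r + r by rewrite (le_trans yr) // lerDl.
have := H1 _ _ yr2 hr; rewrite [y + _]addrC subrK => h1.
rewrite -[expmap x - _](subrK ((x - y) *m dexpmap y)) (le_trans (vnormD _ _)) //.
rewrite [leRHS]mulrDl lerD ?H2 // (le_trans h1) // expr2 mulrA.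
rewrite ler_wpM2r ?vnorm_ge0 // ler_wpM2l // (le_trans hr) // ler_norm //.
Qed.

Lemma expmap_differentiable x : differentiable expmap x.
Proof.
apply: (@differentiable_vnorm _ _ _ _ _ (dexpmap x)) => e e0.
have [K K0 H] := expmap_taylor (vnorm x + 1).
have K1 : 0 < K + 1 by rewrite ltr_wpDl.
exists (Num.min 1 (e / (K + 1))); first by rewrite lt_min ltr01 divr_gt0.
move=> h; rewrite lt_min => /andP[h1 he].
have := H x h; rewrite lerDl ler01 (le_trans (ltW h1)) ?lerDr ?vnorm_ge0 // => /(_ isT isT).
move/le_trans; apply; rewrite expr2 mulrA ler_wpM2r ?vnorm_ge0 //.
rewrite (@le_trans _ _ ((K + 1) * vnorm h)) //.
  by rewrite ler_wpM2r ?vnorm_ge0 // lerDl.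
by rewrite mulrC -ler_pdivlMr // ltW.
Qed.

End ExponentialMap.

(** * A fixed point theorem and local inverses *)

HB.instance Definition _ (R : realType) m n := Complete.on 'M[R]_(m, n).

Lemma norm_row_le (R : realType) L (u : 'rV[R]_L) c : 0 <= c ->
  (`|u| <= c) <-> forall l, `|u 0 l| <= c.
Proof.
move=> c0; rewrite [X in X <= _]/Num.norm /= mx_normrE; split=> [/bigmax_leP[_ H] l|H].
  exact: (H (0, l)).
by apply/bigmax_leP; split=> // -[i l] _; rewrite ord1; apply: H.
Qed.

Section Realification.
Variables (R : realType) (N : nat).

Definition of_real (v : 'rV[R]_(N + N)) : 'rV[C R]_N :=
  \row_k (v 0 (lshift N k) +i* v 0 (rshift N k)).

Definition to_real (x : 'rV[C R]_N) : 'rV[R]_(N + N) :=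
  row_mx (\row_k complex.Re (x 0 k)) (\row_k complex.Im (x 0 k)).

Lemma to_realK : cancel to_real of_real.
Proof.
move=> x; apply/rowP => k; rewrite mxE row_mxEl row_mxEr !mxE.
by case: (x 0 k).
Qed.

Lemma of_realB v w : of_real v - of_real w = of_real (v - w).
Proof. by apply/rowP => k; rewrite !mxE. Qed.

Lemma to_realB x y : to_real x - to_real y = to_real (x - y).
Proof.
rewrite /to_real opp_row_mx add_row_mx.
by congr row_mx; apply/rowP => k; rewrite !mxE; case: (x 0 k); case: (y 0 k).
Qed.

Lemma vnorm_of_real v : vnorm (of_real v) <= 2 * `|v|.
Proof.
have H := (norm_row_le v (normr_ge0 _)).1 (lexx _).
apply: vnorm_le => [|i k]; first by rewrite mulr_ge0.
rewrite mxE (le_trans (modulus_le _)) //= mulr2n mulrDl mul1r.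
by rewrite lerD.
Qed.

Lemma norm_to_real x : `|to_real x| <= vnorm x.
Proof.
apply/norm_row_le => [|k]; first exact: vnorm_ge0.
case: (split_ordP k) => j ->; rewrite ?row_mxEl ?row_mxEr mxE.
  by rewrite (le_trans (modulus_Re _)) // modulus_vnorm.
by rewrite (le_trans (modulus_Im _)) // modulus_vnorm.
Qed.

(** The contraction principle is applied to real rows of double length. Passing back by [of_real]
    may double the norm, which explains the factor [4^-1] and the radius [s / 2]. *)
Lemma fixed_point (G : 'rV[C R]_N -> 'rV[C R]_N) x1 s : 0 <= s ->
  (forall x, vnorm (x - x1) <= s -> vnorm (G x - x1) <= s / 2) ->
  (forall x y, vnorm (x - x1) <= s -> vnorm (y - x1) <= s ->
     vnorm (G x - G y) <= 4^-1 * vnorm (x - y)) ->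
  exists2 x, vnorm (x - x1) <= s & G x = x.
Proof.
move=> s0 G1 G2.
pose U : set 'rV[R]_(N + N) := closed_ball_ Num.norm (to_real x1) (s / 2).
have UE v : U v -> vnorm (of_real v - x1) <= s.
  rewrite /U /closed_ball_ /= distrC => Uv; rewrite -[x1]to_realK of_realB.
  by rewrite (le_trans (vnorm_of_real _)) // mulrC -ler_pdivlMr.
pose f v := to_real (G (of_real v)).
have fU : set_fun U U f.
  move=> v /UE Uv; rewrite /U /closed_ball_ /= distrC /f to_realB.
  by rewrite (le_trans (norm_to_real _)) // G1.
have [|||v Uv fv] := @banach_fixed_point R _ U (mkfun_fun fU).
- have q0 : (0 : R) <= 2^-1 by rewrite invr_ge0.
  exists (NngNum q0); split => /=; first by rewrite invf_lt1 // ltr1n.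
  move=> [v w] [/= /UE Uv /UE Uw].
  rewrite /mkfun_fun /= /mkfun /f to_realB (le_trans (norm_to_real _)) //.
  rewrite (le_trans (G2 _ _ Uv Uw)) // of_realB.
  have := vnorm_of_real (v - w); set a := vnorm _; set b := `|_| => h.
  lra.
- exact: closed_closed_ball_.
- exists (to_real x1); rewrite /U /closed_ball_ /= subrr normr0 divr_ge0 //.
exists (of_real v); first exact: UE.
by rewrite {2}fv /mkfun_fun /= /mkfun /f to_realK.
Qed.

End Realification.

(** * The inverse function theorem *)

Section LocalInverse.
Variables (R : realType) (N : nat) (F : 'rV[C R]_N -> 'rV[C R]_N).
Variables (dF : 'rV[C R]_N -> 'M[C R]_N) (x0 : 'rV[C R]_N).
Hypothesis taylor : forall r, exists2 K : R, 0 <= K & forall x h,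
  vnorm x <= r -> vnorm h <= r ->
  vnorm (F (x + h) - F x - h *m dF x) <= K * vnorm h ^+ 2.
Hypothesis lip : forall r, exists2 K : R, 0 <= K & forall x y (h : 'rV_N),
  vnorm x <= r -> vnorm y <= r ->
  vnorm (h *m dF x - h *m dF y) <= K * vnorm (x - y) * vnorm h.
Hypothesis strict : forall r, exists2 K : R, 0 <= K & forall x0 x y s,
  vnorm x0 <= r -> vnorm (x - x0) <= s -> vnorm (y - x0) <= s -> s <= r ->
  vnorm (F x - F y - (x - y) *m dF x0) <= K * s * vnorm (x - y).
Hypothesis dFu : dF x0 \in unitmx.

Lemma unit_expand (T : 'M[C R]_N) : T \in unitmx ->
  exists2 K : R, 0 < K & forall h : 'rV_N, vnorm h <= K * vnorm (h *m T).
Proof.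
move=> uT; exists (mxbound (invmx T) + 1); first by rewrite ltr_wpDl ?mxbound_ge0.
move=> h; rewrite -{1}[h](mulmxK uT) (le_trans (vnormM _ _)) //.
by rewrite ler_wpM2r ?vnorm_ge0 // lerDl.
Qed.

Lemma expand_unit (T : 'M[C R]_N) (c : R) :
  (forall h : 'rV_N, vnorm h <= c * vnorm (h *m T)) -> T \in unitmx.
Proof.
move=> H; rewrite -row_free_unit -kermx_eq0 -submx0; apply/rV_subP => h /sub_kermxP hT.
rewrite submx0; apply/eqP/vnorm_eq0/eqP.
by rewrite eq_le vnorm_ge0 andbT (le_trans (H h)) // hT vnorm0 mulr0.
Qed.

Lemma local_expand : exists r c : R, [/\ 0 < r, 0 < c,
  forall x y, vnorm (x - x0) < r -> vnorm (y - x0) < r ->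
    vnorm (x - y) <= c * vnorm (F x - F y),
  forall x, vnorm (x - x0) < r -> dF x \in unitmx &
  forall x y, vnorm (x - x0) < r -> vnorm (y - x0) < r ->
    vnorm (((F x - F y) - (x - y) *m dF x0) *m invmx (dF x0)) <= 4^-1 * vnorm (x - y)].
Proof.
have [k k0 Hk] := unit_expand dFu.
set s0 := vnorm x0 + 1.
have s01 : 1 <= s0 by rewrite lerDr vnorm_ge0.
have [K K0 HK] := strict s0.
have [K2 K20 HK2] := lip s0.
set L := 1 + K + K2.
have L1 : 1 <= L by rewrite /L; lra.
(* Here [k] bounds the inverse of [dF x0] and [L] dominates both [K] and [K2]. On this ball the
   deviation of [F] and of [dF] from [dF x0], once multiplied by [k], is at most a quarter. *)
set r := Num.min 1 (4^-1 / (k * L)).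
have kL : 0 < k * L by rewrite mulr_gt0 //; lra.
have r0 : 0 < r by rewrite lt_min ltr01 divr_gt0.
have r1 : r <= 1 by rewrite ge_min lexx.
have rk : k * L * r <= 4^-1.
  by rewrite mulrC -ler_pdivlMr // ge_min lexx orbT.
have strict' x y : vnorm (x - x0) < r -> vnorm (y - x0) < r ->
    vnorm (F x - F y - (x - y) *m dF x0) <= K * r * vnorm (x - y).
  move=> xr yr; apply: HK => //; [by rewrite /s0 lerDl|exact: ltW|exact: ltW|].
  exact: le_trans s01.
have kKr : k * (K * r) <= 4^-1.
  by apply: le_trans rk; rewrite mulrA ler_pM2r // ler_pM2l //; rewrite /L; lra.
have kK2r : k * (K2 * r) <= 4^-1.
  by apply: le_trans rk; rewrite mulrA ler_pM2r // ler_pM2l //; rewrite /L; lra.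
exists r, (2 * k); split => //; first by rewrite mulr_gt0.
- move=> x y xr yr; have := strict' x y xr yr; set u := F x - F y; set v := x - y.
  move=> h1; have := Hk v.
  have h2 : vnorm (v *m dF x0) <= vnorm u + K * r * vnorm v.
    rewrite -[v *m dF x0](subKr u) (le_trans (vnormD _ _)) // lerD2l vnormN //.
  have v0 := vnorm_ge0 v; have u0 := vnorm_ge0 u; have w0 := vnorm_ge0 (v *m dF x0).
  move=> h3.
  have h4 : k * vnorm (v *m dF x0) <= k * (vnorm u + K * r * vnorm v) by rewrite ler_pM2l.
  have h5 : k * (K * r) * vnorm v <= 4^-1 * vnorm v by rewrite ler_wpM2r.
  have -> : 2 * k * vnorm u = 2 * (k * vnorm u) by ring.
  move: h4; rewrite mulrDr mulrA; lra.
- move=> x xr; apply: (@expand_unit _ (2 * k)) => h.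
  have xs : vnorm x <= s0.
    rewrite -[x](subrK x0) (le_trans (vnormD _ _)) // /s0 addrC lerD2l.
    by rewrite (le_trans (ltW xr)).
  have := HK2 x x0 h xs; rewrite /s0 lerDl ler01 => /(_ isT) h1.
  have h2 : K2 * vnorm (x - x0) * vnorm h <= K2 * r * vnorm h.
    by rewrite ler_wpM2r ?vnorm_ge0 // ler_wpM2l // ltW.
  have h3 : vnorm (h *m dF x0) <= vnorm (h *m dF x) + K2 * r * vnorm h.
    rewrite -[h *m dF x0](subKr (h *m dF x)) (le_trans (vnormD _ _)) // lerD2l vnormN.
    exact: le_trans h2.
  have h4 : k * vnorm (h *m dF x0) <= k * (vnorm (h *m dF x) + K2 * r * vnorm h).
    by rewrite ler_pM2l.
  have h5 : k * (K2 * r) * vnorm h <= 4^-1 * vnorm h by rewrite ler_wpM2r ?vnorm_ge0.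
  have h6 := Hk h; have h0 := vnorm_ge0 h.
  have -> : 2 * k * vnorm (h *m dF x) = 2 * (k * vnorm (h *m dF x)) by ring.
  move: h4; rewrite mulrDr mulrA; lra.
- move=> x y xr yr; apply: le_trans (Hk _) _; rewrite mulmxKV //.
  rewrite (@le_trans _ _ (k * (K * r * vnorm (x - y)))) // ?ler_pM2l ?strict' //.
  by rewrite mulrA ler_wpM2r ?vnorm_ge0.
Qed.

(* Newton's method with the frozen Jacobian at [x0] solves [F x = y]. *)
Lemma local_inverse (e : R) : 0 < e -> exists2 r : R, 0 < r <= e &
  exists phi : 'rV[C R]_N -> 'rV[C R]_N,
  let V := [set x | vnorm (x - x0) < r] in let U := F @` V in
  [/\ open U, forall x, V x -> phi (F x) = x & forall z, U z -> differentiable phi z].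
Proof.
move=> e0; have [r0 [c [r00 c0 inj dFu' contr]]] := local_expand.
set r := Num.min r0 e.
have r_gt0 : 0 < r by rewrite lt_min r00.
exists r; first by rewrite r_gt0 ge_min lexx orbT.
have lt0 x : vnorm (x - x0) < r -> vnorm (x - x0) < r0.
  by move=> h; rewrite (lt_le_trans h) // ge_min lexx.
pose V := [set x | vnorm (x - x0) < r].
have [k k0 Hk] := unit_expand dFu.
have openU : open (F @` V).
  apply/open_vnormP => _ [x1 /= Vx1 <-].
  set s := (r - vnorm (x1 - x0)) / 2.
  have s0 : 0 < s by rewrite divr_gt0 // subr_gt0.
  have inV x : vnorm (x - x1) <= s -> vnorm (x - x0) < r.
    move=> xs; rewrite (le_lt_trans (vnormBD _ x1 _)) //.
    rewrite (le_lt_trans (lerD xs (lexx _))) // /s.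
    have v1 : vnorm (x1 - x0) < r := Vx1.
    by rewrite -ltrBrDr ltr_pdivrMr // mulr_natr mulr2n ltrDl subr_gt0.
  have m0 : 0 < mxbound (invmx (dF x0)) + 1 by rewrite ltr_wpDl ?mxbound_ge0.
  (* For such [y] the first Newton step from [x1] has length at most [s / 4]; the contraction adds
     at most [s / 4], which gives the [s / 2] required by [fixed_point]. *)
  exists (s / 4 / (mxbound (invmx (dF x0)) + 1)).
    by apply: divr_gt0 => //; apply: divr_gt0.
  move=> y; rewrite ltr_pdivlMr // => ys.
  pose G x := x - (F x - y) *m invmx (dF x0).
  have GE x z : G x - G z =
      - ((F x - F z - (x - z) *m dF x0) *m invmx (dF x0)).
    have -> : (F x - F z - (x - z) *m dF x0) *m invmx (dF x0) =
        (F x - y) *m invmx (dF x0) - (F z - y) *m invmx (dF x0) - (x - z).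
      rewrite mulmxBl mulmxK // -mulmxBl; congr (_ *m _ - _).
      by rewrite opprB addrA subrK.
    have gen (a b : 'rV[C R]_N) : x - a - (z - b) = - (a - b - (x - z)).
      by rewrite !opprB addrACA [RHS]addrACA [- a - z]addrC.
    exact: gen.
  have Gc x z : vnorm (x - x1) <= s -> vnorm (z - x1) <= s ->
     vnorm (G x - G z) <= 4^-1 * vnorm (x - z).
    by move=> xs zs; rewrite GE vnormN contr // lt0 // inV.
  have G1 : vnorm (G x1 - x1) <= s / 4.
    rewrite /G addrAC subrr add0r vnormN (le_trans (vnormM _ _)) // vnormB.
    rewrite (le_trans _ (ltW ys)) // mulrC ler_wpM2l ?vnorm_ge0 // lerDl //.
  have [|x xs Gx] := fixed_point (ltW s0) _ Gc.
    move=> x xs; rewrite (le_trans (vnormBD _ (G x1) _)) //.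
    have := Gc x x1 xs; rewrite subrr vnorm0 (ltW s0) => /(_ isT).
    lra.
  exists x; first exact: inV.
  move: Gx; rewrite /G => /eqP; rewrite subr_eq -subr_eq0 opprD addrA subrr add0r oppr_eq0.
  move/eqP => E; apply/eqP; rewrite -subr_eq0; apply/eqP.
  by rewrite -[LHS](mulmxKV dFu) E mul0mx.
pose phi z := get [set x | V x /\ F x = z].
have phiK x : V x -> phi (F x) = x.
  move=> Vx; rewrite /phi.
  case: (getPex (ex_intro _ x (conj Vx erefl)) :
    [set y | V y /\ F y = F x] _) => Vy Fy.
  apply/eqP; rewrite -subr_eq0; apply/eqP/vnorm_eq0/eqP.
  rewrite eq_le vnorm_ge0 andbT (le_trans (inj _ _ (lt0 _ Vy) (lt0 _ Vx))) //.
  by rewrite Fy subrr vnorm0 mulr0.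
exists phi; split=> // _ [x1 Vx1 <-].
have u1 := dFu' _ (lt0 _ Vx1).
apply: (@differentiable_vnorm _ _ _ _ _ (invmx (dF x1))) => d d0.
have [K K0 HK] := taylor (vnorm x1 + 2 * r).
set M := mxbound (invmx (dF x1)) * (K * (c * c)) + 1.
have M0 : 0 < M by rewrite ltr_wpDl // mulr_ge0 ?mxbound_ge0 // mulr_ge0 // mulr_ge0 // ltW.
have /open_vnormP/(_ (F x1)) [|a a0 Ha] := openU; first by exists x1.
exists (Num.min a (d / M)); first by rewrite lt_min a0 divr_gt0.
move=> h; rewrite lt_min => /andP[ha hd].
have [|x Vx Fx] := Ha (F x1 + h); first by rewrite addrAC subrr add0r.
rewrite -Fx phiK // phiK //.
have hE : h = F x - F x1 by rewrite Fx addrAC subrr add0r.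
have xh : vnorm (x - x1) <= c * vnorm h by rewrite hE inj ?lt0.
have xr : vnorm (x - x1) <= 2 * r.
  rewrite (le_trans (vnormBD _ x0 _)) // mulr2n mulrDl !mul1r lerD //; first exact: ltW.
  by rewrite vnormB ltW.
have := HK x1 (x - x1); rewrite lerDl mulr_ge0 ?(ltW r_gt0) // => /(_ isT).
rewrite (le_trans xr) ?lerDr ?vnorm_ge0 // => /(_ isT); rewrite [x1 + _]addrC subrK -hE => h1.
have -> : x - x1 - h *m invmx (dF x1) = - ((h - (x - x1) *m dF x1) *m invmx (dF x1)).
  by rewrite mulmxBl mulmxK // opprB.
rewrite vnormN (le_trans (vnormM _ _)) //.
rewrite (@le_trans _ _ (mxbound (invmx (dF x1)) * (K * (c * c)) * vnorm h * vnorm h)) //.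
  have : 0 <= mxbound (invmx (dF x1)) := mxbound_ge0 _.
  move: (mxbound _) => m m0; rewrite -!mulrA ler_wpM2l // (le_trans h1) // ler_wpM2l //.
  rewrite (_ : c * (c * _) = (c * vnorm h) ^+ 2); last by ring.
  by rewrite lerXn2r ?nnegrE ?vnorm_ge0 // mulr_ge0 ?vnorm_ge0 // ltW.
rewrite ler_wpM2r ?vnorm_ge0 // (@le_trans _ _ (M * vnorm h)) //.
  by rewrite ler_wpM2r ?vnorm_ge0 // lerDl.
by rewrite mulrC -ler_pdivlMr // ltW.
Qed.

End LocalInverse.

(** * The dual variety *)

Definition complexify (R : realType) m N (A : 'M[R]_(m, N)) : 'M[C R]_(m, N) :=
  \matrix_(i, j) ((A i j)%:C : C R).

Lemma complexifyE (R : realType) m N (A : 'M[R]_(m, N)) :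
  complexify A = map_mx (real_complex R) A.
Proof. by apply/matrixP => i j; rewrite !mxE. Qed.

Lemma complexifyM (R : realType) m n p (A : 'M[R]_(m, n)) (B : 'M[R]_(n, p)) :
  complexify (A *m B) = complexify A *m complexify B.
Proof. by rewrite !complexifyE map_mxM. Qed.

Lemma complexify_ones (R : realType) n N (P : 'M[R]_(n, N)) :
  complexify (with_ones P) = with_ones (complexify P).
Proof. by rewrite !complexifyE /with_ones map_col_mx map_const_mx. Qed.

Section DualVariety.
Variables (R : realType) (m N : nat) (A : 'M[R]_(m, N)).

Definition exp_sum_derive (c : 'rV[C R]_N) (w v : 'rV[C R]_m) : C R :=
  \sum_k c 0 k * (v *m complexify A) 0 k * expC ((w *m complexify A) 0 k).

Lemma exp_sum_taylor c w v : exists2 K : R, 0 <= K & forall h : C R, modulus h <= 1 ->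
  modulus (exp_sum A c (h *: v + w) - exp_sum A c w - h * exp_sum_derive c w v)
    <= K * modulus h ^+ 2.
Proof.
set W := w *m complexify A; set V := v *m complexify A.
have [K K0 HK] := amp_taylor (vnorm c + vnorm W + vnorm V).
have c0 := vnorm_ge0 c; have W0 := vnorm_ge0 W; have V0 := vnorm_ge0 V.
exists (N%:R * (K * vnorm V ^+ 2)); first by rewrite !mulr_ge0 // exprn_ge0.
move=> h h1; rewrite /exp_sum /exp_sum_derive -/W -/V mulr_sumr -!sumrB.
rewrite (le_trans (modulus_sum _ _)) //.
rewrite (@le_trans _ _ (\sum_(k < N) K * (vnorm V * modulus h) ^+ 2)) //; last first.
  by rewrite sumr_const card_ord -[leLHS]mulr_natl exprMn !mulrA.
apply: ler_sum => k _.
have -> : ((h *: v + w) *m (\matrix_(i, j) ((A i j)%:C : C R))) 0 k = W 0 k + h * V 0 k.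
  have gen (x y : 'rV[C R]_N) : (h *: x + y) 0 k = y 0 k + h * x 0 k.
    by rewrite !mxE addrC.
  by rewrite mulmxDl -scalemxAl gen.
have hV : modulus (h * V 0 k) <= vnorm V * modulus h.
  by rewrite modulusM mulrC ler_wpM2r ?modulus_ge0 // modulus_vnorm.
have := HK (c 0 k) (W 0 k) 0 (h * V 0 k) (vnorm V * modulus h).
rewrite addr0 add0r modulus0 => H.
have -> : h * (c 0 k * V 0 k * expC (W 0 k)) = c 0 k * (h * V 0 k) * expC (W 0 k) by ring.
apply: H => //.
- by rewrite (le_trans (modulus_vnorm _ _ _)) // -addrA lerDl addr_ge0.
- by rewrite (le_trans (modulus_vnorm _ _ _)) // addrAC lerDr addr_ge0.
- by rewrite !addr_ge0.
- rewrite (le_trans hV) // (@le_trans _ _ (vnorm V)) //; last by rewrite lerDr addr_ge0.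
  by rewrite -[leRHS]mulr1 ler_wpM2l.
- by rewrite mulr_ge0 // modulus_ge0.
Qed.

Lemma is_derive_exp_sum c w v : is_derive w v (exp_sum A c) (exp_sum_derive c w v).
Proof.
have [K K0 HK] := exp_sum_taylor c w v.
have cv : (fun h : C R => h^-1 *: ((exp_sum A c \o shift w) (h *: v) - exp_sum A c w))
    @ 0^' --> (exp_sum_derive c w v : C R).
  apply/cvgrPdist_le => e e0.
  have re : e = (complex.Re e)%:C by rewrite RRe_real // gtr0_real.
  have er0 : 0 < complex.Re e by rewrite -ltcR -re.
  have K1 : 0 < K + 1 by rewrite ltr_wpDl.
  rewrite /dnbhs /within; apply/nbhs_modulusP.
  exists (Num.min 1 (complex.Re e / (K + 1))); first by rewrite lt_min ltr01 divr_gt0.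
  move=> h; rewrite subr0 lt_min => /andP[h1 he] h0.
  rewrite modulusE re lecR -modulusN opprB.
  set D := _ - exp_sum A c w; set d := exp_sum_derive c w v.
  have -> : h^-1 *: D - d = h^-1 * (D - h * d).
    by rewrite mulrBr mulrA mulVf // mul1r.
  rewrite modulusM modulusV mulrC ler_pdivrMr; last first.
    by rewrite lt0r modulus_ge0 modulus_eq0 h0.
  rewrite (le_trans (HK _ (ltW h1))) // expr2 mulrA ler_wpM2r ?modulus_ge0 //.
  rewrite (@le_trans _ _ ((K + 1) * modulus h)) //.
    by rewrite ler_wpM2r ?modulus_ge0 // lerDl.
  by rewrite mulrC -ler_pdivlMr // ltW.
split; first by apply/cvg_ex; exists (exp_sum_derive c w v).
by apply: cvg_lim cv; apply: norm_hausdorff.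
Qed.

Lemma singular_pointP c w : singular_point (exp_sum A c) w <->
  exp_sum A c w = 0 /\
  (\row_k (c 0 k * expC ((w *m complexify A) 0 k))) *m (complexify A)^T = 0.
Proof.
rewrite /singular_point.
have E i : ((\row_k (c 0 k * expC ((w *m complexify A) 0 k))) *m (complexify A)^T) 0 i
    = exp_sum_derive c w (delta_mx 0 i).
  rewrite mxE; apply: eq_bigr => k _; rewrite -rowE !mxE; ring.
split=> -[f0 H]; split=> //.
  apply/rowP => i; rewrite E [RHS]mxE; have Hi := H i.
  have D := is_derive_exp_sum c w (delta_mx 0 i).
  by rewrite -(@derive_val _ _ _ _ _ _ _ D) (@derive_val _ _ _ _ _ _ _ Hi).
move=> i; have := is_derive_exp_sum c w (delta_mx 0 i); congr is_derive.
by rewrite -E H mxE.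
Qed.

End DualVariety.

(** The coordinate of [w] paired with the row of ones multiplies all terms by the same nonzero
    factor, so only [n] coordinates matter, and singularity says that the terms form a relation. *)
Lemma dual_varietyP (R : realType) n N (A : 'M[R]_(1 + n, N)) (g : 'M[R]_(1 + n))
    (P : 'M[R]_(n, N)) c :
  g \in unitmx -> g *m A = with_ones P ->
  dual_variety A c <-> torus c /\ exists w : 'rV[C R]_n,
    (\row_k (c 0 k * expC ((w *m complexify P) 0 k))) *m (complexify (with_ones P))^T = 0.
Proof.
move=> gu Eg.
have gCu : complexify g \in unitmx by rewrite complexifyE map_unitmx.
have AE : complexify g *m complexify A = complexify (with_ones P) by rewrite -complexifyM Eg.
have oneE := complexify_ones P.
have expsum_b w : exp_sum A c w = \sum_k (\row_k (c 0 k * expC ((w *m complexify A) 0 k))) 0 k.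
  by apply: eq_bigr => k _; rewrite mxE.
split=> -[tc [w Hw]]; split=> //.
  move: Hw => /singular_pointP[_ bA].
  pose w' := w *m invmx (complexify g).
  have wE k : (w *m complexify A) 0 k = w' 0 0 + (rsubmx w' *m complexify P) 0 k.
    rewrite -(mulKmx gCu (complexify A)) AE mulmxA -/w' oneE -{1}[w']hsubmxK mul_row_col.
    have gen (u : 'rV[C R]_(1 + n)) :
        (lsubmx u *m (const_mx 1 : 'M[C R]_(1, N))) 0 k = u 0 0.
      by rewrite mxE big_ord1 !mxE mulr1; congr (u _ _); apply/val_inj.
    by rewrite mxE gen.
  exists (rsubmx w').
  have -> : \row_k (c 0 k * expC ((rsubmx w' *m complexify P) 0 k)) =
      expC (- w' 0 0) *: \row_k (c 0 k * expC ((w *m complexify A) 0 k)).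
    apply/rowP => k; rewrite mxE [RHS]mxE [X in _ = _ * X]mxE wE expCD.
    have gen (a x y z : C R) : z * x = 1 -> a * y = z * (a * (x * y)).
      by move=> zx; rewrite mulrCA [z * _]mulrA zx mul1r.
    exact/gen/expCN.
  by rewrite -scalemxAl -AE trmx_mul mulmxA bA mul0mx scaler0.
exists (row_mx 0 w *m complexify g).
have wE k : ((row_mx 0 w *m complexify g) *m complexify A) 0 k = (w *m complexify P) 0 k.
  by rewrite -mulmxA AE oneE mul_row_col mul0mx add0r.
apply/singular_pointP.
have bE : \row_k (c 0 k * expC (((row_mx 0 w *m complexify g) *m complexify A) 0 k)) =
    \row_k (c 0 k * expC ((w *m complexify P) 0 k)).
  by apply/rowP => k; rewrite mxE wE [RHS]mxE.
split.
  rewrite expsum_b bE; move: Hw; rewrite oneE => /ones_relP[-> //].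
rewrite bE -(mulKmx gCu (complexify A)) AE trmx_mul mulmxA Hw mul0mx //.
Qed.

(** * A hypersurface in the dual variety *)

Lemma row_base_rank (F : fieldType) p N d (U : 'M[F]_(p, N)) : \rank U = d ->
  exists K : 'M[F]_(d, N), row_free K /\ (K :=: U)%MS.
Proof.
move=> <-; exists (row_base U).
by split; [exact: row_base_free|exact: eq_row_base].
Qed.

Lemma relation_basis (F : fieldType) m d N (W : 'M[F]_(m, N)) :
  row_free W -> (d + m)%N = N ->
  exists K : 'M[F]_(d, N), [/\ row_free K, K *m W^T = 0 &
    forall b : 'rV_N, b *m W^T = 0 -> (b <= K)%MS].
Proof.
move=> fW dN; have rk : \rank (kermx W^T) = d.
  by rewrite mxrank_ker mxrank_tr (eqP fW) -dN addnK.
have [K [fK eK]] := row_base_rank rk; exists K; split => //.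
  by apply/sub_kermxP; rewrite eK.
by move=> b /sub_kermxP; rewrite eK.
Qed.

Section HypersurfacePatch.
Variables (R : realType) (n d : nat).
Let N := (d + n + 1)%N.
Variables (P : 'M[R]_(n, N)) (K : 'M[R]_(d, N)) (b : 'rV[R]_N).
Hypothesis fK : row_free K.
Hypothesis KW : K *m (with_ones P)^T = 0.
Hypothesis bK : (b <= K)%MS.
Hypothesis b0 : forall k, b 0 k != 0.
Hypothesis Hb : \det (gram P b) != 0.

Let last_idx : 'I_N := rshift (d + n) ord0.
Let KC := complexify K.
Let PC := complexify P.
Let Ma : 'M[C R]_N := col_mx (col_mx KC 0) 0.
Let Ml : 'M[C R]_N := col_mx (col_mx 0 (- PC)) 0.
Let Mc : 'M[C R]_N := col_mx 0 (const_mx 1).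

(* The coordinates [(beta, w, s)] are sent to [(beta K) e^{- w P} + s (1, .., 1)];
   the conormal of the dual variety at [w = 0] is [(1, .., 1)], so that the last
   direction is transverse to it. *)
Definition hypersurface_patch := expmap Ma Ml Mc.
Definition dhypersurface_patch := dexpmap Ma Ml Mc.

Lemma mul_hypersurface_patch (x : 'rV[C R]_N) :
  [/\ x *m Ma = lsubmx (lsubmx x) *m KC, x *m Ml = - (rsubmx (lsubmx x) *m PC) &
    forall k, (x *m Mc) 0 k = x 0 last_idx].
Proof.
split.
- by rewrite -{1}[x]hsubmxK -{1}[lsubmx x]hsubmxK !mul_row_col !mulmx0 !addr0.
- by rewrite -{1}[x]hsubmxK -{1}[lsubmx x]hsubmxK !mul_row_col !mulmx0 !addr0 add0r mulmxN.
by move=> k; rewrite -{1}[x]hsubmxK mul_row_col mulmx0 add0r mxE big_ord1 !mxE mulr1.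
Qed.

Lemma hypersurface_patchE x k : hypersurface_patch x 0 k =
  (lsubmx (lsubmx x) *m KC) 0 k * expC (- (rsubmx (lsubmx x) *m PC) 0 k) + x 0 last_idx.
Proof.
have [e1 e2 e3] := mul_hypersurface_patch x.
have n0 (y : 'rV[C R]_N) : (- y) 0 k = - y 0 k by rewrite mxE.
by rewrite /hypersurface_patch expmapE e1 e2 e3 n0.
Qed.

Lemma basis_relation : KC *m (complexify (with_ones P))^T = 0.
Proof. by rewrite /KC !complexifyE map_trmx -map_mxM KW map_mx0. Qed.

Variable beta : 'rV[C R]_d.
Hypothesis betaK : beta *m KC = complexify b.

Let x0 : 'rV[C R]_N := row_mx (row_mx beta 0) 0.

(** A kernel vector [(be, om, s)] satisfies [be K - b (om P) + s = 0] coordinatewise. Summing over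
    the points leaves [N s = 0]. Pairing with [P] then gives [om H(b) = 0], hence [om = 0], and
    finally [be = 0] because [K] is row free. *)
Lemma dhypersurface_patch_unit : dhypersurface_patch x0 \in unitmx.
Proof.
rewrite -row_free_unit -kermx_eq0 -submx0; apply/rV_subP => h /sub_kermxP hT.
rewrite submx0.
set be := lsubmx (lsubmx h); set om := rsubmx (lsubmx h); set s := h 0 last_idx.
have E k : (be *m KC) 0 k - (complexify b) 0 k * (om *m PC) 0 k + s = 0.
  have [a1 a2 a3] := mul_hypersurface_patch x0; have [h1 h2 h3] := mul_hypersurface_patch h.
  move: a1 a2; rewrite /x0 !row_mxKl row_mxKr mul0mx oppr0 betaK => a1 a2.
  have := dexpmapE Ma Ml Mc x0 h k; rewrite -/dhypersurface_patch hT a1 a2 h1 h2 h3.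
  have n0 (y : 'rV[C R]_N) : (- y) 0 k = - y 0 k by rewrite mxE.
  have z0 : (0 : 'rV[C R]_N) 0 k = 0 by rewrite mxE.
  by rewrite n0 !z0 expC0 mulr1 mulrN => ->.
have /ones_relP[beK1 beKP] : (be *m KC) *m (with_ones PC)^T = 0.
  by rewrite -complexify_ones -mulmxA basis_relation mulmx0.
have bW : b *m (with_ones P)^T = 0.
  by have /submxP[y ->] := bK; rewrite -mulmxA KW mulmx0.
have /ones_relP[b1 bP] : (complexify b) *m (with_ones PC)^T = 0.
  by rewrite -complexify_ones !complexifyE map_trmx -map_mxM bW map_mx0.
have s0 : s = 0.
  have : \sum_(k < N) ((be *m KC) 0 k - (complexify b) 0 k * (om *m PC) 0 k + s) = 0.
    by rewrite big1.
  rewrite big_split /= sumrB beK1 sumr_const card_ord.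
  have -> : \sum_(k < N) (complexify b) 0 k * (om *m PC) 0 k = 0.
    have : om *m (complexify b *m PC^T)^T = 0 by rewrite bP trmx0 mulmx0.
    rewrite trmx_mul trmxK mulmxA => /matrixP/(_ 0 0); rewrite [LHS]mxE [RHS]mxE => e.
    have t (y : 'rV[C R]_N) k : y^T k 0 = y 0 k by rewrite mxE.
    by rewrite -[RHS]e; apply: eq_bigr => k _; rewrite t mulrC.
  rewrite subr0 add0r => /eqP; rewrite -mulr_natr mulf_eq0 pnatr_eq0 orbC.
  by rewrite /N addn1 => /eqP.
have E2 : be *m KC = om *m PC *m diag_mx (complexify b).
  apply/rowP => k; rewrite mul_mx_diag [RHS]mxE.
  by move: (E k); rewrite s0 addr0 => /eqP; rewrite subr_eq0 mulrC => /eqP.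
have om0 : om = 0.
  have uH : complexify (gram P b) \in unitmx.
    by rewrite complexifyE map_unitmx unitmxE unitfE.
  have : om *m complexify (gram P b) = 0.
    rewrite -[RHS]beKP E2 -!mulmxA; congr (_ *m _).
    rewrite /gram /PC !complexifyE !map_mxM map_trmx mulmxA; congr (_ *m _ *m _).
    by rewrite map_diag_mx.
  by move/(congr1 (mulmx^~ (invmx (complexify (gram P b))))); rewrite mulmxK // mul0mx.
have be0 : be = 0.
  have fKC : row_free KC by rewrite /KC complexifyE /row_free mxrank_map.
  by apply/eqP; rewrite -(mulmx_free_eq0 _ fKC) E2 om0 !mul0mx.
rewrite -[h]hsubmxK -[lsubmx h]hsubmxK -/be -/om be0 om0 row_mx0.
apply/eqP/rowP => k; case: (split_ordP k) => j ->; rewrite ?row_mxEl ?row_mxEr !mxE //.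
by rewrite -[RHS]s0 /s ord1.
Qed.

End HypersurfacePatch.

Lemma map_sub_complexify (R : realType) m N (K : 'M[R]_(m, N)) (b : 'rV[R]_N) :
  (b <= K)%MS -> exists beta, beta *m complexify K = complexify b.
Proof. by move=> /submxP[y ->]; exists (complexify y); rewrite complexifyM. Qed.

Theorem not_dual_defective (R : realType) n N (A : 'M[R]_(1 + n, N))
    (g : 'M[R]_(1 + n)) (P : 'M[R]_(n, N)) (b : 'rV[R]_N) :
  \rank A = (1 + n)%N -> g \in unitmx -> g *m A = with_ones P ->
  nondegenerate_relation P b -> (forall k, b 0 k != 0) -> ~ dual_defective A.
Proof.
move=> rkA gu Eg ndb b0; apply; move: (ndb) => [b1 bP Hb].
have fW : row_free (with_ones P).
  by rewrite -Eg /row_free (eqmxMfull A) ?row_full_unit // rkA.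
have nN : (1 + n <= N)%N by rewrite -rkA rank_leq_col.
have [d dN] : exists d, (d + n + 1)%N = N by exists (N - (1 + n))%N; lia.
have dN' : (d + (1 + n))%N = N by lia.
have [K [fK KW HK]] := relation_basis fW dN'.
have bK : (b <= K)%MS by apply: HK; apply/ones_relP.
have [beta betaK] := map_sub_complexify bK.
subst N.
pose x0 : 'rV[C R]_(d + n + 1) := row_mx (row_mx beta 0) 0.
(* The radius of the patch is chosen below [mu] in the scale of [Ma], so that no coordinate of
   [beta K] can reach zero and the patch stays in the torus. *)
have [mu mu0 Hmu] : exists2 mu : R, 0 < mu & forall k, mu <= `|b 0 k|.
  exists (\big[Num.min/1]_k `|b 0 k|).
    by apply/bigmin_gtP; split => // k _; rewrite normr_gt0.
  by move=> k; exact: bigmin_le.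
pose Ma : 'M[C R]_(d + n + 1) := col_mx (col_mx (complexify K) 0) 0.
have du := dhypersurface_patch_unit fK KW bK Hb betaK.
have e0 : 0 < mu / (mxbound Ma + 1) by rewrite divr_gt0 // ltr_wpDl ?mxbound_ge0.
have [r /andP[r0 re] [phi /=]] := local_inverse (expmap_taylor _ _ _)
  (dexpmap_lip _ _ _) (expmap_strict _ _ _) du e0.
rewrite -/(hypersurface_patch P K) -/x0.
set V := [set x | vnorm (x - x0) < r]; set U := _ @` V.
move=> [oU phiK dphi].
pose last_idx : 'I_(d + n + 1) := rshift (d + n) ord0.
pose M := hypersurface_patch P K @` (V `&` [set x | x 0 last_idx = 0]).
exists M; split.
- exists (hypersurface_patch P K x0), x0 => //; split; last by rewrite /= /x0 row_mxEr mxE.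
  by rewrite /V /= subrr vnorm0.
- split; first by rewrite leq_subr.
  move=> _ [x [Vx xl] <-].
  exists U, V, phi, (hypersurface_patch P K); split.
  + by split=> //; exists x.
  + exact: open_vball.
  + by split=> [z Uz|z _]; [exact: dphi|exact: expmap_differentiable].
  + split=> [_ [y Vy <-]|y Vy]; first by rewrite phiK.
    by split; [exists y|rewrite phiK].
  + move=> _ [y Vy <-]; rewrite phiK //; split=> [[y' [Vy' yl']] e|H].
      have -> : y = y' by rewrite -(phiK _ Vy) -e phiK.
      move=> j dj; rewrite -[RHS]yl'; congr (_ _ _); apply/val_inj => /=.
      by have := ltn_ord j; move: dj; lia.
    by exists y => //; split=> //; apply: H; rewrite /= addn0 addnK.
move=> _ [x [Vx xl] <-].
apply/(dual_varietyP _ gu Eg).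
have pE k : hypersurface_patch P K x 0 k = (lsubmx (lsubmx x) *m complexify K) 0 k *
    expC (- (rsubmx (lsubmx x) *m complexify P) 0 k).
  by rewrite hypersurface_patchE xl addr0.
have cn0 k : (lsubmx (lsubmx x) *m complexify K) 0 k != 0.
  have E (y : 'rV[C R]_(d + n + 1)) : y *m Ma = lsubmx (lsubmx y) *m complexify K.
    by have [] := mul_hypersurface_patch P K y.
  apply/negP => /eqP z.
  have : modulus (((x - x0) *m Ma) 0 k) = `|b 0 k|.
    have mB (y y' : 'rV[C R]_(d + n + 1)) : (y - y') 0 k = y 0 k - y' 0 k by rewrite !mxE.
    have bE : complexify b 0 k = (b 0 k)%:C by rewrite mxE.
    by rewrite mulmxBl !E mB z /x0 !row_mxKl betaK bE sub0r modulusN modulus_real.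
  apply/eqP; rewrite lt_eqF // (lt_le_trans _ (Hmu k)) //.
  rewrite (le_lt_trans (modulus_vnorm _ _ _)) // (le_lt_trans (vnormM _ _)) //.
  have M1 : 0 < mxbound Ma + 1 by rewrite ltr_wpDl ?mxbound_ge0.
  have Vr : vnorm (x - x0) < r := Vx.
  rewrite (@le_lt_trans _ _ ((mxbound Ma + 1) * vnorm (x - x0))) //.
    by rewrite ler_wpM2r ?vnorm_ge0 // lerDl.
  by rewrite mulrC -ltr_pdivlMr // (lt_le_trans Vr).
split.
  by move=> k; rewrite pE mulf_neq0 // expC_neq0.
exists (rsubmx (lsubmx x)).
have -> : \row_k (hypersurface_patch P K x 0 k * expC ((rsubmx (lsubmx x) *m complexify P) 0 k)) =
    lsubmx (lsubmx x) *m complexify K.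
  by apply/rowP => k; rewrite mxE pE -mulrA expCN mulr1.
by rewrite -mulmxA basis_relation // mulmx0.
Qed.

(** * Images of everywhere singular maps *)

Lemma eq_ler (F : numDomainType) (x y : F) : x = y -> x <= y.
Proof. by move->. Qed.

Section Quantize.
Variables (R : realType) (L e : nat) (s B : R).
Hypotheses (s0 : 0 < s) (se : s * (B + B) <= e%:R).

(** Cells have side [1 / s]. By [se], the cell numbers of rows of norm at most [B] do not exceed
    [e], so [inord] keeps them. *)
Definition quantize (u : 'rV[R]_L) : {ffun 'I_L -> 'I_e.+1} :=
  [ffun l => inord (Num.truncn (s * (u 0 l + B)))].

Definition quantum (q : {ffun 'I_L -> 'I_e.+1}) : 'rV[R]_L :=
  \row_l ((q l)%:R / s - B).

Lemma quantizeK u : `|u| <= B -> `|u - quantum (quantize u)| <= s^-1.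
Proof.
move=> uB; have B0 : 0 <= B := le_trans (normr_ge0 _) uB.
have ul l : `|u 0 l| <= B by move: l; apply/(norm_row_le _ B0).
apply/norm_row_le => [|l]; first by rewrite invr_ge0 ltW.
have /ler_normlP[u1 u2] := ul l.
have p0 : 0 <= s * (u 0 l + B) by apply: mulr_ge0; [exact: ltW|lra].
have /andP[t1 t2] := truncn_itv p0.
move: t1 t2; rewrite !mxE !ffunE; set t := Num.truncn _ => t1 t2.
have tle : (t < e.+1)%N.
  rewrite ltnS -(ler_nat R) (le_trans t1) // (le_trans _ se) // ler_pM2l //.
  by rewrite lerD2r.
rewrite inordK //.
have -> : u 0 l - (t%:R / s - B) = (s * (u 0 l + B) - t%:R) / s.
  by field; rewrite gt_eqF.
rewrite normrM [X in _ * X]gtr0_norm ?invr_gt0 // ler_piMl ?invr_ge0 ?(ltW s0) //.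
by rewrite ger0_norm ?subr_ge0 // lerBlDr nat1r ltW.
Qed.

Lemma quantize_eq u v : `|u| <= B -> `|v| <= B -> quantize u = quantize v ->
  `|u - v| <= 2 / s.
Proof.
move=> uB vB q; have h1 := quantizeK uB; have h2 := quantizeK vB.
rewrite (le_trans (ler_distD (quantum (quantize u)) _ _)) //.
by rewrite mulr2n mulrDl mul1r lerD // distrC q.
Qed.
End Quantize.

Lemma norm_le_vnorm (R : realType) N (u : 'rV[R]_(N + N)) : `|u| <= vnorm (of_real u).
Proof.
apply/norm_row_le => [|k]; first exact: vnorm_ge0.
case: (split_ordP k) => j ->.
  by rewrite (le_trans _ (modulus_vnorm _ 0 j)) // mxE (le_trans _ (modulus_Re _)).
by rewrite (le_trans _ (modulus_vnorm _ 0 j)) // mxE (le_trans _ (modulus_Im _)).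
Qed.

(** * Covering the image of an everywhere singular map *)

Section SingularCover.
Variables (R : realType) (D N : nat) (F : 'rV[C R]_D.+1 -> 'rV[C R]_N).
Variable dF : 'rV[C R]_D.+1 -> 'M[C R]_(D.+1, N).
Hypothesis Flip : forall r, exists2 K : R, 0 <= K & forall x y,
  vnorm x <= r -> vnorm y <= r -> vnorm (F x - F y) <= K * vnorm (x - y).
Hypothesis strict : forall r, exists2 K : R, 0 <= K & forall x0 x y s,
  vnorm x0 <= r -> vnorm (x - x0) <= s -> vnorm (y - x0) <= s -> s <= r ->
  vnorm (F x - F y - (x - y) *m dF x0) <= K * s * vnorm (x - y).
Hypothesis singular : forall x, exists2 h : 'rV_D.+1, h != 0 & h *m dF x = 0.

Lemma unit_kernel x : exists i (h : 'rV[C R]_D.+1),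
  [/\ h 0 i = 1, vnorm h <= 1 & h *m dF x = 0].
Proof.
have [h h0 hF] := singular x.
have [i _ iP] := @arg_maxP _ R _ (ord0 : 'I_D.+1) xpredT (fun j => modulus (h 0 j)) isT.
have hi : h 0 i != 0.
  apply: contra h0 => /eqP hi; apply/eqP/rowP => j; rewrite mxE; apply/eqP.
  by rewrite -modulus_eq0 eq_le modulus_ge0 andbT (le_trans (iP j isT)) // hi modulus0.
exists i, ((h 0 i)^-1 *: h); split; first by rewrite mxE mulVf.
  apply: vnorm_le => // k j; rewrite ord1 mxE modulusM modulusV mulrC.
  have hi0 : 0 < modulus (h 0 i) by rewrite lt0r modulus_ge0 modulus_eq0 hi.
  by rewrite ler_pdivrMr // mul1r; exact: iP.
by rewrite -scalemxAl hF scaler0.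
Qed.

(* In a cube of side [1 / K], sliding along the kernel of the differential at the
   center changes [F] by [O(1 / K^2)] only and kills one complex coordinate; so
   [O(K^(2 (D + 1)) * K^(2 D))] sets of diameter [O(1 / K^2)] cover the image. *)
Lemma singular_cover (k : nat) : exists2 c : R, 0 <= c & forall K : nat, (0 < K)%N ->
  exists lab : 'rV[C R]_D.+1 -> {ffun 'I_(D.+1 + D.+1) -> 'I_(2 * k * K).+1} *
                                {ffun 'I_(D + D) -> 'I_(8 * K).+1},
  forall x y, vnorm x <= k%:R -> vnorm y <= k%:R -> lab x = lab y ->
    vnorm (F x - F y) <= c / K%:R ^+ 2.
Proof.
have [c1 c10 Hlip] := Flip (k%:R + 10).
have [c2 c20 Hstr] := strict (k%:R + 10).
(* Each of the two slides costs [c2 (4 / K) (2 / K)], and the slid points are at distance at most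
   [4 / K^2], where [c1] is a Lipschitz constant. The radius [k + 10] leaves room for the centers
   and the slid points. *)
exists (16 * c2 + 4 * c1); first by rewrite addr_ge0 // mulr_ge0.
move=> K K0; have KR : (0 : R) < K%:R by rewrite ltr0n.
have K1 : (1 : R) <= K%:R by rewrite ler1n.
have Ki : K%:R^-1 <= 1 :> R by rewrite invf_le1.
pose cube (x : 'rV[C R]_D.+1) := quantize (2 * k * K) K%:R k%:R (to_real x).
pose center (x : 'rV[C R]_D.+1) : 'rV[C R]_D.+1 := of_real (quantum K%:R k%:R (cube x)).
have /choice[di Hdi] : forall x, exists ih : 'I_D.+1 * 'rV[C R]_D.+1,
    [/\ ih.2 0 ih.1 = 1, vnorm ih.2 <= 1 & ih.2 *m dF x = 0].
  by move=> x; have [i [h H]] := unit_kernel x; exists (i, h).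
pose i_ (x : 'rV[C R]_D.+1) := (di (center x)).1.
pose h_ (x : 'rV[C R]_D.+1) := (di (center x)).2.
(* As [h_ x] has coordinate 1 at [i_ x], sliding brings this coordinate to that of the center. Only
   [D] coordinates, of size at most [4 / K], remain to be recorded with mesh [K^-2], hence the
   [8 * K] cells. *)
pose slide (x : 'rV[C R]_D.+1) := x - (x - center x) 0 (i_ x) *: h_ x.
pose rest (x : 'rV[C R]_D.+1) : 'rV[C R]_D := \row_j (slide x - center x) 0 (lift (i_ x) j).
pose lab2 (x : 'rV[C R]_D.+1) := quantize (8 * K) (K%:R ^+ 2) (4 / K%:R) (to_real (rest x)).
have se1 : K%:R * (k%:R + k%:R) <= (2 * k * K)%:R :> R.
  by rewrite -natrD -natrM ler_nat; lia.
have se2 : K%:R ^+ 2 * (4 / K%:R + 4 / K%:R) <= (8 * K)%:R :> R.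
  by rewrite natrM; apply: eq_ler; field; rewrite gt_eqF.
exists (fun x => (cube x, lab2 x)).
have near_center x : vnorm x <= k%:R -> vnorm (x - center x) <= 2 / K%:R.
  move=> xk; rewrite /center -[X in X - _]to_realK of_realB.
  rewrite (le_trans (vnorm_of_real _)) // ler_pM2l // quantizeK //.
  by rewrite (le_trans (norm_to_real _)).
have coef x : vnorm x <= k%:R -> modulus ((x - center x) 0 (i_ x)) <= 2 / K%:R.
  by move=> xk; rewrite (le_trans (modulus_vnorm _ _ _)) // near_center.
have slide_dist x : vnorm x <= k%:R -> vnorm (x - slide x) <= 2 / K%:R.
  move=> xk; have [_ h1 _] := Hdi (center x).
  rewrite /slide subKr vnormZ -[leRHS]mulr1.
  by apply: ler_pM; rewrite ?modulus_ge0 ?vnorm_ge0 ?coef.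
have slide_center x : vnorm x <= k%:R -> vnorm (slide x - center x) <= 4 / K%:R.
  move=> xk; rewrite (le_trans (vnormBD _ x _)) // vnormB.
  rewrite (le_trans (lerD (slide_dist _ xk) (near_center _ xk))) // -mulrDl.
  by rewrite ler_pM2r ?invr_gt0 // -natrD.
have K4 : 4 / K%:R <= 4 :> R by rewrite ler_piMr.
have K2 : 2 / K%:R <= 2 :> R by rewrite ler_piMr.
have center_k x : vnorm x <= k%:R -> vnorm (center x) <= k%:R + 10.
  move=> xk; rewrite -[center x](subKr x) (le_trans (vnormD _ _)) // vnormN.
  rewrite lerD // (le_trans (near_center _ xk)) // (le_trans K2) // ler_nat //.
have slide_k x : vnorm x <= k%:R -> vnorm (slide x) <= k%:R + 10.
  move=> xk; rewrite -[slide x](subKr x) (le_trans (vnormD _ _)) // vnormN.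
  rewrite lerD // (le_trans (slide_dist _ xk)) // (le_trans K2) // ler_nat //.
have F_slide x : vnorm x <= k%:R -> vnorm (F x - F (slide x)) <= 8 * c2 / K%:R ^+ 2.
  move=> xk; have [_ _ hF] := Hdi (center x).
  have := @Hstr (center x) x (slide x) (4 / K%:R) (center_k _ xk).
  have -> : (x - slide x) *m dF (center x) = 0.
    by rewrite /slide subKr -scalemxAl hF scaler0.
  rewrite subr0 => H; apply: le_trans (H _ _ _) _.
  - by rewrite (le_trans (near_center _ xk)) // ler_pM2r ?invr_gt0 // ler_nat.
  - exact: slide_center.
  - by rewrite (le_trans K4) // -[leLHS]add0r lerD // ler_nat.
  rewrite (@le_trans _ _ (c2 * (4 / K%:R) * (2 / K%:R))) //.
    by rewrite ler_wpM2l ?slide_dist // mulr_ge0 // divr_ge0.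
  by apply: eq_ler; field; rewrite gt_eqF.
have slide_i x : (slide x - center x) 0 (i_ x) = 0.
  have [h1 _ _] := Hdi (center x).
  have gen (u v h : 'rV[C R]_D.+1) i : h 0 i = 1 -> (u - (u - v) 0 i *: h - v) 0 i = 0.
    by move=> h1'; rewrite !mxE h1' mulr1; ring.
  exact: gen.
have rest_le z : vnorm z <= k%:R -> `|to_real (rest z)| <= 4 / K%:R.
  move=> zk; rewrite (le_trans (norm_to_real _)) //.
  apply: vnorm_le => [|a j]; first by rewrite divr_ge0.
  by rewrite mxE (le_trans (modulus_vnorm _ _ _)) // slide_center.
have K20 : (0 : R) < K%:R ^+ 2 by rewrite exprn_gt0.
move=> x y xk yk eqxy.
have ec : center x = center y by exact: (congr1 (fun q => of_real (quantum _ _ q.1)) eqxy).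
have close := quantize_eq K20 se2 (rest_le _ xk) (rest_le _ yk) (congr1 snd eqxy).
clear eqxy.
have ei : i_ x = i_ y by rewrite /i_ ec.
have dslide : vnorm (slide x - slide y) <= 4 / K%:R ^+ 2.
  apply: vnorm_le => [|a j]; first by rewrite divr_ge0 // ltW.
  rewrite ord1.
  have -> : (slide x - slide y) 0 j = (slide x - center x) 0 j - (slide y - center y) 0 j.
    by rewrite ec; move: (slide x) (slide y) (center y) => u v w; rewrite !mxE; ring.
  case: (unliftP (i_ x) j) => [j'|] ->; last first.
    rewrite {2}ei !slide_i subrr modulus0 divr_ge0 // ltW //.
  have -> : (slide x - center x) 0 (lift (i_ x) j') - (slide y - center y) 0 (lift (i_ x) j')
     = (rest x - rest y) 0 j'.
    have mB (u v : 'rV[C R]_D) : (u - v) 0 j' = u 0 j' - v 0 j' by rewrite !mxE.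
    by rewrite mB /rest ei; congr (_ - _); rewrite [RHS]mxE // ei.
  rewrite (le_trans (modulus_vnorm _ _ _)) // -(to_realK (rest x)) -(to_realK (rest y)).
  rewrite of_realB (le_trans (vnorm_of_real _)) // (le_trans (ler_wpM2l _ close)) //.
  by apply: eq_ler; field; rewrite gt_eqF.
have := Hlip (slide x) (slide y) (slide_k _ xk) (slide_k _ yk) => h2.
rewrite (le_trans (vnormBD _ (F (slide x)) _)) //.
rewrite (le_trans (lerD (F_slide _ xk) (vnormBD _ (F (slide y)) _))) //.
have h3 := F_slide _ yk; rewrite vnormB in h3.
rewrite (le_trans (lerD (lexx _) (lerD (le_trans h2 (ler_wpM2l c10 dslide)) h3))) //.
by apply: eq_ler; field; rewrite gt_eqF.
Qed.
End SingularCover.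

(** For [K = lam * t] there are at most [(m t)^(4 D + 2)] labels, against [t^(4 D + 4)] grid points.
    The complex coordinate killed by the singular differential is what leaves the spare factor
    [t^2]. *)
Lemma label_count (k lam D m t : nat) :
  m = ((2 * k * lam).+1 + (8 * lam).+1)%N -> (m ^ (D.+1 + D.+1 + (D + D)) < t)%N ->
  ((2 * k * (lam * t)).+1 ^ (D.+1 + D.+1) * (8 * (lam * t)).+1 ^ (D + D) <
    (t * t) ^ (D.+1 + D.+1))%N.
Proof.
move=> em tm; have t0 : (0 < t)%N by apply: leq_ltn_trans tm.
have le1 : ((2 * k * (lam * t)).+1 <= m * t)%N by rewrite em; nia.
have le2 : ((8 * (lam * t)).+1 <= m * t)%N by rewrite em; nia.
apply: (@leq_ltn_trans ((m * t) ^ (D.+1 + D.+1) * (m * t) ^ (D + D))).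
  have mono a b e : (a <= b -> a ^ e <= b ^ e)%N by case: e => // e; rewrite leq_exp2r.
  by apply: leq_mul; apply: mono.
rewrite -expnD expnMn mulnn -expnM.
have -> : (2 * (D.+1 + D.+1) = (D.+1 + D.+1 + (D + D)) + 2)%N by lia.
rewrite [X in (_ < X)%N]expnD mulnC ltn_pmul2l ?expn_gt0 ?t0 //.
by rewrite (leq_trans tm) // -{1}[t]expn1 leq_pexp2l.
Qed.

(** * Separated points on a patch, against the covering *)

Section NoPatch.
Variables (R : realType) (D N : nat) (F : 'rV[C R]_D.+1 -> 'rV[C R]_N).
Variable dF : 'rV[C R]_D.+1 -> 'M[C R]_(D.+1, N).
Hypothesis Flip : forall r, exists2 K : R, 0 <= K & forall x y,
  vnorm x <= r -> vnorm y <= r -> vnorm (F x - F y) <= K * vnorm (x - y).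
Hypothesis strict : forall r, exists2 K : R, 0 <= K & forall x0 x y s,
  vnorm x0 <= r -> vnorm (x - x0) <= s -> vnorm (y - x0) <= s -> s <= r ->
  vnorm (F x - F y - (x - y) *m dF x0) <= K * s * vnorm (x - y).
Hypothesis singular : forall x, exists2 h : 'rV_D.+1, h != 0 & h *m dF x = 0.
Variables (psi : 'rV[C R]_D.+1 -> 'rV[C R]_N) (v0 : 'rV[C R]_D.+1) (rho : R).
Hypothesis rho0 : 0 < rho.
Hypothesis psiF : forall v, vnorm (v - v0) < rho -> exists x, F x = psi v.
Hypothesis psi_expand : forall v, vnorm (v - v0) < rho ->
  exists K d : R, 0 < d /\ forall w, vnorm (w - v0) < rho ->
    vnorm (psi w - psi v) < d -> vnorm (w - v) <= K * vnorm (psi w - psi v).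

(** One integer bounds the size of a preimage, the expansion constant and the inverse of the scale
    on which expansion holds, so that countably many sets suffice. *)
Definition uniform_at (k : nat) v := [/\ vnorm (v - v0) < rho,
  exists2 x, vnorm x <= k%:R & F x = psi v &
  forall w, vnorm (w - v0) < rho -> vnorm (psi w - psi v) < k.+1%:R^-1 ->
    vnorm (w - v) <= k%:R * vnorm (psi w - psi v)].

Lemma uniform_at_exists v : vnorm (v - v0) < rho -> exists k, uniform_at k v.
Proof.
move=> vr; have [x Fx] := psiF vr; have [K [d [d0 H]]] := psi_expand vr.
exists (Num.truncn (vnorm x + `|K| + d^-1)).+1; set k := (_.+1)%N.
have hk : vnorm x + `|K| + d^-1 < k%:R by apply: truncnS_gt.
have x0 := vnorm_ge0 x; have K0 := normr_ge0 K.
have di : 0 < d^-1 by rewrite invr_gt0.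
have kx : vnorm x <= k%:R by lra.
have kK : `|K| <= k%:R by lra.
have kd : d^-1 <= k.+1%:R by rewrite -nat1r; lra.
split=> //; first by exists x.
move=> w wr wd; rewrite (le_trans (H _ wr _)) //.
  by rewrite (lt_le_trans wd) // invf_ple // posrE.
by rewrite ler_wpM2r ?vnorm_ge0 // (le_trans (ler_norm _)).
Qed.

(* Baire: the sets [uniform_at k] cover the ball. *)
Lemma uniform_at_dense : exists (k : nat) (u1 : 'rV[R]_(D.+1 + D.+1)) (r : R), 0 < r /\
  forall u, `|u - u1| < r -> forall e, 0 < e ->
    exists2 u', `|u - u'| < e & uniform_at k (of_real u').
Proof.
apply: contrapT => nex.
pose X : completeNormedModType R := 'rV[R]_(D.+1 + D.+1).
pose G (k : nat) : set X := [set u | uniform_at k (of_real u)].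
have OD k : open (~` closure (G k)) /\ dense (~` closure (G k)).
  split; first by apply: closed_openC; exact: closed_closure.
  move=> O [u1 Ou1] oO; apply: contrapT => nO; apply: nex.
  have /nbhs_normP[r /= r0 Hr] : nbhs u1 O by exact: open_nbhs_nbhs.
  exists k, u1, r; split=> // u ur e e0.
  have clu : closure (G k) u.
    apply: contrapT => nu; apply: nO; exists u; split=> //.
    by apply: Hr; rewrite /ball_ /= distrC.
  have [|u' [Gu' eu']] := clu (ball_ Num.norm u e).
    by apply: nbhs_le_nbhs_norm; exists e.
  by exists u'.
have := Baire OD; pose B : set X := [set u | vnorm (of_real u - v0) < rho].
move=> /(_ B)[||u [Bu Ou]].
- by exists (to_real v0); rewrite /B /= to_realK subrr vnorm0.
- rewrite openE => u Bu; apply: nbhs_le_nbhs_norm.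
  exists ((rho - vnorm (of_real u - v0)) / 2); first by rewrite /= divr_gt0 // subr_gt0.
  move=> u'; rewrite /ball_ /= distrC ltr_pdivlMr // mulrC ltrBrDr => h.
  rewrite /B /= (le_lt_trans (vnormBD _ (of_real u) _)) // (le_lt_trans _ h) //.
  by rewrite lerD2r of_realB vnorm_of_real.
have [k Hk] := uniform_at_exists Bu.
by apply: (Ou k I); apply: subset_closure.
Qed.

Lemma natr_dist (a b' : nat) : a != b' -> 1 <= `|a%:R - b'%:R| :> R.
Proof.
case: ltngtP => // ab _; last by rewrite -natrB 1?ltnW // ger0_norm // ler1n subn_gt0.
by rewrite distrC -natrB 1?ltnW // ger0_norm // ler1n subn_gt0.
Qed.

(* A grid of [(t^2)^(2 (D + 1))] points of the patch has images at mutual distance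
   at least a constant times [t^-2], more than [singular_cover] allows for [K]
   proportional to [t]. *)
Lemma no_expanding_patch : False.
Proof.
have [k [u1 [r [r0 dense]]]] := uniform_at_dense.
have [c c0 cover] := singular_cover Flip strict singular k.
(* Two grid points with equal labels would give [r / 4 <= k c / lam^2], which this [lam] excludes.
   It also makes [c / K^2] less than [1 / (k + 1)], the scale on which [uniform_at] applies. *)
pose lam := (Num.truncn (c * k.+1%:R * (1 + 16 / r))).+1.
have lam0 : (0 < lam)%N by [].
have lamb : c * k.+1%:R * (1 + 16 / r) < lam%:R by apply: truncnS_gt.
pose m := ((2 * k * lam).+1 + (8 * lam).+1)%N.
pose t := (m ^ (D.+1 + D.+1 + (D + D))).+1.
have t0 : (0 < t)%N by [].
pose K := (lam * t)%N; pose J := (t * t)%N.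
have K0 : (0 < K)%N by rewrite muln_gt0.
have J0 : (0 : R) < J%:R by rewrite ltr0n muln_gt0.
have lamK : lam%:R <= K%:R ^+ 2 :> R.
  by rewrite -natrX ler_nat /K; nia.
have [lab Hlab] := cover K K0.
pose grid (I : {ffun 'I_(D.+1 + D.+1) -> 'I_J}) : 'rV[R]_(D.+1 + D.+1) :=
  u1 + \row_l ((I l)%:R * (r / 2 / J%:R)).
have grid_in I : `|grid I - u1| < r.
  rewrite /grid addrAC subrr add0r (@le_lt_trans _ _ (r / 2)) //; last by lra.
  apply/norm_row_le => [|l]; first by rewrite divr_ge0 // ltW.
  rewrite mxE ger0_norm; last by rewrite mulr_ge0 // !divr_ge0 // ltW.
  by rewrite mulrCA ler_piMr ?divr_ge0 ?(ltW r0) // ler_pdivrMr // mul1r ler_nat ltnW.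
(* Uniform points are only dense, so grid points are moved by less than a quarter of the spacing
   [r / (2 J)]; half of the separation survives. *)
have e0 : 0 < r / 8 / J%:R by rewrite !divr_gt0.
have /choice[g Hg] : forall I, exists u',
    `|grid I - u'| < r / 8 / J%:R /\ uniform_at k (of_real u').
  by move=> I; have [u' h1 h2] := dense _ (grid_in I) _ e0; exists u'.
have /choice[x Hx] : forall I, exists x, vnorm x <= k%:R /\ F x = psi (of_real (g I)).
  by move=> I; have [_ [_ [x h1 h2] _]] := Hg I; exists x.
have inj : injective (fun I => lab (x I)).
  move=> I I' /= eqlab; apply/ffunP => l; apply/val_inj/eqP; apply: contraT => ne.
  have [xI FI] := Hx I; have [xI' FI'] := Hx I'.
  have := Hlab _ _ xI xI' eqlab; rewrite FI FI' => close.
  have [gI [bI _ lipI]] := Hg I; have [gI' [bI' _ _]] := Hg I'.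
  have sep : r / 2 / J%:R <= `|grid I - grid I'|.
    have := (norm_row_le (grid I - grid I') (normr_ge0 _)).1 (lexx _) l.
    apply: le_trans; rewrite !mxE opprD addrACA subrr add0r -mulrBl normrM.
    rewrite [X in _ <= _ * X]gtr0_norm ?divr_gt0 // ler_peMl ?divr_ge0 ?(ltW r0) //.
    exact: natr_dist.
  have gsep : r / 4 / J%:R <= `|g I - g I'|.
    have h1 := ler_distD (g I) (grid I) (grid I').
    have h2 := ler_distD (g I') (g I) (grid I').
    rewrite distrC in gI'.
    have -> : r / 4 / J%:R = r / 2 / J%:R - r / 8 / J%:R - r / 8 / J%:R.
      by field; rewrite gt_eqF.
    lra.
  have gv : `|g I - g I'| <= vnorm (of_real (g I') - of_real (g I)).
    by rewrite distrC (le_trans (norm_le_vnorm _)) // of_realB.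
  rewrite vnormB in close.
  have ck : c / K%:R ^+ 2 < k.+1%:R^-1.
    rewrite ltr_pdivrMr ?exprn_gt0 ?ltr0n // mulrC ltr_pdivlMr ?ltr0Sn //.
    rewrite (lt_le_trans _ lamK) // (le_lt_trans _ lamb) // ler_peMr //.
      by rewrite mulr_ge0.
    by rewrite lerDl divr_ge0 // ltW.
  have := lipI _ bI' (le_lt_trans close ck) => h.
  have : r / 4 / J%:R <= k%:R * (c / K%:R ^+ 2).
    rewrite (le_trans gsep) // (le_trans gv) // (le_trans h) // ler_wpM2l //.
  have -> : c / K%:R ^+ 2 = c / lam%:R ^+ 2 / J%:R.
    by rewrite /K /J !natrM; field; rewrite ?gt_eqF ?ltr0n.
  rewrite mulrA ler_pM2r ?invr_gt0 // mulrA ler_pdivlMr ?exprn_gt0 ?ltr0n // => h5.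
  have lam1 : 1 <= lam%:R :> R by rewrite ler1n.
  have hl : lam%:R <= lam%:R ^+ 2 :> R by rewrite expr2 ler_peMr.
  have h6 : r / 4 * lam%:R <= k%:R * c.
    by rewrite (le_trans _ h5) // ler_wpM2l // divr_ge0 // ltW.
  have h7 : r * (c * k.+1%:R * (1 + 16 / r)) < r * lam%:R by rewrite ltr_pM2l.
  have e7 : r * (c * k.+1%:R * (1 + 16 / r)) = c * k.+1%:R * (r + 16).
    by field; rewrite gt_eqF.
  rewrite e7 -natr1 in h7.
  have k0 : 0 <= c * k%:R by rewrite mulr_ge0.
  have h8 : 0 <= c * (k%:R + 1) * r by rewrite mulr_ge0 ?(ltW r0) // mulr_ge0 // addr_ge0.
  have h9 : c * (k%:R + 1) * (r + 16) = c * (k%:R + 1) * r + 16 * (c * k%:R) + 16 * c by ring.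
  rewrite h9 in h7; exfalso; move: h6 h7; rewrite [k%:R * c]mulrC.
  have -> : r / 4 * lam%:R = r * lam%:R / 4 by ring.
  lra.
have := leq_card _ inj; rewrite card_prod !card_ffun !card_ord leqNgt.
by rewrite (@label_count _ _ _ m).
Qed.
End NoPatch.

Lemma complex_relation (R : realType) m N d (W : 'M[R]_(m, N)) (K : 'M[R]_(d, N))
    (b : 'rV[C R]_N) :
  (d + m)%N = N -> row_free W -> row_free K -> K *m W^T = 0 ->
  b *m (complexify W)^T = 0 -> exists beta, b = beta *m complexify K.
Proof.
move=> dN fW fK KW bW.
have rk : \rank (kermx (complexify W)^T) = d.
  by rewrite mxrank_ker mxrank_tr !complexifyE mxrank_map (eqP fW) -dN addnK.
have KK : (complexify K <= kermx (complexify W)^T)%MS.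
  by apply/sub_kermxP; rewrite !complexifyE map_trmx -map_mxM KW map_mx0.
have : (kermx (complexify W)^T <= complexify K)%MS.
  by rewrite -(mxrank_leqif_sup KK) rk complexifyE mxrank_map (eqP fK).
have /sub_kermxP/submx_trans bK := bW.
by move/bK/submxP.
Qed.

Lemma no_expanding_patch_pos (R : realType) (m N : nat) (F : 'rV[C R]_m -> 'rV[C R]_N)
    (dF : 'rV[C R]_m -> 'M[C R]_(m, N)) (psi : 'rV[C R]_m -> 'rV[C R]_N)
    (v0 : 'rV[C R]_m) (rho : R) :
  (0 < m)%N ->
  (forall r, exists2 K : R, 0 <= K & forall x y,
    vnorm x <= r -> vnorm y <= r -> vnorm (F x - F y) <= K * vnorm (x - y)) ->
  (forall r, exists2 K : R, 0 <= K & forall x0 x y s,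
    vnorm x0 <= r -> vnorm (x - x0) <= s -> vnorm (y - x0) <= s -> s <= r ->
    vnorm (F x - F y - (x - y) *m dF x0) <= K * s * vnorm (x - y)) ->
  (forall x, exists2 h : 'rV_m, h != 0 & h *m dF x = 0) ->
  0 < rho ->
  (forall v, vnorm (v - v0) < rho -> exists x, F x = psi v) ->
  (forall v, vnorm (v - v0) < rho ->
    exists K d : R, 0 < d /\ forall w, vnorm (w - v0) < rho ->
    vnorm (psi w - psi v) < d -> vnorm (w - v) <= K * vnorm (psi w - psi v)) ->
  False.
Proof.
case: m F dF psi v0 => // D F dF psi v0 _ h1 h2 h3 h4 h5 h6.
exact: (no_expanding_patch h1 h2 h3 h4 h5 h6).
Qed.

(** * The Horn-Kapranov map when all Hessians are degenerate *)

Section HornKapranov.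
Variables (R : realType) (n d : nat).
Let N := (n + d + 1)%N.
Variables (P : 'M[R]_(n, N)) (K : 'M[R]_(d, N)).
Hypothesis n0 : (0 < n)%N.
Hypothesis fW : row_free (with_ones P).
Hypothesis fK : row_free K.
Hypothesis KW : K *m (with_ones P)^T = 0.
Hypothesis sing : forall b : 'rV[C R]_N, b *m (complexify (with_ones P))^T = 0 ->
  \det (gram (complexify P) b) = 0.

Let KC := complexify K.
Let PC := complexify P.
Let Ma : 'M[C R]_(n + d, N) := col_mx 0 KC.
Let Ml : 'M[C R]_(n + d, N) := col_mx (- PC) 0.

(* The Horn-Kapranov parametrization [(w, beta) |-> (beta K) e^{- w P}]. *)
Definition horn := expmap Ma Ml 0.
Definition dhorn := dexpmap Ma Ml 0.

Lemma mul_horn (x : 'rV[C R]_(n + d)) :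
  x *m Ma = rsubmx x *m KC /\ x *m Ml = - (lsubmx x *m PC).
Proof.
split; first by rewrite -{1}[x]hsubmxK mul_row_col !mulmx0 !add0r.
by rewrite -{1}[x]hsubmxK mul_row_col !mulmx0 !addr0 mulmxN.
Qed.

Lemma hornE x k : horn x 0 k =
  (rsubmx x *m KC) 0 k * expC (- (lsubmx x *m PC) 0 k).
Proof.
have [e1 e2] := mul_horn x.
have n0' (y : 'rV[C R]_N) : (- y) 0 k = - y 0 k by rewrite mxE.
have z0 : (0 : 'rV[C R]_N) 0 k = 0 by rewrite mxE.
by rewrite /horn expmapE e1 e2 n0' mulmx0 z0 addr0.
Qed.

(** If [om] is in the kernel of [H(b)], the coordinatewise product of [om P] and [b] is again a
    relation, say [be K]. In the direction [(om, be)] the two terms of the differential cancel. *)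
Lemma dhorn_singular x : exists2 h : 'rV[C R]_(n + d), h != 0 & h *m dhorn x = 0.
Proof.
set b := rsubmx x *m KC.
have KCW : KC *m (complexify (with_ones P))^T = 0.
  by rewrite /KC !complexifyE map_trmx -map_mxM KW map_mx0.
have bW : b *m (complexify (with_ones P))^T = 0 by rewrite -mulmxA KCW mulmx0.
have onesE := complexify_ones P.
have := bW; rewrite onesE => /ones_relP[b1 bP].
have [om om0 omH] : exists2 om : 'rV[C R]_n, om != 0 & om *m gram PC b = 0.
  have : ~~ row_free (gram PC b) by rewrite row_free_unit unitmxE unitfE sing // eqxx.
  rewrite -kermx_eq0 => /rowV0Pn[om /sub_kermxP omH om0].
  by exists om.
have relW : (om *m PC *m diag_mx b) *m (complexify (with_ones P))^T = 0.
  rewrite onesE; apply/ones_relP; split; last by rewrite -omH /gram !mulmxA.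
  have : om *m (b *m PC^T)^T = 0 by rewrite bP trmx0 mulmx0.
  rewrite trmx_mul trmxK mulmxA => /matrixP/(_ 0 0); rewrite [LHS]mxE [RHS]mxE => e.
  have t (y : 'rV[C R]_N) k : y^T k 0 = y 0 k by rewrite mxE.
  rewrite -[RHS]e; apply: eq_bigr => k _; rewrite t mul_mx_diag.
  by move: (om *m PC) => u; rewrite mxE.
have dN : (d + (1 + n))%N = N by rewrite /N; lia.
have [be Ebe] := complex_relation dN fW fK KW relW.
exists (row_mx om be).
  by apply: contra om0; rewrite -row_mx0 => /eqP/eq_row_mx[-> _].
apply/rowP => k; rewrite [RHS]mxE.
have [a1 a2] := mul_horn x; have [h1 h2] := mul_horn (row_mx om be).
rewrite row_mxKl in h2; rewrite row_mxKr -Ebe in h1.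
have := dexpmapE Ma Ml 0 x (row_mx om be) k; rewrite -/dhorn => ->.
have n0' (y : 'rV[C R]_N) : (- y) 0 k = - y 0 k by rewrite mxE.
have z0 : (0 : 'rV[C R]_N) 0 k = 0 by rewrite mxE.
have dE (u v : 'rV[C R]_N) : (u *m diag_mx v) 0 k = u 0 k * v 0 k.
  by rewrite mul_mx_diag mxE.
rewrite h1 h2 a1 -/b n0' mulmx0 z0 addr0 dE.
have gen (u v w : C R) : (u * v + v * - u) * w = 0 by ring.
exact: gen.
Qed.

Theorem horn_no_hypersurface (M : set 'rV[C R]_N) :
  M !=set0 -> complex_submanifold (N - 1) M ->
  (forall z, M z -> exists x, horn x = z) -> False.
Proof.
move=> [p Mp] [_ Msub] Mhorn.
have [U [V [phi [psi [[oU Up] oV [dphi dpsi] [phiK psiK] Mphi]]]]] := Msub p Mp.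
(* Since [N - 1 = n + d], the slice is the vanishing of the last coordinate. Then [psi] after [emb]
   parametrizes [M] by as many variables as [horn] has. *)
pose emb (v : 'rV[C R]_(n + d)) : 'rV[C R]_N := row_mx v 0.
have phi_last z : U z -> M z -> phi z = emb (lsubmx (phi z)).
  move=> Uz Mz; rewrite -{1}[phi z]hsubmxK /emb; congr row_mx.
  apply/rowP => j; rewrite [LHS]mxE [RHS]mxE (iffLR (Mphi z Uz) Mz) //.
  by rewrite /= /N ord1; lia.
have vemb v w : vnorm (emb v - emb w) = vnorm (v - w).
  apply/eqP; rewrite eq_le; apply/andP; split.
    apply: vnorm_le => [|i j]; first exact: vnorm_ge0.
    rewrite ord1 /emb opp_row_mx add_row_mx subrr.
    case: (split_ordP j) => j' ->; rewrite ?row_mxEl ?row_mxEr.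
      exact: modulus_vnorm.
    by rewrite mxE modulus0 vnorm_ge0.
  apply: vnorm_le => [|i j]; first exact: vnorm_ge0.
  rewrite (_ : (v - w) i j = (emb v - emb w) i (lshift 1 j)) ?modulus_vnorm //.
  by rewrite /emb opp_row_mx add_row_mx row_mxEl.
pose v0 := lsubmx (phi p).
have V0 : V (emb v0) by rewrite -phi_last //; have [] := phiK p Up.
have /open_vnormP/(_ _ V0)[rho rho0 Hrho] := oV.
have inV v : vnorm (v - v0) < rho -> V (emb v).
  by move=> vr; apply: Hrho; rewrite vemb.
have psiM v : vnorm (v - v0) < rho -> M (psi (emb v)).
  move=> vr; have [Uz Ez] := psiK _ (inV v vr); apply/(Mphi _ Uz) => j dj.
  rewrite Ez /emb; case: (split_ordP j) dj => j' -> /=; last by rewrite row_mxEr mxE.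
  by rewrite /N; have := ltn_ord j'; lia.
have psiF v : vnorm (v - v0) < rho -> exists x, horn x = psi (emb v).
  by move=> vr; apply/Mhorn/psiM.
have expand v : vnorm (v - v0) < rho -> exists K d : R, 0 < d /\
    forall w, vnorm (w - v0) < rho -> vnorm (psi (emb w) - psi (emb v)) < d ->
      vnorm (w - v) <= K * vnorm (psi (emb w) - psi (emb v)).
  move=> vr; have [Uz Ez] := psiK _ (inV v vr).
  have [L [e e0 HL]] := differentiable_lipschitz (dphi _ Uz).
  exists L, e; split=> // w wr we; rewrite -vemb -{1}Ez.
  by have [_ {1}<-] := psiK _ (inV w wr); apply: HL.
have nd : (0 < n + d)%N by rewrite addn_gt0 n0.
exact: (no_expanding_patch_pos nd (expmap_lip Ma Ml 0) (expmap_strict Ma Ml 0)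
  dhorn_singular rho0 psiF expand).
Qed.

End HornKapranov.

Theorem dual_defective_of_singular (R : realType) n N (A : 'M[R]_(1 + n, N))
    (g : 'M[R]_(1 + n)) (P : 'M[R]_(n, N)) :
  (0 < n)%N -> \rank A = (1 + n)%N -> g \in unitmx -> g *m A = with_ones P ->
  (forall b : 'rV[C R]_N, b *m (complexify (with_ones P))^T = 0 ->
    \det (gram (complexify P) b) = 0) ->
  dual_defective A.
Proof.
move=> n0 rkA gu Eg sing [M [M0 subM MA]].
have fW : row_free (with_ones P).
  by rewrite -Eg /row_free (eqmxMfull A) ?row_full_unit // rkA.
have nN : (1 + n <= N)%N by rewrite -rkA rank_leq_col.
have [d dN] : exists d, (n + d + 1)%N = N by exists (N - (1 + n))%N; lia.
have dN' : (d + (1 + n))%N = N by lia.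
have [K [fK KW HK]] := relation_basis fW dN'.
subst N.
apply: (horn_no_hypersurface n0 fW fK KW sing M0 subM) => z /MA.
move=> /(dual_varietyP _ gu Eg)[_ [w Hw]].
have [be Ebe] := complex_relation dN' fW fK KW Hw.
exists (row_mx w be); apply/rowP => k.
rewrite hornE row_mxKl row_mxKr -Ebe [X in X * _]mxE -mulrA.
by rewrite -expCD addrN expC0 mulr1.
Qed.

(** * The theorem *)

Lemma det_gram_line (F : fieldType) n N (P : 'M[F]_(n, N)) (x y : 'rV[F]_N) :
  exists p : {poly F}, forall t, \det (gram P (x + t *: y)) = p.[t].
Proof.
exists (\det (map_mx polyC (gram P x) + 'X *: map_mx polyC (gram P y))) => t.
rewrite -horner_evalE -det_map_mx; congr (\det _).
have -> : gram P (x + t *: y) = gram P x + t *: gram P y.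
  rewrite /gram -!mulmxA scalemxAr -mulmxDr; congr (_ *m _).
  by rewrite scalemxAl -mulmxDl; congr (_ *m _); rewrite linearD linearZ.
by apply/matrixP => i j; rewrite !mxE /= /horner_eval hornerD hornerM hornerX !hornerC.
Qed.

Lemma complement_row (F : fieldType) n (u : 'rV[F]_(1 + n)) : u != 0 ->
  exists W : 'M[F]_(n, 1 + n), (col_mx u W : 'M[F]_(1 + n)) \in unitmx.
Proof.
move=> u0; have rk : \rank (u^C)%MS = n by rewrite mxrank_compl rank_rV u0 addKn.
have [W [fW eW]] := row_base_rank rk; exists W.
rewrite -row_full_unit -sub1mx -addsmxE; have := addsmx_compl_full u.
by rewrite -sub1mx (adds_eqmx (eqmx_refl u) eW).
Qed.

(* If all relations vanish at [k], then [delta_mx 0 k] is an affine function on the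
   points, and its linear part lies in the kernel of [gram P b]. *)
Lemma relation_full_support (F : fieldType) n N (P : 'M[F]_(n, N)) (b : 'rV_N) k :
  (1 < N)%N -> nondegenerate_relation P b ->
  exists2 c : 'rV_N, c *m (with_ones P)^T = 0 & c 0 k != 0.
Proof.
move=> N1 [b1 bP Hb]; apply: contrapT => nc.
have ck (c : 'rV_N) : c *m (with_ones P)^T = 0 -> c 0 k = 0.
  by move=> cW; apply/eqP/negPn/negP => nz; apply: nc; exists c.
have bk : b 0 k = 0 by apply: ck; apply/ones_relP.
have /submxP[v Ev] : ((delta_mx 0 k : 'rV_N) <= with_ones P)%MS.
  rewrite submxE -rowE; apply/eqP/rowP => j; rewrite mxE [RHS]mxE.
  rewrite -[LHS](_ : (col j (cokermx (with_ones P)))^T 0 k = _); last by rewrite !mxE.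
  by apply: ck; rewrite -trmx_mul colE mulmxA mulmx_coker mul0mx trmx0.
have one_rel : (const_mx 1 : 'rV_N) *m diag_mx b = b.
  by apply/rowP => j; rewrite mul_mx_diag !mxE mul1r.
rewrite -[v]hsubmxK /with_ones mul_row_col [lsubmx v]mx11_scalar mul_scalar_mx in Ev.
set v0 := lsubmx v 0 0 in Ev; set v' := rsubmx v in Ev.
have v'P : v' *m P = delta_mx 0 k - v0 *: const_mx 1 by rewrite Ev addrC addKr.
have v'0 : v' = 0.
  have uH : gram P b \in unitmx by rewrite unitmxE unitfE.
  rewrite -[LHS](mulmxK uH) /gram !mulmxA v'P 2!mulmxBl -!scalemxAl one_rel bP.
  have -> : delta_mx 0 k *m diag_mx b = 0 :> 'rV_N.
    apply/rowP => j; rewrite mul_mx_diag !mxE.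
    by case: (eqVneq j k) => [->|_]; rewrite ?andbF ?bk ?mulr0 ?mul0r.
  by rewrite scaler0 mul0mx subrr mul0mx.
rewrite v'0 mul0mx addr0 in Ev.
have [j jk] : exists j : 'I_N, j != k.
  have [->|] := eqVneq k (Ordinal N1); last by move=> ne; exists (Ordinal N1); rewrite eq_sym.
  by exists (Ordinal (ltnW N1)); rewrite -val_eqE.
move/rowP: Ev => Ev; have := Ev k; have := Ev j.
rewrite !mxE !eqxx (negbTE jk) /= mulr1 => <- /eqP.
by rewrite oner_eq0.
Qed.

Lemma nondegenerate_torus (R : realType) n N (P : 'M[R]_(n, N)) :
  (1 < N)%N -> (exists b, nondegenerate_relation P b) ->
  exists b, nondegenerate_relation P b /\ forall k, b 0 k != 0.
Proof.
move=> N1 [b ndb]; pose K := kermx (with_ones P)^T.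
(* The conditions are put on coefficient vectors [v], so that every point of a line yields a
   relation [v *m K]; [None] stands for nondegeneracy. *)
pose Q (i : option 'I_N) (v : 'rV[R]_N) :=
  if i is Some k then (v *m K) 0 k != 0 else \det (gram P (v *m K)) != 0.
have onK c : c *m (with_ones P)^T = 0 -> exists v, c = v *m K.
  by move=> /sub_kermxP/submxP.
have [||v /allP Hv] := @generic_exists _ _ _ (enum {: option 'I_N}) Q.
- case=> [k|] x y /=.
    apply: (@generic_ne0 _ _ (fun v => (v *m K) 0 k)) => x' y' t.
    by rewrite mulmxDl -scalemxAl !mxE.
  have [p Hp] := det_gram_line P (x *m K) (y *m K).
  by exists p => t; rewrite mulmxDl -scalemxAl Hp.
- case=> [k|] _ /=.
    have [c /onK[v ->] ck] := relation_full_support k N1 ndb.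
    by exists v.
  have [b1 bP Hb] := ndb; have /onK[v Ev] : b *m (with_ones P)^T = 0 by apply/ones_relP.
  by exists v; rewrite -Ev.
exists (v *m K); split; last by move=> k; apply: (Hv (Some k)); rewrite mem_enum.
have /ones_relP[? ?] : v *m K *m (with_ones P)^T = 0 by apply/sub_kermxP/submxMl.
by split=> //; apply: (Hv None); rewrite mem_enum.
Qed.

(** Since [P] is real, the real and imaginary parts [x] and [y] of [b] are relations. The polynomial
    [\det H(x + t y)] is nonzero at [t = 'i], hence at some natural number [t], where the relation
    is real. *)
Lemma real_nondegenerate (R : realType) n N (P : 'M[R]_(n, N)) (b : 'rV[C R]_N) :
  b *m (complexify (with_ones P))^T = 0 -> \det (gram (complexify P) b) != 0 ->
  exists b', nondegenerate_relation P b'.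
Proof.
move=> bW Hb.
pose x : 'rV[R]_N := \row_k complex.Re (b 0 k).
pose y : 'rV[R]_N := \row_k complex.Im (b 0 k).
have bE : b = complexify x + ('i : C R) *: complexify y.
  apply/rowP => k; rewrite !mxE; case: (b 0 k) => r s; apply/eqP.
  by rewrite eq_complex /= !(mul0r, mul1r, mulr0, subr0, add0r, addr0) !eqxx.
have E : complexify (x *m (with_ones P)^T) +
    ('i : C R) *: complexify (y *m (with_ones P)^T) = 0.
  rewrite !complexifyM scalemxAl -mulmxDl -bE -[RHS]bW; congr (_ *m _).
  by rewrite !complexifyE map_trmx.
have [xW yW] : x *m (with_ones P)^T = 0 /\ y *m (with_ones P)^T = 0.
  have gen k (v w : 'rV[R]_k) : complexify v + ('i : C R) *: complexify w = 0 ->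
      v = 0 /\ w = 0.
    move=> /rowP H; split; apply/rowP => j; have := H j; rewrite !mxE => /eqP;
    by rewrite eq_complex /= !(mul0r, mul1r, mulr0, subr0, add0r, addr0) => /andP[
      /eqP ? /eqP ?].
  exact: gen E.
have [p Hp] := det_gram_line (complexify P) (complexify x) (complexify y).
have p0 : p != 0 by apply: contraNneq Hb => p0; rewrite bE Hp p0 horner0.
have [t pt] := poly_nonroot_nat p0.
exists (x + t%:R *: y).
have /ones_relP[? ?] : (x + t%:R *: y) *m (with_ones P)^T = 0.
  by rewrite mulmxDl -scalemxAl xW yW scaler0 addr0.
split=> //; apply: contraNneq pt => d0; rewrite -Hp.
have -> : complexify x + t%:R *: complexify y = complexify (x + t%:R *: y).
  rewrite !complexifyE map_mxD map_mxZ; congr (_ + _ *: _).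
  by rewrite rmorph_nat.
have -> : gram (complexify P) (complexify (x + t%:R *: y)) =
    complexify (gram P (x + t%:R *: y)).
  by rewrite /gram !complexifyE !map_mxM map_trmx map_diag_mx.
by rewrite complexifyE det_map_mx d0 rmorph0.
Qed.

Theorem theorem6p4 (R : realType) (n N : nat) (A : 'M[R]_(1 + n, N))
    (hn : (1 <= n)%N) (hA : spectrum A) :
  dual_defective A <-> ~ contains_iterated_circuit A.
Proof.
have [rkA /submxP[u Eu]] := hA.
have N1 : (1 < N)%N by have := rank_leq_col A; rewrite rkA; lia.
have u0 : u != 0.
  apply: contra_eq_neq Eu => ->; rewrite mul0mx.
  apply/eqP => /matrixP/(_ 0 (Ordinal (ltnW N1))); rewrite !mxE.
  by apply/eqP; rewrite oner_eq0.
(* As [u *m A] is the row of ones, completing [u] to an invertible matrix normalizes the spectrum to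
   [with_ones P]. *)
have [W gu] := complement_row u0.
pose P := W *m A.
have Eg : col_mx u W *m A = with_ones P by rewrite mul_col_mx -Eu.
rewrite (contains_iterated_circuitP hA gu Eg).
split=> [DD /(nondegenerate_torus N1)[b [ndb b0]]|nd].
  exact: (not_dual_defective rkA gu Eg ndb b0).
apply: (dual_defective_of_singular hn rkA gu Eg) => b bW.
apply/eqP/negPn/negP => Hb; apply: nd.
exact: real_nondegenerate bW Hb.
Qed.
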